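(* Let $F:\,]-\infty,1[\,\to\mathbb R$ be a measurable function such that for all $0<x<y<1$ $$2F(x)+2F(y)-F\!\left(\tfrac{x}{y}\right)+2F\!\left(\tfrac{1-y}{1-x}\right)+2F\!\left(\tfrac{x(1-y)}{y(1-x)}\right)-F(xy)+2F\!\left(\tfrac{x(1-y)}{x-1}\right)+2F\!\left(\tfrac{1-y}{y(x-1)}\right)-F\!\left(\tfrac{x(1-y)^2}{y(1-x)^2}\right)=R_3(x,y),$$ where $$R_3(x,y)=2\,\mathrm{Li}_3(1)-\log(y)^2\log\!\left(\tfrac{1-y}{1-x}\right)+\tfrac{\pi^2}{3}\log(y)+\tfrac13\log(y)^3 .$$ If $F$ is differentiable at $0$, then $F=\mathrm{Li}_3$.
   Context: $\mathrm{Li}_3$ is the trilogarithm, considered as a real analytic function on $]-\infty,1[$ (the analytic continuation of $\sum_{n\ge1}z^n/n^3$), with $\mathrm{Li}_3(1)=\zeta(3)$. *)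

(* Defs.v *)
From HB Require Import structures.
From mathcomp Require Import all_boot all_order all_algebra.
From mathcomp Require Import all_classical all_reals all_analysis.
Set Implicit Arguments.
Unset Strict Implicit.
Unset Printing Implicit Defensive.
Import Order.TTheory GRing.Theory Num.Theory.
Import numFieldNormedType.Exports.
Local Open Scope classical_set_scope.
Local Open Scope ring_scope.

(* Functions on a domain D of the line are total functions R -> R whose values
   outside D are irrelevant. *)

(* Measurability for the Lebesgue (i.e. completed Borel) sigma-algebra on the
   source, which is the domain of [completed_lebesgue_measure], and the Borel
   sigma-algebra on the target.  Every Borel measurable function qualifies. *)
Definition lebesgue_measurable_fun (R : realType) (D : set R) (f : R -> R) :
    Prop :=
  @measurable_fun _ _ (caratheodory_type (@wlength R idfun)^*%mu) R D f.

Definition real_analytic_on (R : realType) (D : set R) (f : R -> R) : Prop :=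
  forall a, D a -> exists c : R^nat,
    \forall x \near a, pseries c (x - a) @ \oo --> f x.

(* [L] is the analytic continuation to ]-oo, 1[ of the sum of z^n / n^3 over
   n >= 1, together with the value zeta(3) at 1.  These conditions determine L
   on ]-oo, 1].  The term of index 0 in the series vanishes since 0^-1 = 0. *)
Definition is_trilogarithm (R : realType) (L : R -> R) : Prop :=
  [/\ real_analytic_on `]-oo, 1[ L,
      forall z : R, `|z| < 1 -> pseries (fun n => n%:R ^- 3) z @ \oo --> L z
    & series (fun n => n%:R ^- 3 : R) @ \oo --> L 1].

Definition R3 (R : realType) (Li3 : R -> R) (x y : R) : R :=
  2 * Li3 1 - ln y ^+ 2 * ln ((1 - y) / (1 - x))
  + pi ^+ 2 / 3 * ln y + ln y ^+ 3 / 3.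

(* Main.v *)
(* Write the equation as
   2 F(x) = G(y) - 2 F(y) + log(1-x) log(y)^2 - sum_i c_i F(lam_i(x) mu_i(y))
   and put alpha = F'(0).

   Regularity.  By Lusin's theorem each F(lam_i(x) mu_i(.)) depends continuously
   on x in measure, so F is continuous on ]0, 1[.  Letting x tend to 0 gives a
   three-term relation between F(y), F(1-y) and F(1-1/y), which carries
   continuity over to ]-oo, 0[.  Integrating the equation in y against a weight
   that vanishes at the endpoints of an interval moves the derivative in x onto
   the weight, whence F is differentiable on ]-oo, 1[.

   First order.  Comparing the terms of order x as x tends to 0 gives
   u F'(u) + v F'(v) = - log(1-u)^2 / 2 with v = u / (u-1).

   Second order.  With y = 1-e and e tending to 0, the three terms at x, x/y and
   xy form a symmetric second difference of F in the variable log x, of which the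
   other terms determine the limit up to an additive function of e alone.  Let
   psi(x) = F(x) - Li3(x) + (alpha-1) log(1-x).  For fixed h the function
   psi(h x) - psi(x) therefore has vanishing generalized second derivative in
   log x and tends to 0 with x, so it is 0 by Schwarz's theorem; thus
   psi(x) = lim psi(h x) = F(0) on ]0, 1[.

   Constants.  As y tends to 1 the equation gives F(1-e) -> Li3(1) - 7/2 F(0), so
   alpha = 1 and F(0) = 0.  The first-order relation then settles x < 0. *)
Require Import Defs.
From HB Require Import structures.
From mathcomp Require Import all_boot all_order all_algebra.
From mathcomp Require Import all_classical all_reals all_analysis.
From mathcomp Require Import measurable_realfun ring lra.
Set Implicit Arguments.
Unset Strict Implicit.
Unset Printing Implicit Defensive.
Import Order.TTheory GRing.Theory Num.Theory.
Import numFieldNormedType.Exports.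
Local Open Scope classical_set_scope.
Local Open Scope ring_scope.

(** * Lusin's theorem and convergence in measure *)

(** Differentiability at the single point 0 gives no second-order information there, yet the
    second-order step needs the terms whose arguments tend to 0 up to o(e^2). Two devices replace
    the missing second derivative. Differentiating an integral of F(l m(y)) in the scale l produces
    a factor 1/l. Writing F(t) = F(0) + t r(t) cancels it, and r is continuous at 0 precisely
    because F is differentiable there. Hence F' tends to F'(0) from the right, and by the
    first-order relation also from the left. Moreover the arguments of order e fall into pairs s, s'
    with s' = s/(s-1) + O(e^2), and the first-order relation determines F(s) + F(s') to second
    order, although it determines neither term alone. The additive function of e is built from
    F(1-e), whose deviation from its limit is not known to be comparable with e^2; comparing the
    points h x and x removes it without any estimate. *)

Lemma lebesgue_measurable_funN (R : realType) (D : set R) (f : R -> R) :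
  measurable D -> lebesgue_measurable_fun D f ->
  exists N : set R, [/\ measurable N, lebesgue_measure N = 0%E
    & @measurable_fun _ _ (measurableTypeR R) R (D `\` N) f].
Proof.
move=> mD mf.
(* Each set {f > q} with q rational is Borel up to a Borel null set [N q]. Outside the union of
   these countably many null sets, {f > a} is the union of the Borel sets [B q] over the rationals q
   >= a. *)
pose A (q : rat) := D `&` f @^-1` `]ratr q, +oo[%classic.
have cA q : exists B N : set R, [/\ measurable B, measurable N,
    lebesgue_measure N = 0%E & A q `\` N = B `\` N].
  have : (@wlength R idfun)^*%mu.-cara.-measurable (A q).
    by apply: mf; [exact: sub_caratheodory|exact: measurable_itv].
  rewrite -completed_caratheodory_measurable g_sigma_completed_algebra_genE.
  move=> [B mB [N [M [mM M0 NM]] BN]]; exists B, M; split => //.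
  rewrite -BN; apply/seteqP; split => x [].
    by move=> [//|/NM].
  by move=> Bx nMx; split => //; left.
have /choice[B /choice[N BN]] := cA.
(* Countable unions of negligible sets are indexed by naturals, whence the passage through
   [unpickle]; codes of no rational default to 0. *)
have NE : \bigcup_q N q = \bigcup_n N (odflt 0 (unpickle n)).
  apply/seteqP; split => x [q _ Nx]; last by exists (odflt 0 (unpickle q)).
  by exists (pickle q) => //; rewrite pickleK.
have mN : measurable (\bigcup_q N q).
  by apply: bigcupT_measurable_rat => q; case: (BN q).
exists (\bigcup_q N q); split => //.
  apply: measure_negligible => //; rewrite NE; apply: negligible_bigcup => k.
  by apply/negligibleP; case: (BN (odflt 0 (unpickle k))).
move=> mDN; apply: (measurability _ (RGenOInfty.measurableE R)) => //.
move=> _ [_ [a ->] <-].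
rewrite (_ : _ `&` _ =
    \bigcup_(q in [set q | a <= ratr q]) (B q `\` (\bigcup_r N r))).
  rewrite bigcup_mkcond; apply: bigcupT_measurable_rat => q.
  by case: ifPn => // _; apply: measurableD => //; case: (BN q).
have nNq q x : ~ (\bigcup_r N r) x -> A q x <-> B q x.
  move=> nN; have nNq : ~ N q x by move=> ?; apply: nN; exists q.
  case: (BN q) => _ _ _ /seteqP[AB BA].
  by split => [Ax|Bx]; [have [] := AB x (conj Ax nNq)|have [] := BA x (conj Bx nNq)].
apply/seteqP; split => x.
  move=> [[Dx nNx]] /=; rewrite in_itv/= andbT => /rat_in_itvoo[q].
  rewrite in_itv/= => /andP[aq qf]; exists q; first exact: ltW.
  by split => //; apply/nNq => //; split => //=; rewrite in_itv/= qf.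
move=> [q /= aq [Bx nNx]]; have /nNq-/(_ nNx)[Dx] := Bx.
rewrite /= !in_itv/= !andbT => qf; split; first by split.
exact: le_lt_trans qf.
Qed.

(** On [J] the inverse of [g] is Lipschitz with constant [k^-1]. The trace on [J] of the preimage of
    an interval therefore has diameter at most [k^-1] times its length and lies in a segment of that
    length; summing over a cover of [E] by intervals gives the bound. [lebesgue_measure] is used
    here as an outer measure. *)
Lemma outer_measure_preimage (R : realType) (g : R -> R) (J E : set R) (k : R) :
  0 < k -> (forall y z, J y -> J z -> k * `|y - z| <= `|g y - g z|) ->
  (lebesgue_measure (J `&` g @^-1` E) <= (k^-1)%:E * lebesgue_measure E)%E.
Proof.
move=> k0 kg.
have piece (A : set R) : ocitv A ->
    (lebesgue_measure (J `&` g @^-1` A) <= (k^-1)%:E * wlength idfun A)%E.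
  case/ocitvP => [->|[[a b] /= ab ->]].
    by rewrite preimage_set0 setI0 measure0 mule_ge0//= ?wlength0// lee_fin invr_ge0 ltW.
  set X := (X in lebesgue_measure X).
  have [->|/set0P[x0 Xx0]] := eqVneq X set0.
    by rewrite measure0 mule_ge0// ?lee_fin ?invr_ge0 ?ltW//; exact: wlength_itv_ge0.
  have Xd y z : X y -> X z -> `|y - z| <= (b - a) / k.
    move=> [Jy] /= + [Jz] /=; rewrite !in_itv/= => /andP[ay yb] /andP[az zb].
    rewrite ler_pdivlMr// mulrC (le_trans (kg _ _ Jy Jz))// ler_norml.
    by apply/andP; split; lra.
  have hsX : has_sup X.
    split; first by exists x0.
    exists (x0 + (b - a) / k) => y Xy.
    by have := Xd _ _ Xy Xx0; rewrite ler_norml => /andP[]; lra.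
  have hiX : has_inf X.
    split; first by exists x0.
    exists (x0 - (b - a) / k) => y Xy.
    by have := Xd _ _ Xy Xx0; rewrite ler_norml => /andP[]; lra.
  have Xsub : X `<=` `[inf X, sup X]%classic.
    move=> y Xy /=; rewrite in_itv/=; apply/andP; split.
      by apply: ge_inf => //; case: hiX.
    by apply: ub_le_sup => //; case: hsX.
  apply: (le_trans (le_outer_measure ((wlength idfun)^*)%mu _ _ Xsub)).
  rewrite wlength_itv/= lte_fin ab -EFinB -EFinM.
  rewrite (_ : ((_)^*)%mu _ = lebesgue_measure `[inf X, sup X]%classic)//.
  rewrite lebesgue_measure_itv/= lte_fin; case: ifPn => [_|_]; last first.
    by rewrite lee_fin mulr_ge0 ?invr_ge0 ?(ltW k0)// subr_ge0 ltW.
  rewrite -EFinB lee_fin lerBlDr; apply: ge_sup; first by exists x0.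
  move=> y Xy; rewrite -lerBlDl; apply: lb_le_inf; first by exists x0.
  move=> z Xz; rewrite lerBlDl -lerBlDr.
  by rewrite (le_trans (ler_norm _))// [leRHS]mulrC Xd.
have [|Eoo] := leP +oo%E (lebesgue_measure E).
  by rewrite leye_eq => /eqP ->; rewrite mulry gtr0_sg ?invr_gt0// mul1e leey.
have Efin : lebesgue_measure E \is a fin_num.
  by rewrite ge0_fin_numE//; exact: (outer_measure_ge0 ((wlength idfun)^*)%mu).
apply/lee_addgt0Pr => e e0.
have ke0 : 0 < e * k by rewrite mulr_gt0.
have /(lb_ereal_inf_adherent ke0)[_ [A [mA EA] <-]] := Efin.
move=> Ae.
apply: (@le_trans _ _ (\sum_(0 <= i <oo) lebesgue_measure (J `&` g @^-1` A i))%E).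
  apply: (@le_trans _ _ (lebesgue_measure (\bigcup_i (J `&` g @^-1` A i)))).
    apply: (le_outer_measure ((wlength idfun)^*)%mu) => y [Jy /EA[i _ Ai]].
    by exists i.
  exact: (outer_measure_sigma_subadditive ((wlength idfun)^*)%mu).
apply: (@le_trans _ _ (\sum_(0 <= i <oo) ((k^-1)%:E * wlength idfun (A i)))%E).
  apply: lee_nneseries => [i _ _|i _]; last by apply: piece; exact: mA.
  exact: (outer_measure_ge0 ((wlength idfun)^*)%mu).
rewrite nneseriesZl//.
have -> : e = k^-1 * (e * k) by rewrite mulrCA mulVf ?mulr1// gt_eqF.
rewrite EFinM -muleDr//; last by rewrite fin_num_adde_defl.
by rewrite lee_wpmul2l ?(ltW Ae)// lee_fin invr_ge0 ltW.
Qed.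

Lemma within_compact_unif_cont (R : realType) (K : set R) (f : R -> R) (e : R) :
  compact K -> {within K, continuous f} -> 0 < e ->
  exists2 d, 0 < d & forall y z, K y -> K z -> `|y - z| < d -> `|f y - f z| < e.
Proof.
move=> cK cf e0.
have /compact_near_coveringP/near_covering_withinP := cK.
(* Compactness is used as a near-covering property: a radius that works near each point of [K],
   along the filter of small positive radii, can be chosen for all of [K] at once. *)
move=> /(_ R (0:R)^'+ (fun d x => forall z, K z -> `|x - z| < d -> `|f x - f z| < e) _)[].
  move=> x Kx.
  have /subspace_continuousP/(_ x Kx)/cvgrPdist_lt/(_ (e/2)) := cf.
  rewrite divr_gt0// => /(_ isT).
  rewrite near_withinE => -[r /= r0 xr].
  exists (ball x (r / 2), `]0, r / 2[%classic).
    split; first by apply: nbhsx_ballx; rewrite divr_gt0.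
    have := @nbhs_right_lt R 0 (r / 2); rewrite divr_gt0// => /(_ isT).
    by apply: filterS2 (nbhs_right_gt 0) => t t0 tr /=; rewrite in_itv/= t0.
  move=> [y d] /= [xy]; rewrite in_itv/= => /andP[d0 dr] Ky z Kz yz.
  have -> : f y - f z = (f x - f z) - (f x - f y) by lra.
  rewrite (le_lt_trans (ler_normB _ _))// [ltRHS]splitr ltrD//; apply: xr => //=.
    rewrite (_ : x - z = (x - y) + (y - z)); last lra.
    rewrite (le_lt_trans (ler_normD _ _))// [ltRHS]splitr ltrD//.
    exact: lt_trans dr.
  by apply: (lt_trans xy); rewrite ltr_pdivrMr// ltr_pMr// ltr1n.
move=> d /= d0 H; exists (d / 2); first by rewrite divr_gt0.
move=> y z Ky Kz yz; apply: (H (d/2)) => //=; last by rewrite divr_gt0.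
by rewrite sub0r normrN gtr0_norm ?divr_gt0// ltr_pdivrMr// ltr_pMr// ltr1n.
Qed.

(** The null set outside which [f] is Borel joins the small set discarded by Lusin's theorem for
    Borel functions. *)
Lemma lebesgue_lusin (R : realType) (D A : set R) (f : R -> R) (e : R) :
  measurable D -> lebesgue_measurable_fun D f ->
  measurable A -> A `<=` D -> (lebesgue_measure A < +oo)%E -> 0 < e ->
  exists K, [/\ compact K, K `<=` A, (lebesgue_measure (A `\` K) < e%:E)%E
    & {within K, continuous f}].
Proof.
move=> mD mf mA AD Aoo e0.
have [N [mN N0 mfN]] := lebesgue_measurable_funN mD mf.
have mAN : measurable (A `\` N) by exact: measurableD.
have ANoo : (lebesgue_measure (A `\` N) < +oo)%E.
  by apply: le_lt_trans Aoo; apply: le_measure; rewrite ?inE//; exact: subDsetl.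
have mfAN : measurable_fun (A `\` N) f.
  by apply: measurable_funS mfN; [exact: measurableD|exact: setSD].
have [K [cK KA AK fK]] := measurable_almost_continuous mAN ANoo e0 mfAN.
exists K; split => //; first by apply: (subset_trans KA); exact: subDsetl.
have mK : measurable K by apply: closed_measurable; exact: compact_closed.
apply: le_lt_trans AK.
apply: (@le_trans _ _ (lebesgue_measure ((A `\` N `\` K) `|` N))).
  apply: le_measure; rewrite ?inE.
  - exact: measurableD.
  - by apply: measurableU => //; exact: measurableD.
  - move=> x [Ax nK]; have [Nx|nN] := pselect (N x); first by right.
    by left.
rewrite (le_trans (outer_measureU2 ((wlength idfun)^*)%mu _ _))//.
by rewrite [X in (_ + X)%E]N0 adde0.
Qed.

(* The exceptional sets [B] need not be measurable: [lebesgue_measure] is used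
   as an outer measure. *)
Definition cvg_in_outer_measure (R : realType) (p q x0 : R)
    (phi : R -> R -> R) : Prop :=
  forall e, 0 < e -> \forall x \near x0, exists B : set R,
    (lebesgue_measure B <= e%:E)%E /\
    forall y, p <= y <= q -> ~ B y -> `|phi x y - phi x0 y| <= e.

Section cvg_in_outer_measure.
Variables (R : realType) (p q x0 : R).
Local Notation cvgm := (@cvg_in_outer_measure R p q x0).

Lemma cvgmD (phi psi : R -> R -> R) : cvgm phi -> cvgm psi ->
  cvgm (fun x y => phi x y + psi x y).
Proof.
move=> phic psic e e0; have e20 : 0 < e / 2 by rewrite divr_gt0.
near=> x.
have [B1 [mB1 H1]] : exists B : set R, (lebesgue_measure B <= (e / 2)%:E)%E /\
    forall y, p <= y <= q -> ~ B y -> `|phi x y - phi x0 y| <= e / 2.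
  by near: x; exact: phic.
have [B2 [mB2 H2]] : exists B : set R, (lebesgue_measure B <= (e / 2)%:E)%E /\
    forall y, p <= y <= q -> ~ B y -> `|psi x y - psi x0 y| <= e / 2.
  by near: x; exact: psic.
exists (B1 `|` B2); split.
  rewrite (le_trans (outer_measureU2 ((wlength idfun)^*)%mu _ _))//.
  by rewrite [e]splitr EFinD leeD.
move=> y yJ /not_orP[nB1 nB2].
rewrite (_ : _ - _ = (phi x y - phi x0 y) + (psi x y - psi x0 y)); last lra.
by rewrite (le_trans (ler_normD _ _))// [e]splitr lerD ?H1 ?H2.
Unshelve. all: by end_near. Qed.

Lemma cvgmZ (c : R) (phi : R -> R -> R) : cvgm phi ->
  cvgm (fun x y => c * phi x y).
Proof.
move=> phic e e0.
have c0 : 0 < `|c| + 1 by rewrite ltr_wpDl.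
have e10 : 0 < e / (`|c| + 1) by rewrite divr_gt0.
have e1e : e / (`|c| + 1) <= e by rewrite ler_pdivrMr// ler_peMr ?(ltW e0)// lerDr.
have := phic _ e10; apply: filterS => x [B [mB H]].
exists B; split; first by rewrite (le_trans mB)// lee_fin.
move=> y yJ nB; rewrite -mulrBr normrM (le_trans (ler_wpM2l _ (H _ yJ nB)))//.
by rewrite mulrCA ler_piMr ?(ltW e0)// ler_pdivrMr// mul1r lerDl.
Qed.

Lemma cvgm_sum (I : Type) (r : seq I) (phi : I -> R -> R -> R) :
  (forall i, cvgm (phi i)) -> cvgm (fun x y => \sum_(i <- r) phi i x y).
Proof.
move=> phic; elim: r => [|i r IH].
  move=> e e0; near=> x; exists set0; split.
    by rewrite measure0 lee_fin ltW.
  by move=> y _ _; rewrite !big_nil subrr normr0 ltW.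
rewrite (_ : (fun x y => _) = (fun x y => phi i x y + \sum_(j <- r) phi j x y)).
  exact: cvgmD.
by apply/funext => x; apply/funext => y; rewrite big_cons.
Unshelve. all: by end_near. Qed.

(** An exceptional set of measure less than [q - p] cannot cover [[p, q]], so some good [y] remains;
    when nothing depends on [y], one good [y] is enough. *)
Lemma cvgm_cst (phi : R -> R -> R) :
  p < q -> cvgm phi -> (forall x y, phi x y = phi x p) ->
  phi x p @[x --> x0] --> phi x0 p.
Proof.
move=> pq phic phip; apply/cvgrPdist_le => e e0.
pose e' := Num.min e ((q - p) / 2).
have e'0 : 0 < e' by rewrite lt_min e0 divr_gt0// subr_gt0.
have := phic _ e'0; apply: filterS => x [B [mB H]].
have [y [yJ nB]] : exists y, p <= y <= q /\ ~ B y.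
  apply: contrapT => /forallNP nex.
  suff : (lebesgue_measure `[p, q]%classic <= e'%:E)%E.
    rewrite lebesgue_measure_itv/= lte_fin pq -EFinB lee_fin le_min => /andP[_].
    by rewrite leNgt => /negP; apply; rewrite ltr_pdivrMr ?mulr_natr//; lra.
  apply: le_trans mB; apply: (le_outer_measure ((wlength idfun)^*)%mu).
  move=> y /=; rewrite in_itv/= => yJ; apply: contrapT => nB.
  by apply: (nex y).
by rewrite distrC -(phip x y) -(phip x0 y) (le_trans (H _ yJ nB))// ge_min lexx.
Qed.

(** By Lusin [f] is uniformly continuous on a large compact [K], so [f (lam x * mu y)] is close to
    [f (lam x0 * mu y)] whenever both arguments lie in [K]. The remaining [y] belong to preimages of
    a small set under [y |-> lam x * mu y], which are small since this map expands distances by at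
    least [kappa * |lam x|]. *)
Lemma cvgm_comp (f lam mu : R -> R) (kappa : R) :
  lebesgue_measurable_fun `]-oo, 1[ f ->
  {for x0, continuous lam} -> lam x0 != 0 ->
  0 < kappa ->
  (forall y z, p <= y <= q -> p <= z <= q -> kappa * `|y - z| <= `|mu y - mu z|) ->
  (exists M : R, forall y, p <= y <= q -> `|mu y| <= M) ->
  (\forall x \near x0, forall y, p <= y <= q -> lam x * mu y < 1) ->
  cvgm (fun x y => f (lam x * mu y)).
Proof.
move=> mf lamc lam0 k0 kmu [M0 muM0] lm1 e e0.
have [M [M0' muM]] : exists M : R, 0 < M /\ forall y, p <= y <= q -> `|mu y| <= M.
  exists (`|M0| + 1); split; first by rewrite ltr_wpDl.
  by move=> y /muM0 /le_trans; apply; rewrite (le_trans (ler_norm _))// lerDl.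
set l0 := `|lam x0|; have l00 : 0 < l0 by rewrite normr_gt0.
(* [L] bounds the arguments as long as [|lam x| <= 2 * l0], so that Lusin's theorem is applied on a
   set of finite measure. *)
pose L := 2 * l0 * M.
pose A := `[- L, 1[%classic : set R.
(* Near [x0] the expansion factor is at least [kappa * (l0 / 2)]; with this [e'] the bad sets at [x]
   and at [x0] have measure at most [e / 2] each. *)
pose e' := e * (kappa * (l0 / 2)) / 2.
have kl0 : 0 < kappa * (l0 / 2) by rewrite mulr_gt0// divr_gt0.
have e'0 : 0 < e' by rewrite divr_gt0// mulr_gt0.
have [K [cK KA AK fK]] : exists K, [/\ compact K, K `<=` A,
    (lebesgue_measure (A `\` K) < e'%:E)%E & {within K, continuous f}].
  apply: (lebesgue_lusin _ mf) => //.
  - exact: measurable_itv.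
  - by move=> x /=; rewrite !in_itv/= => /andP[].
  - by rewrite lebesgue_measure_itv/=; case: ifPn => _; rewrite ?ltry// -EFinB ltry.
have [d d0 fd] := within_compact_unif_cont cK fK e0.
pose bad x := [set y | p <= y <= q] `&` (fun y => lam x * mu y) @^-1` (A `\` K).
have mbad x : l0 / 2 <= `|lam x| -> (lebesgue_measure (bad x) <= (e / 2)%:E)%E.
  move=> lx; have lx0 : 0 < `|lam x| by rewrite (lt_le_trans _ lx)// divr_gt0.
  apply: (@le_trans _ _ ((kappa * (l0 / 2))^-1%:E * lebesgue_measure (A `\` K))%E).
    apply: outer_measure_preimage => // y z yJ zJ.
    rewrite -mulrBr normrM mulrAC [leRHS]mulrC.
    by apply: ler_pM => //; [rewrite mulr_ge0// ltW|rewrite divr_ge0// ltW|exact: kmu].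
  apply: (@le_trans _ _ ((kappa * (l0 / 2))^-1%:E * e'%:E)%E).
    by apply: lee_wpmul2l; [rewrite lee_fin invr_ge0 ltW|exact: ltW].
  rewrite -EFinM lee_fin (_ : _ * e' = e / 2)// /e'.
  by field; rewrite !gt_eqF.
have lm10 := nbhs_singleton lm1.
near=> x.
have lxge : l0 / 2 <= `|lam x|.
  have : `|lam x0 - lam x| < l0 / 2.
    by near: x; move/cvgrPdist_lt : lamc; apply; rewrite divr_gt0.
  move=> h; have := lerB_dist (lam x0) (lam x0 - lam x).
  rewrite subKr -/l0; lra.
have lxle : `|lam x| <= 2 * l0.
  have : `|lam x0 - lam x| < l0.
    by near: x; move/cvgrPdist_lt : lamc; apply.
  move=> h; have := ler_normB (lam x0) (lam x0 - lam x).
  rewrite subKr -/l0; lra.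
have inA x' y : `|lam x'| <= 2 * l0 -> p <= y <= q -> lam x' * mu y < 1 ->
    A (lam x' * mu y).
  move=> lx' yJ h; rewrite /A /= in_itv/= h andbT lerNl.
  apply: (le_trans (ler_norm _)); rewrite normrN normrM /L.
  by apply: ler_pM => //; exact: muM.
have lx1 : forall y, p <= y <= q -> lam x * mu y < 1 by near: x.
exists (bad x `|` bad x0); split.
  rewrite (le_trans (outer_measureU2 ((wlength idfun)^*)%mu _ _))//.
  by rewrite [e]splitr EFinD leeD//; apply: mbad => //; rewrite -/l0; lra.
move=> y yJ /not_orP[nb nb0]; apply/ltW/fd.
- apply: contrapT => nK; apply: nb; split => //; split => //.
  by apply: inA => //; exact: lx1.
- apply: contrapT => nK; apply: nb0; split => //; split => //.
  apply: inA => //; first by rewrite -/l0; lra.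
  exact: lm10.
- rewrite -mulrBl normrM.
  apply: (@le_lt_trans _ _ (`|lam x - lam x0| * M)).
    by rewrite ler_wpM2l// muM.
  rewrite -ltr_pdivlMr// distrC.
  by near: x; move/cvgrPdist_lt : lamc; apply; rewrite divr_gt0.
Unshelve. all: by end_near. Qed.

Lemma cvgmM (u v : R -> R) : {for x0, continuous u} ->
  (exists M : R, forall y, p <= y <= q -> `|v y| <= M) ->
  cvgm (fun x y => u x * v y).
Proof.
move=> uc [M vM] e e0.
have M0 : 0 < `|M| + 1 by rewrite ltr_wpDl.
have eM0 : 0 < e / (`|M| + 1) by rewrite divr_gt0.
move/cvgrPdist_lt : uc => /(_ _ eM0); apply: filterS => x ux.
exists set0; split; first by rewrite measure0 lee_fin ltW.
move=> y yJ _; rewrite -mulrBl normrM distrC.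
rewrite -[leRHS](divfK (lt0r_neq0 M0)); apply: ler_pM => //; first exact: ltW.
rewrite (le_trans (vM _ yJ))// (le_trans (ler_norm _))// lerDl//.
Qed.

Lemma cvgm_near (phi psi : R -> R -> R) :
  (\forall x \near x0, forall y, p <= y <= q -> phi x y = psi x y) ->
  cvgm psi -> cvgm phi.
Proof.
move=> phipsi psic e e0; have phipsi0 := nbhs_singleton phipsi; have := psic _ e0.
apply: filterS2 phipsi => x phipsi [B [mB H]]; exists B; split => // y yJ nB.
by rewrite phipsi// phipsi0// H.
Qed.

End cvg_in_outer_measure.

Lemma within_itv_continuous (R : realType) (p q : R) (g : R -> R) :
  (forall y, p <= y <= q -> {for y, continuous g}) ->
  {within `[p, q], continuous g}.
Proof.
by move=> gc; apply: continuous_in_subspaceT => y; rewrite inE/= in_itv/=; exact: gc.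
Qed.

Lemma continuous_itv_bounded (R : realType) (p q : R) (g : R -> R) :
  (forall y, p <= y <= q -> {for y, continuous g}) ->
  exists2 M : R, 0 < M & forall y, p <= y <= q -> `|g y| <= M.
Proof.
move=> gc; have [pq|qp] := leP p q; last first.
  by exists 1 => // y /andP[py yq]; have := le_trans py yq; rewrite leNgt qp.
have [] := @EVT_max R (fun y => `|g y|) p q pq.
  apply: within_itv_continuous => y /gc gy.
  by apply: continuous_comp gy _; exact: norm_continuous.
move=> c _ H; exists (`|g c| + 1); first by rewrite ltr_wpDl.
by move=> y yJ; rewrite (le_trans (H y _)) ?in_itv// lerDl.
Qed.

(** * The functional equation as a sum over products, and continuity on ]0, 1[ *)

(** The constant [z] stands for Li3(1): the regularity theory and the local analysis at 0 hold for
    any constant, and the trilogarithm enters only in the final comparison. *)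
Definition spence_kummer (R : realType) (z : R) (F : R -> R) : Prop :=
  forall x y : R, 0 < x -> x < y -> y < 1 ->
     2 * F x + 2 * F y - F (x / y)
     + 2 * F ((1 - y) / (1 - x))
     + 2 * F ((x * (1 - y)) / (y * (1 - x)))
     - F (x * y)
     + 2 * F ((x * (1 - y)) / (x - 1))
     + 2 * F ((1 - y) / (y * (x - 1)))
     - F ((x * (1 - y) ^+ 2) / (y * (1 - x) ^+ 2))
     = 2 * z - ln y ^+ 2 * ln ((1 - y) / (1 - x))
       + pi ^+ 2 / 3 * ln y + ln y ^+ 3 / 3.

(* Apart from [x] and [y], the arguments of [F] in the equation are the
   products [sk_lam i x * sk_mu i y] for [i < 7]. *)
Definition sk_coef (R : realType) (i : nat) : R :=
  match i with 0 | 3 | 6 => -1 | _ => 2 end.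

Definition sk_lam (R : realType) (i : nat) (x : R) : R :=
  match i with
  | 0 | 3 => x | 1 => (1 - x)^-1 | 2 => x / (1 - x) | 4 => - (x / (1 - x))
  | 5 => - (1 - x)^-1 | _ => x / (1 - x) ^+ 2
  end.

Definition sk_mu (R : realType) (i : nat) (y : R) : R :=
  match i with
  | 0 => y^-1 | 1 | 4 => 1 - y | 2 | 5 => (1 - y) / y | 3 => y
  | _ => (1 - y) ^+ 2 / y
  end.

Section spence_kummer.
Variables (R : realType) (z : R) (F : R -> R).
Hypothesis FE : spence_kummer z F.

(** The logarithm of (1-y)/(1-x) splits, and only [ln (1 - x) * ln y ^+ 2] still involves [x]; this
    is the rest of the right-hand side. *)
Definition sk_rhs (y : R) : R :=
  2 * z - ln y ^+ 2 * ln (1 - y) + pi ^+ 2 / 3 * ln y + ln y ^+ 3 / 3.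

Lemma spence_kummerE (x y : R) : 0 < x -> x < y -> y < 1 ->
  2 * F x = sk_rhs y - 2 * F y + ln (1 - x) * ln y ^+ 2
    - \sum_(i < 7) sk_coef R i * F (sk_lam i x * sk_mu i y).
Proof.
move=> x0 xy y1; have := FE x0 xy y1.
have x1 : x != 1 by rewrite lt_eqF// (lt_trans xy).
have y0 : y != 0 by rewrite gt_eqF// (lt_trans x0).
have xm : 1 - x != 0 by rewrite subr_eq0 eq_sym.
have xm' : x - 1 != 0 by rewrite subr_eq0.
rewrite ln_div ?posrE ?subr_gt0//; last exact: lt_trans xy y1.
rewrite !big_ord_recl big_ord0/= /sk_rhs /=.
rewrite (_ : x * (1 - y) / (y * (1 - x)) = x / (1 - x) * ((1 - y) / y)); last first.
  by field; rewrite ?y0 ?xm ?xm'.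
rewrite (_ : x * (1 - y) / (x - 1) = - (x / (1 - x)) * (1 - y)); last first.
  by field; rewrite ?y0 ?xm ?xm'.
rewrite (_ : (1 - y) / (y * (x - 1)) = - (1 - x)^-1 * ((1 - y) / y)); last first.
  by field; rewrite ?y0 ?xm ?xm'.
rewrite (_ : x * (1 - y) ^+ 2 / (y * (1 - x) ^+ 2) =
    x / (1 - x) ^+ 2 * ((1 - y) ^+ 2 / y)); last first.
  by field; rewrite ?y0 ?xm ?xm'.
rewrite (_ : (1 - y) / (1 - x) = (1 - x)^-1 * (1 - y)); last by rewrite mulrC.
move=> E; lra.
Qed.

Lemma sk_arg_lt1 (i : nat) (x y : R) : 0 < x -> x < y -> y < 1 ->
  sk_lam i x * sk_mu i y < 1.
Proof.
move=> x0 xy y1; have y0 := lt_trans x0 xy; have x1 := lt_trans xy y1.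
have x1' : 0 < 1 - x by rewrite subr_gt0.
have y1' : 0 < 1 - y by rewrite subr_gt0.
case: i => [|[|[|[|[|[|i]]]]]] /=.
- by rewrite ltr_pdivrMr// mul1r.
- by rewrite mulrC ltr_pdivrMr//; lra.
- by rewrite mulrACA -invfM ltr_pdivrMr ?mulr_gt0//; nra.
- by rewrite mulr_ilt1 ?ltW.
- by rewrite mulNr (@lt_trans _ _ 0)// oppr_lt0 mulr_gt0// divr_gt0.
- by rewrite mulNr (@lt_trans _ _ 0)// oppr_lt0 mulr_gt0 ?invr_gt0// divr_gt0.
- rewrite mulrACA -invfM ltr_pdivrMr ?mulr_gt0 ?exprn_gt0// mul1r.
  have : (1 - y) ^+ 2 < (1 - x) ^+ 2 by rewrite ltr_pXn2r ?nnegrE//; lra.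
  by have := exprn_gt0 2 y1'; nra.
Qed.

(** Each difference is [y - w] times a factor of absolute value 1, [(y * w)^-1] or [(y * w)^-1 - 1].
    The last is the smallest case, and is at least 1/q - 1 >= 1 - q because y w <= q. *)
Lemma sk_mu_inv_lip (i : nat) (p q y w : R) : 0 < p -> q < 1 ->
  p <= y <= q -> p <= w <= q ->
  (1 - q) * `|y - w| <= `|sk_mu i y - sk_mu i w|.
Proof.
move=> p0 q1 /andP[py yq] /andP[pw wq].
have y0 := lt_le_trans p0 py; have w0 := lt_le_trans p0 pw.
have y1 := le_lt_trans yq q1; have w1 := le_lt_trans wq q1.
have yw1 : 1 < (y * w)^-1 by rewrite invf_gt1 ?mulr_gt0// mulr_ilt1// ltW.
suff [k -> qk] : exists2 k, sk_mu i y - sk_mu i w = (y - w) * k & 1 - q <= `|k|.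
  by rewrite normrM mulrC ler_wpM2l.
have q0 : 0 < q by rewrite (lt_le_trans y0).
have yw0 : 0 < (y * w)^-1 by rewrite (lt_trans ltr01).
have yN0 : y != 0 by rewrite gt_eqF.
have wN0 : w != 0 by rewrite gt_eqF.
case: i => [|[|[|[|[|[|i]]]]]] /=.
- exists (- (y * w)^-1); first by field; rewrite ?yN0 ?wN0.
  by rewrite normrN gtr0_norm//; lra.
- by exists (-1); [ring|rewrite normrN normr1; lra].
- exists (- (y * w)^-1); first by field; rewrite ?yN0 ?wN0.
  by rewrite normrN gtr0_norm//; lra.
- by exists 1; [ring|rewrite normr1; lra].
- by exists (-1); [ring|rewrite normrN normr1; lra].
- exists (- (y * w)^-1); first by field; rewrite ?yN0 ?wN0.
  by rewrite normrN gtr0_norm//; lra.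
- exists (1 - (y * w)^-1); first by field; rewrite ?yN0 ?wN0.
  rewrite distrC gtr0_norm ?subr_gt0//.
  have : (q * 1)^-1 <= (y * w)^-1.
    by rewrite lef_pV2 ?posrE ?mulr_gt0// ler_pM// ltW.
  have : 2 - q <= (q * 1)^-1.
    by rewrite mulr1 -[leRHS]mul1r ler_pdivlMr//; nra.
  lra.
Qed.

Lemma continuous_sk_mu (i : nat) (y : R) : 0 < y -> {for y, continuous (@sk_mu R i)}.
Proof.
move=> y0; have yN0 : y != 0 by rewrite gt_eqF.
have c1 : {for y, continuous (fun y : R => 1 - y)}.
  by apply: cvgB; [exact: cvg_cst|exact: cvg_id].
have cV : {for y, continuous (fun y : R => y^-1)} by apply: cvgV.
case: i => [|[|[|[|[|[|i]]]]]] //=.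
- exact: cvgM.
- exact: cvgM.
- by apply: cvgM => //; apply: cvgM.
Qed.

Lemma continuous_sk_lam (i : nat) (x : R) : x < 1 -> {for x, continuous (@sk_lam R i)}.
Proof.
move=> x1; have xN1 : 1 - x != 0 by rewrite gt_eqF// subr_gt0.
have c1 : {for x, continuous (fun y : R => 1 - y)}.
  by apply: cvgB; [exact: cvg_cst|exact: cvg_id].
have cV : {for x, continuous (fun y : R => (1 - y)^-1)} by apply: cvgV.
case: i => [|[|[|[|[|[|i]]]]]] //=.
- by apply: cvgM => //.
- by apply: cvgN; apply: cvgM.
- exact: cvgN.
- apply: cvgM => //; apply: cvgV; first by rewrite expf_neq0.
  exact: cvgM.
Qed.

Lemma sk_lam_neq0 (i : nat) (x : R) : 0 < x -> x < 1 -> sk_lam i x != 0.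
Proof.
move=> x0 x1; have xN0 : x != 0 by rewrite gt_eqF.
have xN1 : 1 - x != 0 by rewrite gt_eqF// subr_gt0.
by case: i => [|[|[|[|[|[|i]]]]]] //=; rewrite ?oppr_eq0 ?mulf_neq0 ?invr_eq0 ?expf_neq0.
Qed.

Lemma spence_kummer_continuous (x : R) : lebesgue_measurable_fun `]-oo, 1[ F ->
  0 < x -> x < 1 -> {for x, continuous F}.
Proof.
move=> mF x0 x1.
(* [[p, q]] is the middle third of [[x, 1]], hence to the right of every [t] close to [x]. *)
pose p := (2 * x + 1) / 3; pose q := (x + 2) / 3.
have xp : x < p by rewrite /p; lra.
have pq : p < q by rewrite /p /q; lra.
have q1 : q < 1 by rewrite /q; lra.
have p0 := lt_trans x0 xp.
have nx : \forall t \near x, 0 < t < p.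
  near=> t; apply/andP; split; first by near: t; exact: lt_nbhsr.
  by near: t; exact: lt_nbhsl.
(* The left-hand side of the equation does not involve [y], so convergence in measure over [y] is
   ordinary convergence. *)
suff : cvg_in_outer_measure p q x (fun t y => 2 * F t).
  move=> /(cvgm_cst pq)/(_ (fun _ _ => erefl)) F2.
  rewrite (_ : F = (fun t => 2^-1 * (2 * F t))); last first.
    by apply/funext => t; rewrite mulKf.
  by apply: cvgM => //; exact: cvg_cst.
apply: (@cvgm_near _ _ _ _ _ (fun t y => (1 * (sk_rhs y - 2 * F y) +
    ln (1 - t) * ln y ^+ 2) + (-1) *
    \sum_(i < 7) (sk_coef R i * F (sk_lam i t * sk_mu i y)))).
  apply: filterS nx => t /andP[t0 tp] y /andP[py yq].
  rewrite mul1r mulN1r; apply: spence_kummerE => //.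
    exact: lt_le_trans py.
  exact: le_lt_trans q1.
apply: cvgmD; first apply: cvgmD.
- move=> e e0; near=> t.
  exists set0; split; first by rewrite measure0 lee_fin ltW.
  by move=> y _ _; rewrite subrr normr0 ltW.
- apply: cvgmM.
    apply: continuous_comp.
      by apply: cvgB; [exact: cvg_cst|exact: cvg_id].
    by apply: continuous_ln; rewrite subr_gt0.
  exists (ln p ^+ 2) => y /andP[py yq].
  have y0 := lt_le_trans p0 py; have y1 := le_lt_trans yq q1.
  rewrite normrX -[in leRHS]sqrrN lerXn2r ?nnegrE ?oppr_ge0 ?ln_le0//.
    exact: (le_trans (le_trans py yq) (ltW q1)).
  rewrite ler0_norm ?ln_le0 ?(ltW y1)// lerN2 ler_ln//.
- apply: cvgmZ; apply: cvgm_sum => i; apply: cvgmZ.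
  apply: (@cvgm_comp _ _ _ _ _ _ _ (1 - q)) => //.
  + exact: continuous_sk_lam.
  + exact: sk_lam_neq0.
  + by rewrite subr_gt0.
  + by move=> y w yJ wJ; exact: (sk_mu_inv_lip _ p0).
  + have [M _ mM] : exists2 M : R, 0 < M & forall y, p <= y <= q -> `|sk_mu i y| <= M.
      apply: continuous_itv_bounded => y /andP[py _].
      by apply: continuous_sk_mu; exact: lt_le_trans py.
    by exists M.
  + apply: filterS nx => t /andP[t0 tp] y /andP[py yq].
    apply: sk_arg_lt1 => //; first exact: lt_le_trans py.
    exact: le_lt_trans q1.
Unshelve. all: by end_near. Qed.

End spence_kummer.

(** * The three-term relation *)

Lemma cvg_sum_ord (R : realType) (T : Type) (G : set_system T) {FG : Filter G}
    (n : nat) (f : nat -> T -> R) (l : nat -> R) :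
  (forall i, f i @ G --> l i) ->
  (fun x => \sum_(i < n) f i x) @ G --> \sum_(i < n) l i.
Proof.
move=> fl; elim: n => [|n IH].
  rewrite big_ord0 (_ : (fun x => _) = cst 0); first exact: cvg_cst.
  by apply/funext => x; rewrite big_ord0.
rewrite big_ord_recr/= (_ : (fun x => _) =
  (fun x => \sum_(i < n) f i x + f n x)); first exact: cvgD.
by apply/funext => x; rewrite big_ord_recr.
Qed.

Lemma cvg_continuous_comp (R : realType) (T : Type) (G : set_system T)
    (f : R -> R) (g : T -> R) (a : R) {FG : Filter G} :
  {for a, continuous f} -> g @ G --> a -> f (g x) @[x --> G] --> f a.
Proof. by move=> fa ga; exact: (cvg_comp _ _ ga fa). Qed.

(* Choosing [y] as a function of [x] so that the argument
   [(1 - y) / (y (x - 1))] does not move, the limit [x --> 0] does not require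
   the continuity of [F] at negative points. *)
Lemma spence_kummer3 (R : realType) (z : R) (F : R -> R) (y : R) :
  spence_kummer z F -> {for 0, continuous F} ->
  (forall x, 0 < x -> x < 1 -> {for x, continuous F}) ->
  0 < y -> y < 1 ->
  2 * F y + 2 * F (1 - y) + 2 * F (1 - y^-1) + 3 * F 0 = sk_rhs z y.
Proof.
move=> FE F0 Fc y0 y1.
have yN0 : y != 0 by rewrite gt_eqF.
pose Z := (1 - y) / y; have Z0 : 0 < Z by rewrite divr_gt0// subr_gt0.
(* [Y x] solves (1 - Y)/Y = Z (1 - x), so the argument (1 - Y)/(Y (x - 1)) stays equal to -Z. *)
pose Y x := (1 + Z * (1 - x))^-1.
have Y0 : Y 0 = y by rewrite /Y /Z; field; rewrite yN0 -/Z; apply/eqP; lra.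
have x0 : x @[x --> 0^'+] --> (0 : R) by apply: cvg_at_right_filter; exact: cvg_id.
have x1 : 1 - x @[x --> 0^'+] --> (1 : R).
  by rewrite -[X in _ --> X]subr0; apply: cvgB => //; exact: cvg_cst.
have YV : 1 + Z * (1 - x) @[x --> 0^'+] --> 1 + Z.
  rewrite -[in X in _ --> X](mulr1 Z).
  by apply: cvgD; [exact: cvg_cst|apply: cvgM => //; exact: cvg_cst].
have Yc : Y x @[x --> 0^'+] --> y.
  rewrite -Y0 /Y subr0 mulr1; apply: cvgV => //.
  by rewrite gt_eqF// addr_gt0.
have nx : \forall x \near 0^'+, [/\ 0 < x, x < Y x, Y x < 1 & x < 1].
  near=> x.
  have xg0 : 0 < x by [].
  have xy2 : x < y / 2.
    by near: x; apply: nbhs_right_lt; rewrite divr_gt0.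
  have Yy : y / 2 < Y x.
    near: x; apply: (cvgr_gt y) => //.
    by rewrite ltr_pdivrMr// ltr_pMr// ltr1n.
  have xl1 : x < 1 by lra.
  have Zx : 0 < Z * (1 - x) by rewrite mulr_gt0// subr_gt0.
  split => //; first exact: lt_trans Yy.
  by rewrite /Y invf_lt1 ?ltrDl// addr_gt0.
pose A x := \sum_(i < 7) sk_coef R i * F (sk_lam i x * sk_mu i (Y x)).
(* At index 1 the argument tends to [1 - y], in ]0, 1[; at index 5 it is constantly [- Z]; at all
   others it tends to 0. In each case the value of [F] converges. *)
pose L i := if i is 5 then F (- Z) else F (sk_lam i 0 * sk_mu i y).
have Ac : A x @[x --> 0^'+] --> \sum_(i < 7) sk_coef R i * L i.
  apply: (@cvg_sum_ord _ _ _ _ _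
      (fun i x => sk_coef R i * F (sk_lam i x * sk_mu i (Y x)))
      (fun i => sk_coef R i * L i)) => i.
  apply: cvgM; first exact: cvg_cst.
  have lmc : sk_lam i x * sk_mu i (Y x) @[x --> 0^'+] --> sk_lam i 0 * sk_mu i y.
    apply: cvgM.
      by apply: cvg_at_right_filter; exact: continuous_sk_lam.
    by apply: cvg_continuous_comp Yc; exact: continuous_sk_mu.
  have z0 : sk_lam i 0 = 0 :> R ->
      F (sk_lam i x * sk_mu i (Y x)) @[x --> 0^'+] --> F (sk_lam i 0 * sk_mu i y).
    move=> l0; move: lmc; rewrite l0 mul0r => lmc.
    exact: (cvg_continuous_comp F0 lmc).
  case: i lmc z0 => [|[|[|[|[|[|i]]]]]] /= lmc z0.
  - exact: z0.
  - apply: cvg_continuous_comp lmc; rewrite subr0 invr1 mul1r.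
    by apply: Fc; lra.
  - by apply: z0; rewrite mul0r.
  - exact: z0.
  - by apply: z0; rewrite mul0r oppr0.
  - apply: cvg_near_cst; apply: filterS nx => x [xg0 xY Y1 xl1].
    congr F; rewrite /Y.
    have h1 : 1 - x != 0 by rewrite gt_eqF// subr_gt0.
    have h2 : 1 + Z * (1 - x) != 0.
      by rewrite gt_eqF// addr_gt0// mulr_gt0// subr_gt0.
    by field; rewrite h1 h2.
  - by apply: z0; rewrite mul0r.
have lnY : ln (Y x) @[x --> 0^'+] --> ln y.
  exact: cvg_continuous_comp (continuous_ln y0) Yc.
pose B x := sk_rhs z (Y x) - 2 * F (Y x) + ln (1 - x) * ln (Y x) ^+ 2 - A x.
have Bc : B x @[x --> 0^'+] --> sk_rhs z y - 2 * F y + 0 * ln y ^+ 2 -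
    \sum_(i < 7) sk_coef R i * L i.
  apply: cvgB => //; apply: cvgD; first apply: cvgB.
  - apply: cvgD; first apply: cvgD; first apply: cvgB.
    + exact: cvg_cst.
    + apply: cvgM; first by apply: cvgM.
      apply: (cvg_continuous_comp (continuous_ln _)); first by rewrite subr_gt0.
      by apply: cvgB => //; exact: cvg_cst.
    + by apply: cvgM => //; exact: cvg_cst.
    + apply: cvgM; last exact: cvg_cst.
      by rewrite exprS; apply: cvgM => //; apply: cvgM.
  - by apply: cvgM; [exact: cvg_cst|exact: cvg_continuous_comp (Fc _ y0 y1) Yc].
  - apply: cvgM; last exact: cvgM.
    rewrite -[X in _ --> X](ln1 R); apply: cvg_continuous_comp x1.
    exact: continuous_ln.
have F2 : 2 * F x @[x --> 0^'+] --> 2 * F 0.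
  by apply: cvgM; [exact: cvg_cst|exact: cvg_continuous_comp F0 x0].
have : 2 * F 0 = sk_rhs z y - 2 * F y + 0 * ln y ^+ 2 -
    \sum_(i < 7) sk_coef R i * L i.
  apply: (cvg_unique _ F2) => //.
  apply: cvg_trans Bc; apply: near_eq_cvg.
  apply: filterS nx => x [xg0 xY Y1 xl1].
  by rewrite /= /B /A (spence_kummerE FE xg0 xY Y1).
(* The coefficient 3 of [F 0] is 2 from the left-hand side plus -1 + 2 - 1 + 2 - 1 from the indices
   0, 2, 3, 4, 6. *)
rewrite !big_ord_recl big_ord0 /L /=.
rewrite !mul0r subr0 invr1 oppr0 !mul0r mul1r.
rewrite (_ : - Z = 1 - y^-1); last by rewrite /Z; field; rewrite yN0.
move=> E; lra.
Unshelve. all: by end_near. Qed.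

(** * Weighted integrals and their dependence on a scale parameter *)

Lemma continuous_itv_integrable (R : realType) (p q : R) (g : R -> R) :
  (forall y, p <= y <= q -> {for y, continuous g}) ->
  lebesgue_measure.-integrable `[p, q] (EFin \o g).
Proof.
move=> gc; apply: continuous_compact_integrable; first exact: segment_compact.
exact: within_itv_continuous.
Qed.

Lemma is_derive_continuous (R : realType) (g : R -> R) (x d : R) :
  is_derive x 1 g d -> {for x, continuous g}.
Proof.
by move=> gd; apply/differentiable_continuous/derivable1_diffP; exact: ex_derive.
Qed.

Lemma is_derive_LRcontinuous (R : realType) (p q : R) (g dg : R -> R) :
  (forall y, p <= y <= q -> is_derive y 1 g (dg y)) ->
  p < q -> derivable_oo_LRcontinuous g p q.
Proof.
move=> gd pq; split.
- move=> y; rewrite in_itv/= => /andP[py yq].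
  by have [] := gd y _; rewrite ?(ltW py) ?(ltW yq).
- apply: cvg_at_right_filter; apply: is_derive_continuous; apply: gd.
  by rewrite lexx ltW.
- apply: cvg_at_left_filter; apply: is_derive_continuous; apply: gd.
  by rewrite lexx ltW.
Qed.

Lemma is_derive_derive1 (R : realType) (g : R -> R) (x d : R) :
  is_derive x 1 g d -> g^`()%classic x = d.
Proof. by move=> gd; rewrite derive1E derive_val. Qed.

Lemma continuous_antiderivative (R : realType) (f : R -> R) (a b : R) :
  a < b -> (forall z, a <= z <= b -> {for z, continuous f}) ->
  exists G : R -> R, forall z, a < z < b -> is_derive z 1 G (f z).
Proof.
move=> ab fc; exists (fun x => \int[lebesgue_measure]_(t in `[a, x]) f t).
move=> z /andP[az zb].
have fz : {for z, continuous f} by apply: fc; rewrite !ltW.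
have [dG GE] := @continuous_FTC1_closed R f a z b zb (continuous_itv_integrable fc) az fz.
by apply: DeriveDef; [exact: dG|rewrite -derive1E; exact: GE].
Qed.

(** For scales near [l0] all arguments stay in one bounded interval away from 1, where continuous
    functions are bounded and have an antiderivative; this supplies the dominating functions under
    the integral sign. *)
Lemma scale_neighborhood (R : realType) (m : R -> R) (p q l0 : R) :
  p <= q -> (forall y, p <= y <= q -> {for y, continuous m}) ->
  (forall y, p <= y <= q -> l0 * m y < 1) ->
  exists u v a b : R, [/\ u < l0 < v, a < b, b < 1 &
    forall l y, u < l < v -> p <= y <= q -> a < l * m y < b].
Proof.
move=> pq mc lm.
have [M M0 mM] := continuous_itv_bounded mc.
have [c cJ cmax] : exists2 c, c \in `[p, q] &
    forall y, y \in `[p, q] -> l0 * m y <= l0 * m c.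
  apply: (@EVT_max R (fun y => l0 * m y)) => //.
  apply: within_itv_continuous => y /mc my.
  by apply: cvgM => //; exact: cvg_cst.
have c1 : l0 * m c < 1 by apply: lm; rewrite in_itv in cJ.
(* Half the distance from 1 to the largest value of [l0 * m], attained at [c]. *)
pose e := (1 - l0 * m c) / 2.
have e0 : 0 < e by rewrite divr_gt0// subr_gt0.
have eM : 0 < e / M by rewrite divr_gt0.
have key l y : l0 - e / M < l < l0 + e / M -> p <= y <= q ->
    - `|l0| * M - e < l * m y < l0 * m c + e.
  move=> /andP[l1 l2] yJ.
  have h : `|(l - l0) * m y| < e.
    rewrite normrM (le_lt_trans (ler_wpM2l _ (mM _ yJ)))//.
    by rewrite -ltr_pdivlMr// ltr_norml; apply/andP; split; lra.
  have h1 : l0 * m y <= l0 * m c by apply: cmax; rewrite in_itv.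
  have h2 : `|l0 * m y| <= `|l0| * M by rewrite normrM ler_wpM2l// mM.
  move: h h2; rewrite ltr_norml ler_norml => /andP[? ?] /andP[? ?].
  by apply/andP; split; lra.
exists (l0 - e / M), (l0 + e / M), (- `|l0| * M - e), (l0 * m c + e); split.
- by apply/andP; split; lra.
- have l0J : l0 - e / M < l0 < l0 + e / M by apply/andP; split; lra.
  have pJ : p <= p <= q by rewrite lexx.
  by have /andP[] := key _ _ l0J pJ; exact: lt_trans.
- by rewrite /e; lra.
- exact: key.
Qed.

Lemma continuous_integral_scale (R : realType) (k m w : R -> R) (p q l0 : R) :
  p <= q -> (forall z, z < 1 -> {for z, continuous k}) ->
  (forall y, p <= y <= q -> {for y, continuous m}) ->
  (forall y, p <= y <= q -> {for y, continuous w}) ->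
  (forall y, p <= y <= q -> l0 * m y < 1) ->
  {for l0, continuous
    (fun l : R => \int[lebesgue_measure]_(y in `[p, q]) (k (l * m y) * w y))}.
Proof.
move=> pq kc mc wc lm.
have [u [v [a [b [luv ab b1 H]]]]] := scale_neighborhood pq mc lm.
have [M M0 kM] : exists2 M : R, 0 < M & forall z, a <= z <= b -> `|k z| <= M.
  by apply: continuous_itv_bounded => z /andP[_ zb]; apply: kc; exact: le_lt_trans b1.
have lmy l y : u < l < v -> p <= y <= q -> l * m y < 1.
  by move=> /H /[apply] /andP[_ /lt_trans]; apply.
apply: (@continuity_under_integral R _ _ lebesgue_measure
  (fun l y => k (l * m y) * w y) `[p, q]%classic _ u v _ _
  (fun y => M * `|w y|)).
- exact: measurable_itv.
- move=> l; rewrite /= in_itv/= => lJ; apply: continuous_itv_integrable => y yJ.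
  apply: cvgM; last exact: wc.
  apply: (cvg_continuous_comp (g := fun y => l * m y)); first exact/kc/lmy.
  by apply: cvgM; [exact: cvg_cst|exact: mc].
- apply: aeW => y /=; rewrite in_itv/= => yJ l; rewrite inE/= in_itv/= => lJ.
  apply: cvgM; last exact: cvg_cst.
  apply: (cvg_continuous_comp (g := fun l => l * m y)); first exact/kc/lmy.
  by apply: cvgM; [exact: cvg_id|exact: cvg_cst].
- apply: continuous_itv_integrable => y yJ; apply: cvgM; first exact: cvg_cst.
  by apply: continuous_comp (wc _ yJ) _; exact: norm_continuous.
- move=> l; rewrite /= in_itv/= => lJ; apply: aeW => y /=; rewrite in_itv/= => yJ.
  rewrite normrM ler_wpM2r// kM//.
  by have /andP[? ?] := H _ _ lJ yJ; rewrite !ltW.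
- by rewrite inE/= in_itv.
Qed.

Section integral_scale.
Variables (R : realType) (p q : R) (f m dm S s : R -> R).
Local Notation mu := (@lebesgue_measure R).
Hypothesis pq : p < q.
Hypothesis fc : forall z, z < 1 -> {for z, continuous f}.
Hypothesis mdm : forall y, p <= y <= q -> is_derive y 1 m (dm y).
Hypothesis dmc : forall y, p <= y <= q -> {for y, continuous dm}.
Hypothesis Ss : forall y, p <= y <= q -> is_derive y 1 S (s y).
Hypothesis sc : forall y, p <= y <= q -> {for y, continuous s}.
Hypotheses (Sp : S p = 0) (Sq : S q = 0).

Let mc y (yJ : p <= y <= q) : {for y, continuous m} := is_derive_continuous (mdm yJ).
Let Sc y (yJ : p <= y <= q) : {for y, continuous S} := is_derive_continuous (Ss yJ).

Let pqW z : z \in `]p, q[ -> p <= z <= q.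
Proof. by rewrite in_itv/= => /andP[? ?]; rewrite !ltW. Qed.

(** As [f] is only continuous, the derivative in [l] cannot fall on it. With an antiderivative [G]
    of [f], integration by parts turns [l] times the integral into minus the integral of
    [s y * G (l * m y)], the boundary terms vanishing with [S]. This can be differentiated under the
    integral sign, and dividing by [l] gives the formula. *)
Lemma is_derive_integral_scale (l0 : R) : l0 != 0 ->
  (forall y, p <= y <= q -> l0 * m y < 1) ->
  is_derive l0 1 (fun l : R => \int[mu]_(y in `[p, q]) (f (l * m y) * (S y * dm y)))
    (- l0^-1 * \int[mu]_(y in `[p, q]) (f (l0 * m y) * (s y * m y + S y * dm y))).
Proof.
move=> l00 lm.
have [u [v [a [b [luv ab b1 H]]]]] := scale_neighborhood (ltW pq) mc lm.
have [G Gf] : exists G : R -> R, forall z, a < z < b -> is_derive z 1 G (f z).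
  apply: continuous_antiderivative => // z /andP[_ zb]; apply: fc.
  exact: le_lt_trans b1.
have lmy l y : u < l < v -> p <= y <= q -> l * m y < 1.
  by move=> /H /[apply] /andP[_ /lt_trans]; apply.
have flc l : u < l < v -> forall y, p <= y <= q ->
    {for y, continuous (fun y => f (l * m y))}.
  move=> lJ y yJ.
  apply: (cvg_continuous_comp (g := fun y => l * m y)); first exact/fc/lmy.
  by apply: cvgM; [exact: cvg_cst|exact: mc].
have Gl l : u < l < v -> forall y, p <= y <= q ->
    is_derive y 1 (fun y => G (l * m y)) (f (l * m y) * (l * dm y)).
  move=> lJ y yJ; apply: (@is_derive1_comp _ G (fun y => l * m y)).
    by apply: Gf; exact: H.
  by have := mdm yJ => ?; apply: is_deriveZ.
pose I l := \int[mu]_(y in `[p, q]) (f (l * m y) * (S y * dm y)).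
pose K l := \int[mu]_(y in `[p, q]) (s y * G (l * m y)).
have IBP l : u < l < v -> l * I l = - K l.
  move=> lJ.
  have -> : l * I l = \int[mu]_(y in `[p, q]) (S y * (f (l * m y) * (l * dm y))).
    rewrite /I -RintegralZl//; last first.
      apply: continuous_itv_integrable => y yJ; apply: cvgM; first exact: flc.
      by apply: cvgM; [exact: Sc|exact: dmc].
    by apply: eq_Rintegral => y _; ring.
  rewrite (@Rintegration_by_parts R S (fun y => G (l * m y)) s)//.
  - by rewrite Sp Sq !mul0r subrr sub0r.
  - exact: within_itv_continuous.
  - exact: is_derive_LRcontinuous.
  - by move=> y /pqW yJ; exact/is_derive_derive1/Ss.
  - apply: within_itv_continuous => y yJ; apply: cvgM; first exact: flc.
    by apply: cvgM; [exact: cvg_cst|exact: dmc].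
  - by apply: (is_derive_LRcontinuous (Gl _ lJ)).
  - by move=> y /pqW yJ; exact/is_derive_derive1/Gl.
pose k l y := s y * G (l * m y).
have kd l y : u < l < v -> p <= y <= q ->
    is_derive l 1 (k ^~ y) (s y * (f (l * m y) * m y)).
  move=> lJ yJ; apply: is_deriveZ.
  apply: (@is_derive1_comp _ G (fun l => l * m y)); first by apply: Gf; exact: H.
  have -> : (fun l => l * m y) = (fun l => m y * l).
    by apply/funext => t; rewrite mulrC.
  by rewrite -[X in is_derive _ _ _ X]mulr1; apply: is_deriveZ.
have [Mf Mf0 fM] : exists2 M : R, 0 < M & forall z, a <= z <= b -> `|f z| <= M.
  by apply: continuous_itv_bounded => z /andP[_ zb]; apply: fc; exact: le_lt_trans b1.
have Kd : is_derive l0 1 K (\int[mu]_(y in `[p, q]) (s y * (f (l0 * m y) * m y))).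
  have uv l : `]u, v[%classic l = (u < l < v) by rewrite /= in_itv.
  have B1 := @differentiation_under_integral R _ _ mu k `[p, q]%classic
    (measurable_itv _) l0 u v.
  have B2 := @derivable_under_integral R _ _ mu k `[p, q]%classic
    (measurable_itv _) l0 u v.
  have h1 : `]u, v[%classic l0 by rewrite uv.
  have h2 l : `]u, v[%classic l -> mu.-integrable `[p, q] (EFin \o k l).
    rewrite uv => lJ; apply: continuous_itv_integrable => y yJ.
    by apply: cvgM; [exact: sc|exact: (is_derive_continuous (Gl _ lJ _ yJ))].
  have h3 l y : `]u, v[%classic l -> `[p, q]%classic y -> derivable (k ^~ y) l 1.
    by rewrite uv /= in_itv/= => lJ yJ; have [] := kd _ _ lJ yJ.
  pose g y := `|s y| * (Mf * `|m y|).
  have h4 y : 0 <= g y by rewrite !mulr_ge0// ltW.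
  have h5 : mu.-integrable `[p, q] (EFin \o g).
    apply: continuous_itv_integrable => y yJ; apply: cvgM.
      by apply: continuous_comp (sc yJ) _; exact: norm_continuous.
    apply: cvgM; first exact: cvg_cst.
    by apply: continuous_comp (mc yJ) _; exact: norm_continuous.
  have dk l y : u < l < v -> p <= y <= q ->
      partial1of2 k l y = s y * (f (l * m y) * m y).
    by move=> lJ yJ; rewrite /partial1of2; exact/is_derive_derive1/kd.
  have h6 l y : `]u, v[%classic l -> `[p, q]%classic y ->
      `|partial1of2 k l y| <= g y.
    rewrite uv /= in_itv/= => lJ yJ; rewrite dk// !normrM ler_wpM2l// ler_wpM2r//.
    by apply: fM; have /andP[? ?] := H _ _ lJ yJ; rewrite !ltW.
  have KE := B1 h1 h2 h3 g h4 h5 h6.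
  have Kder := B2 h1 h2 h3 g h4 h5 h6.
  apply: DeriveDef => //; rewrite -derive1E KE; apply: eq_Rintegral => y.
  by rewrite inE/= in_itv/= => yJ; rewrite dk.
have IE : \forall l \near l0, - l^-1 * K l = I l.
  near=> l.
  have lJ : u < l < v.
    by near: l; apply: near_in_itvoo; rewrite in_itv.
  have ll0 : l != 0.
    near: l; exists `|l0| => /=; first by rewrite normr_gt0.
    by move=> t /=; apply: contraTneq => ->; rewrite subr0 ltxx.
  by rewrite mulNr -mulrN -IBP// mulKf.
apply: (near_eq_is_derive IE).
have KI := IBP _ luv.
have -> : - l0^-1 * \int[mu]_(y in `[p, q]) (f (l0 * m y) * (s y * m y + S y * dm y)) =
  - l0^-1 * \int[mu]_(y in `[p, q]) (s y * (f (l0 * m y) * m y)) + l0 ^- 2 * K l0.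
  have -> : l0 ^- 2 * K l0 = - l0^-1 * I l0.
    by rewrite -[K l0]opprK -KI; field.
  rewrite -mulrDr /I -RintegralD//; first last.
  - apply: continuous_itv_integrable => y yJ; apply: cvgM; first exact: flc.
    by apply: cvgM; [exact: Sc|exact: dmc].
  - apply: continuous_itv_integrable => y yJ; apply: cvgM; first exact: sc.
    by apply: cvgM; [exact: flc|exact: mc].
  by congr (_ * _); apply: eq_Rintegral => y _; ring.
have VI : is_derive l0 1 (fun l : R => - l^-1) (l0 ^- 2).
  have := is_deriveN (@is_deriveV R id l0 1 1 l00 (is_derive_id _ _)).
  by rewrite scaler1 opprK.
by apply: is_derive_eq; rewrite /GRing.scale/=; ring.
Unshelve. all: by end_near. Qed.

(** Removes the factor [l0^-1], which would be singular at 0. The weight [s * m + S * dm] is the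
    derivative of [S * m], which vanishes at both ends, so the constant [f 0] integrates to 0; the
    remaining part of [f (l0 * m y)] carries a factor [l0]. The resulting formula makes sense, and
    is continuous, down to scale 0. *)
Lemma is_derive_integral_scale_quotient (r : R -> R) (l0 : R) :
  (forall z, z < 1 -> {for z, continuous r}) ->
  (forall z, f z = f 0 + z * r z) -> l0 != 0 ->
  (forall y, p <= y <= q -> l0 * m y < 1) ->
  is_derive l0 1 (fun l : R => \int[mu]_(y in `[p, q]) (f (l * m y) * (S y * dm y)))
    (- \int[mu]_(y in `[p, q]) (r (l0 * m y) * (m y * (s y * m y + S y * dm y)))).
Proof.
move=> rc fr l00 lm; have Id := is_derive_integral_scale l00 lm.
apply: is_derive_eq.
have T0 : \int[mu]_(y in `[p, q]) (s y * m y + S y * dm y) = 0.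
  rewrite RintegralD//; last 2 first.
  - by apply: continuous_itv_integrable => y yJ; apply: cvgM; [exact: sc|exact: mc].
  - by apply: continuous_itv_integrable => y yJ; apply: cvgM; [exact: Sc|exact: dmc].
  rewrite [X in _ + X](@Rintegration_by_parts R S m s)//.
  - by rewrite Sp Sq !mul0r subrr sub0r addrN.
  - exact: within_itv_continuous.
  - exact: is_derive_LRcontinuous.
  - by move=> y /pqW yJ; exact/is_derive_derive1/Ss.
  - exact: within_itv_continuous.
  - exact: is_derive_LRcontinuous.
  - by move=> y /pqW yJ; exact/is_derive_derive1/mdm.
pose W y := s y * m y + S y * dm y.
have Wc y : p <= y <= q -> {for y, continuous W}.
  move=> yJ; apply: cvgD; apply: cvgM.
  - exact: sc.
  - exact: mc.
  - exact: Sc.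
  - exact: dmc.
have rlc y : p <= y <= q -> {for y, continuous (fun y => r (l0 * m y))}.
  move=> yJ; apply: (cvg_continuous_comp (g := fun y => l0 * m y)).
    exact/rc/lm.
  by apply: cvgM; [exact: cvg_cst|exact: mc].
have -> : \int[mu]_(y in `[p, q]) (f (l0 * m y) * W y) =
    \int[mu]_(y in `[p, q]) (f 0 * W y + l0 * (r (l0 * m y) * (m y * W y))).
  by apply: eq_Rintegral => y _; rewrite fr; ring.
rewrite RintegralD//; last 2 first.
- by apply: continuous_itv_integrable => y yJ; apply: cvgM; [exact: cvg_cst|exact: Wc].
- apply: continuous_itv_integrable => y yJ; apply: cvgM; first exact: cvg_cst.
  by apply: cvgM; [exact: rlc|apply: cvgM; [exact: mc|exact: Wc]].
rewrite !RintegralZl//; last 2 first.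
- apply: continuous_itv_integrable => y yJ.
  by apply: cvgM; [exact: rlc|apply: cvgM; [exact: mc|exact: Wc]].
- by apply: continuous_itv_integrable => y yJ; exact: Wc.
by rewrite /W T0 mulr0 add0r mulNr mulKf.
Qed.

End integral_scale.

(** * Differentiability *)

Lemma Rintegral_sum_ord (R : realType) (p q : R) (n : nat) (g : nat -> R -> R) :
  (forall i y, p <= y <= q -> {for y, continuous (g i)}) ->
  \int[lebesgue_measure]_(y in `[p, q]) (\sum_(i < n) g i y) =
  \sum_(i < n) \int[lebesgue_measure]_(y in `[p, q]) g i y.
Proof.
move=> gc; elim: n => [|n IH].
  rewrite big_ord0; rewrite (@eq_Rintegral _ _ _ _ _ (cst 0)); last by move=> y _; rewrite big_ord0.
  by rewrite /Rintegral integral0.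
rewrite big_ord_recr/= -IH.
have -> : \int[lebesgue_measure]_(y in `[p, q]) (\sum_(i < n.+1) g i y) =
    \int[lebesgue_measure]_(y in `[p, q]) (\sum_(i < n) g i y + g n y).
  by apply: eq_Rintegral => y _; rewrite big_ord_recr.
rewrite RintegralD//; last first.
- by apply: continuous_itv_integrable; exact: gc.
- apply: continuous_itv_integrable => y yJ.
  by apply: (@cvg_sum_ord _ _ _ _ n g (g ^~ y)) => i; exact: gc.
Qed.

Lemma Rintegral_continuous_gt0 (R : realType) (p q : R) (g : R -> R) :
  p < q -> continuous g -> (forall y, p < y < q -> 0 < g y) ->
  0 < \int[lebesgue_measure]_(y in `[p, q]) g y.
Proof.
move=> pq gc g0.
have [G Gg] : exists G : R -> R, forall z, p - 1 < z < q + 1 -> is_derive z 1 G (g z).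
  by apply: continuous_antiderivative => [|t _]; [lra|exact: gc].
have Gg' y : p <= y <= q -> is_derive y 1 G (g y).
  by move=> /andP[py yq]; apply: Gg; apply/andP; split; lra.
have -> : \int[lebesgue_measure]_(y in `[p, q]) g y = G q - G p.
  rewrite /Rintegral (@continuous_FTC2 R g G p q)//.
  - by apply: within_itv_continuous => y _; exact: gc.
  - exact: is_derive_LRcontinuous Gg' pq.
  - move=> y; rewrite in_itv/= => /andP[py yq].
    by apply: is_derive_derive1; apply: Gg'; rewrite !ltW.
have [|y|c] := @MVT R G g p q pq.
- move=> y; rewrite in_itv/= => /andP[py yq].
  by apply: Gg'; rewrite !ltW.
- by apply: within_itv_continuous => // t /Gg'; exact: is_derive_continuous.
- by rewrite in_itv/= => cJ ->; rewrite mulr_gt0 ?g0// subr_gt0.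
Qed.

Lemma is_derive_sum_ord (R : realType) (n : nat) (h : nat -> R -> R)
    (dh : nat -> R) (x : R) :
  (forall i, is_derive x 1 (h i) (dh i)) ->
  is_derive x 1 (fun t => \sum_(i < n) h i t) (\sum_(i < n) dh i).
Proof.
move=> hd; elim: n => [|n IH].
  rewrite big_ord0 (_ : (fun t => _) = cst 0); first exact: is_derive_cst.
  by apply/funext => t; rewrite big_ord0.
rewrite big_ord_recr/= (_ : (fun t => _) =
  (fun t => \sum_(i < n) h i t + h n t)); first exact: is_deriveD.
by apply/funext => t; rewrite big_ord_recr.
Qed.

Section smoothing.
Variables (R : realType) (z : R) (F r : R -> R).
Local Notation mu := (@lebesgue_measure R).
Hypothesis FE : spence_kummer z F.
Hypothesis Fc : forall t, t < 1 -> {for t, continuous F}.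
Hypothesis rc : forall t, t < 1 -> {for t, continuous r}.
Hypothesis Fr : forall t, F t = F 0 + t * r t.
Variables (p q : R).
Hypotheses (p0 : 0 < p) (pq : p < q) (q1 : q < 1).

(* The weight [(y - p) (q - y) (1 - y^2)] is divisible by the derivative of
   every [sk_mu i], up to a unit, and vanishes at the endpoints. *)
Definition sk_P (y : R) := (y - p) * (q - y).
Definition sk_rho (y : R) := sk_P y * (1 - y ^+ 2).
Definition sk_drho (y : R) := (p + q - 2 * y) * (1 - y ^+ 2) - 2 * y * sk_P y.

Definition sk_dmu (i : nat) (y : R) : R :=
  match i with
  | 1 | 4 => -1 | 3 => 1 | 0 | 2 | 5 => - y ^- 2 | _ => 1 - y ^- 2
  end.

(** The quotient of [sk_rho] by [sk_dmu i]: with these weights all seven integrals carry the same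
    product [sk_rho], by which the whole equation can be multiplied. *)
Definition sk_S (i : nat) (y : R) : R :=
  match i with
  | 1 | 4 => - sk_rho y | 3 => sk_rho y | 0 | 2 | 5 => - (y ^+ 2 * sk_rho y)
  | _ => - (y ^+ 2 * sk_P y)
  end.

Definition sk_s (i : nat) (y : R) : R :=
  match i with
  | 1 | 4 => - sk_drho y | 3 => sk_drho y
  | 0 | 2 | 5 => - (2 * y * sk_rho y + y ^+ 2 * sk_drho y)
  | _ => - (2 * y * sk_P y + y ^+ 2 * (p + q - 2 * y))
  end.

Definition sk_dlam (i : nat) (x : R) : R :=
  match i with
  | 0 | 3 => 1 | 1 | 2 => (1 - x) ^- 2 | 4 | 5 => - (1 - x) ^- 2
  | _ => (1 + x) / (1 - x) ^+ 3
  end.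

Lemma is_derive_sk_P (y : R) : is_derive y 1 sk_P (p + q - 2 * y).
Proof. by rewrite /sk_P; apply: is_derive_eq; rewrite /GRing.scale/=; ring. Qed.

Lemma is_derive_sk_rho (y : R) : is_derive y 1 sk_rho (sk_drho y).
Proof.
have := is_derive_sk_P y => ?; rewrite /sk_rho.
by apply: is_derive_eq; rewrite /GRing.scale/= /sk_drho; ring.
Qed.

Lemma is_derive_sk_S (i : nat) (y : R) : is_derive y 1 (sk_S i) (sk_s i y).
Proof.
have := is_derive_sk_P y => ?; have := is_derive_sk_rho y => ?.
by case: i => [|[|[|[|[|[|i]]]]]] /=; apply: is_derive_eq; rewrite /GRing.scale/=; ring.
Qed.

Lemma continuous_sk_drho : continuous sk_drho.
Proof.
move=> y; have := is_derive_sk_P y => ?; rewrite /sk_drho.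
by apply/differentiable_continuous/derivable1_diffP; apply: ex_derive.
Qed.

Lemma continuous_sk_s i y : {for y, continuous (sk_s i)}.
Proof.
have cP := is_derive_continuous (is_derive_sk_P y).
have cr := is_derive_continuous (is_derive_sk_rho y).
have cd := @continuous_sk_drho y.
have c2 : {for y, continuous (fun y : R => 2 * y)} by apply: cvgM; [exact: cvg_cst|exact: cvg_id].
have cX : {for y, continuous (fun y : R => y ^+ 2)} by exact: exprn_continuous.
case: i => [|[|[|[|[|[|i]]]]]] //=; apply: cvgN => //.
- by apply: cvgD; apply: cvgM.
- by apply: cvgD; apply: cvgM.
- by apply: cvgD; apply: cvgM.
- by apply: cvgD; apply: cvgM => //; apply: cvgB => //; exact: cvg_cst.
Qed.

Lemma is_derive_sk_mu i y : p <= y <= q -> is_derive y 1 (@sk_mu R i) (sk_dmu i y).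
Proof.
move=> /andP[py _]; have yN0 : y != 0 by rewrite gt_eqF// (lt_le_trans p0).
have V : is_derive y 1 (fun y : R => y^-1) (- y ^- 2).
  by have := @is_deriveV R id y 1 1 yN0 (is_derive_id _ _); rewrite scaler1.
case: i => [|[|[|[|[|[|i]]]]]] //=; apply: is_derive_eq;
  rewrite /GRing.scale/= ?expr1; try ring; by field.
Qed.

Lemma is_derive_sk_lam (i : nat) (x : R) : x < 1 -> is_derive x 1 (@sk_lam R i) (sk_dlam i x).
Proof.
move=> x1; have xN1 : 1 - x != 0 by rewrite gt_eqF// subr_gt0.
have V : is_derive x 1 (fun y : R => (1 - y)^-1) ((1 - x) ^- 2).
  have h : is_derive x 1 (fun y : R => 1 - y) (-1).
    by rewrite -[X in is_derive _ _ _ X]sub0r; apply: is_deriveB.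
  by apply: is_derive_eq; rewrite /GRing.scale/=; ring.
have V2 : is_derive x 1 (fun y : R => ((1 - y) ^+ 2)^-1) (2 / (1 - x) ^+ 3).
  have -> : (fun y : R => ((1 - y) ^+ 2)^-1) = (fun y => (1 - y)^-1 * (1 - y)^-1).
    by apply/funext => y; rewrite -invfM expr2.
  by apply: is_derive_eq; rewrite /GRing.scale/=; field.
case: i => [|[|[|[|[|[|i]]]]]] //=; apply: is_derive_eq;
  rewrite /GRing.scale/=; try ring; by field.
Qed.

Lemma continuous_sk_dmu i y : p <= y <= q -> {for y, continuous (sk_dmu i)}.
Proof.
move=> /andP[py _]; have yN0 : y != 0 by rewrite gt_eqF// (lt_le_trans p0).
have V2 : {for y, continuous (fun y : R => y ^- 2)}.
  by apply: cvgV; [rewrite expf_neq0|exact: exprn_continuous].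
case: i => [|[|[|[|[|[|i]]]]]] //=; try exact: cvg_cst; try by apply: cvgN.
by apply: cvgB => //; exact: cvg_cst.
Qed.

Lemma continuous_sk_dlam i : {for 0, continuous (sk_dlam i)}.
Proof.
have c1 : {for (0 : R), continuous (fun y : R => 1 - y)}.
  by apply: cvgB; [exact: cvg_cst|exact: cvg_id].
have V n : {for (0 : R), continuous (fun y : R => (1 - y) ^- n)}.
  apply: cvgV; first by rewrite subr0 expf_neq0// oner_eq0.
  by apply: (cvg_continuous_comp (f := fun y => y ^+ n)) => //; exact: exprn_continuous.
case: i => [|[|[|[|[|[|i]]]]]] //=; try exact: cvg_cst.
- exact: (V 2).
- exact: (V 2).
- by apply: cvgN; exact: (V 2).
- by apply: cvgN; exact: (V 2).
- apply: cvgM; last exact: (V 3).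
  by apply: cvgD; [exact: cvg_cst|exact: cvg_id].
Qed.

Lemma sk_S_dmu i y : p <= y <= q -> sk_S i y * sk_dmu i y = sk_rho y.
Proof.
move=> /andP[py _]; have yN0 : y != 0 by rewrite gt_eqF// (lt_le_trans p0).
by case: i => [|[|[|[|[|[|i]]]]]] /=; rewrite /sk_rho; field.
Qed.

Lemma sk_Sp i : sk_S i p = 0.
Proof. by case: i => [|[|[|[|[|[|i]]]]]] /=; rewrite /sk_rho /sk_P; ring. Qed.

Lemma sk_Sq i : sk_S i q = 0.
Proof. by case: i => [|[|[|[|[|[|i]]]]]] /=; rewrite /sk_rho /sk_P; ring. Qed.

Definition sk_J (i : nat) (l : R) :=
  \int[mu]_(y in `[p, q]) (F (l * sk_mu i y) * (sk_S i y * sk_dmu i y)).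

Definition sk_E (i : nat) (l : R) := - \int[mu]_(y in `[p, q])
  (r (l * sk_mu i y) * (sk_mu i y * (sk_s i y * sk_mu i y + sk_S i y * sk_dmu i y))).

Lemma continuous_itv_sk_mu i y : p <= y <= q -> {for y, continuous (@sk_mu R i)}.
Proof. by move=> yJ; exact: is_derive_continuous (is_derive_sk_mu i yJ). Qed.

Lemma is_derive_sk_J i l : l != 0 -> (forall y, p <= y <= q -> l * sk_mu i y < 1) ->
  is_derive l 1 (sk_J i) (sk_E i l).
Proof.
move=> l0 lm; apply: is_derive_integral_scale_quotient => //.
- exact: is_derive_sk_mu.
- exact: continuous_sk_dmu.
- by move=> y _; exact: is_derive_sk_S.
- by move=> y _; exact: continuous_sk_s.
- exact: sk_Sp.
- exact: sk_Sq.
Qed.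

Lemma continuous_sk_E i l : (forall y, p <= y <= q -> l * sk_mu i y < 1) ->
  {for l, continuous (sk_E i)}.
Proof.
move=> lm; apply: cvgN.
apply: (@continuous_integral_scale R r (@sk_mu R i)
  (fun y => sk_mu i y * (sk_s i y * sk_mu i y + sk_S i y * sk_dmu i y)) p q l) => //.
- exact: ltW.
- exact: continuous_itv_sk_mu.
- move=> y yJ; apply: cvgM; first exact: continuous_itv_sk_mu.
  apply: cvgD; apply: cvgM.
  + exact: continuous_sk_s.
  + exact: continuous_itv_sk_mu.
  + exact: (is_derive_continuous (is_derive_sk_S i y)).
  + exact: continuous_sk_dmu.
Qed.

(** Multiplied by [sk_rho] and integrated over [[p, q]], the equation expresses [F] on ]0, p[ by the
    functions [sk_J i] at [sk_lam i x], and [D] is the termwise derivative. Its continuity at 0,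
    where most scales vanish, rests on the singularity-free form [sk_E]; it later gives the limit of
    F' at 0 from the right. *)
Lemma spence_kummer_derivable : exists D : R -> R,
  {for 0, continuous D} /\ forall x, 0 < x -> x < p -> is_derive x 1 F (D x).
Proof.
have Jy y : p <= y <= q -> 0 < y /\ y < 1.
  by move=> /andP[py yq]; rewrite (lt_le_trans p0 py) (le_lt_trans yq q1).
have rhoc : continuous sk_rho.
  by move=> y; exact: is_derive_continuous (is_derive_sk_rho y).
pose C0 := \int[mu]_(y in `[p, q]) sk_rho y.
(* The weight has positive total mass, so the integrated equation can be solved for [F x]. *)
have C00 : 0 < C0.
  apply: Rintegral_continuous_gt0 => // y /andP[py yq].
  rewrite /sk_rho /sk_P mulr_gt0 ?mulr_gt0 ?subr_gt0//.
  by rewrite expr_lt1// ?(lt_trans yq q1)// ltW// (lt_trans p0).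
pose C1 := \int[mu]_(y in `[p, q]) ((sk_rhs z y - 2 * F y) * sk_rho y).
pose C2 := \int[mu]_(y in `[p, q]) (ln y ^+ 2 * sk_rho y).
have lam_ok i x y : 0 < x -> x < p -> p <= y <= q -> sk_lam i x * sk_mu i y < 1.
  move=> x0 xp /[dup] /Jy[_ y1] /andP[py _].
  by apply: sk_arg_lt1 => //; exact: lt_le_trans py.
have lnc y : p <= y <= q -> {for y, continuous (fun y : R => ln y)}.
  by move=> /Jy[y0 _]; exact: continuous_ln.
have ln2c y : p <= y <= q -> {for y, continuous (fun y : R => ln y ^+ 2)}.
  by move=> /lnc h; apply: (cvgM h h).
have rhsc y : p <= y <= q -> {for y, continuous (fun y => sk_rhs z y - 2 * F y)}.
  move=> yJ; have [y0 y1] := Jy _ yJ.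
  apply: cvgB; last by apply: cvgM; [exact: cvg_cst|exact: Fc].
  apply: cvgD; first apply: cvgD; first apply: cvgB.
  - exact: cvg_cst.
  - apply: cvgM; first exact: ln2c.
    apply: (cvg_continuous_comp (f := @ln R)).
      by apply: continuous_ln; rewrite subr_gt0.
    by apply: cvgB; [exact: cvg_cst|exact: cvg_id].
  - by apply: cvgM; [exact: cvg_cst|exact: lnc].
  - apply: cvgM; last exact: cvg_cst.
    by apply: cvgM; [exact: lnc|exact: ln2c].
have key x : 0 < x -> x < p ->
    F x = (2 * C0)^-1 * (C1 + ln (1 - x) * C2 -
                        \sum_(i < 7) sk_coef R i * sk_J i (sk_lam i x)).
  move=> x0 xp.
  have FJ i y : p <= y <= q -> {for y, continuous (fun y => F (sk_lam i x * sk_mu i y))}.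
    move=> yJ; apply: (cvg_continuous_comp (f := F)); first exact/Fc/lam_ok.
    by apply: cvgM; [exact: cvg_cst|exact: continuous_itv_sk_mu].
  have -> : \sum_(i < 7) sk_coef R i * sk_J i (sk_lam i x) =
      \int[mu]_(y in `[p, q])
        \sum_(i < 7) (sk_coef R i * (F (sk_lam i x * sk_mu i y) * sk_rho y)).
    rewrite (@Rintegral_sum_ord R p q 7
       (fun i y => sk_coef R i * (F (sk_lam i x * sk_mu i y) * sk_rho y))); last first.
      move=> i y yJ; apply: cvgM; first exact: cvg_cst.
      by apply: cvgM; [exact: FJ|exact: rhoc].
    apply: eq_bigr => i _; rewrite RintegralZl//; last first.
      by apply: continuous_itv_integrable => y yJ; apply: cvgM; [exact: FJ|exact: rhoc].
    congr (_ * _); apply: eq_Rintegral => y; rewrite inE/= in_itv/= => yJ.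
    by rewrite sk_S_dmu.
  rewrite /C1 /C2 -RintegralZl//; last first.
    by apply: continuous_itv_integrable => y yJ; apply: cvgM; [exact: ln2c|exact: rhoc].
  rewrite -RintegralD//; last 2 first.
  - by apply: continuous_itv_integrable => y yJ; apply: cvgM; [exact: rhsc|exact: rhoc].
  - apply: continuous_itv_integrable => y yJ; apply: cvgM; first exact: cvg_cst.
    by apply: cvgM; [exact: ln2c|exact: rhoc].
  rewrite -RintegralB//; last 2 first.
  - apply: continuous_itv_integrable => y yJ; apply: cvgD.
      by apply: cvgM; [exact: rhsc|exact: rhoc].
    apply: cvgM; first exact: cvg_cst.
    by apply: cvgM; [exact: ln2c|exact: rhoc].
  - apply: continuous_itv_integrable => y yJ.
    apply: (@cvg_sum_ord _ _ _ _ 7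
      (fun i y => sk_coef R i * (F (sk_lam i x * sk_mu i y) * sk_rho y))
      (fun i => sk_coef R i * (F (sk_lam i x * sk_mu i y) * sk_rho y))) => i.
    apply: cvgM; first exact: cvg_cst.
    by apply: cvgM; [exact: FJ|exact: rhoc].
  have -> : \int[mu]_(y in `[p, q]) (((sk_rhs z y - 2 * F y) * sk_rho y +
      ln (1 - x) * (ln y ^+ 2 * sk_rho y)) -
      \sum_(i < 7) (sk_coef R i * (F (sk_lam i x * sk_mu i y) * sk_rho y))) =
    \int[mu]_(y in `[p, q]) (2 * F x * sk_rho y).
    apply: eq_Rintegral => y; rewrite inE/= in_itv/= => yJ.
    have [y0 y1] := Jy _ yJ; have /andP[py _] := yJ.
    rewrite (spence_kummerE FE x0 (lt_le_trans xp py) y1).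
    rewrite [RHS]mulrBl [in RHS]mulrDl [in RHS]mulr_suml; congr (_ + _ - _).
      by rewrite mulrA.
    by apply: eq_bigr => i _; rewrite mulrA.
  rewrite RintegralZl//; last by apply: continuous_itv_integrable => y _; exact: rhoc.
  by rewrite -/C0; field; rewrite gt_eqF.
exists (fun x => (2 * C0)^-1 * (- (1 - x)^-1 * C2 -
   \sum_(i < 7) sk_coef R i * (sk_E i (sk_lam i x) * sk_dlam i x))); split.
  apply: cvgM; first exact: cvg_cst.
  apply: cvgB.
    apply: cvgM; last exact: cvg_cst.
    by apply: cvgN; exact: (@continuous_sk_lam R 1 0 ltr01).
  apply: (@cvg_sum_ord _ _ _ _ 7
    (fun i x => sk_coef R i * (sk_E i (sk_lam i x) * sk_dlam i x))
    (fun i => sk_coef R i * (sk_E i (sk_lam i 0) * sk_dlam i 0))) => i.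
  apply: cvgM; first exact: cvg_cst.
  apply: cvgM; last exact: continuous_sk_dlam.
  apply: (cvg_continuous_comp (f := sk_E i)); last exact: continuous_sk_lam.
  apply: continuous_sk_E => y /Jy[y0 y1].
  case: i => [|[|[|[|[|[|i]]]]]] /=; rewrite ?subr0 ?invr1
    ?oppr0 ?mul0r ?oppr0 ?mul0r ?mul1r ?ltr01//.
  + lra.
  + rewrite mulN1r (@lt_trans _ _ 0)// oppr_lt0 divr_gt0// subr_gt0//.
move=> x x0 xp; have x1 : x < 1 by rewrite (lt_trans xp)// (lt_trans pq).
have L : is_derive x 1 (fun x : R => ln (1 - x)) (- (1 - x)^-1).
  rewrite -mulrN1; apply: (@is_derive1_comp _ (@ln R) (fun x => 1 - x)).
    by apply: is_derive1_ln; rewrite subr_gt0.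
  by rewrite -[X in is_derive _ _ _ X]sub0r; apply: is_deriveB.
have Jd : is_derive x 1 (fun x => \sum_(i < 7) sk_coef R i * sk_J i (sk_lam i x))
   (\sum_(i < 7) sk_coef R i * (sk_E i (sk_lam i x) * sk_dlam i x)).
  apply: (@is_derive_sum_ord R 7 (fun i x => sk_coef R i * sk_J i (sk_lam i x))
    (fun i => sk_coef R i * (sk_E i (sk_lam i x) * sk_dlam i x))) => i.
  apply: is_deriveZ; apply: (@is_derive1_comp _ (sk_J i) (@sk_lam R i)).
    by apply: is_derive_sk_J => [|y yJ]; [exact: sk_lam_neq0|exact: lam_ok].
  exact: is_derive_sk_lam.
have : is_derive x 1 (fun x => (2 * C0)^-1 * (C1 + ln (1 - x) * C2 -
                        \sum_(i < 7) sk_coef R i * sk_J i (sk_lam i x)))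
  ((2 * C0)^-1 * (- (1 - x)^-1 * C2 -
   \sum_(i < 7) sk_coef R i * (sk_E i (sk_lam i x) * sk_dlam i x))).
  by apply: is_derive_eq; rewrite /GRing.scale/=; ring.
apply: near_eq_is_derive; near=> t; rewrite -key//.
  by near: t; exact: lt_nbhsr.
by near: t; exact: lt_nbhsl.
Unshelve. all: by end_near. Qed.

End smoothing.

(** * Real analytic functions and the trilogarithm *)

(** For [t] strictly between [|x|] and [|K|], the bound (n+1) |x|^n (t - |x|) <= t^(n+1) absorbs the
    factor n+1 of the derived series, which is then dominated by the absolutely convergent series at
    [t]. *)
Lemma is_cvg_pseries_diffs (R : realType) (c : R^nat) (K x : R) :
  cvgn (pseries c K) -> `|x| < `|K| -> cvgn (pseries (pseries_diffs c) x).
Proof.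
move=> cK xK.
pose t := (`|x| + `|K|) / 2.
have xt : `|x| < t by rewrite /t; lra.
have tK : t < `|K| by rewrite /t; lra.
have t0 : 0 < t by exact: le_lt_trans xt.
have d0 : 0 < t - `|x| by rewrite subr_gt0.
have bern n : n.+1%:R * `|x| ^+ n * (t - `|x|) <= t ^+ n.+1.
  elim: n => [|n IH]; first by rewrite expr0 mulr1 mul1r expr1 gerBl.
  have xn : `|x| ^+ n.+1 <= t ^+ n.+1 by rewrite lerXn2r ?nnegrE// ltW.
  rewrite -natr1 mulrDl mul1r mulrDl [t ^+ n.+2]exprS.
  have -> : t * t ^+ n.+1 = `|x| * t ^+ n.+1 + t ^+ n.+1 * (t - `|x|) by ring.
  apply: lerD; last by rewrite ler_wpM2r// ltW.
  by rewrite exprS mulrCA -mulrA ler_wpM2l.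
apply: normed_cvg; rewrite /normed_series_of /=.
apply: (@series_le_cvg _ _ (fun n => (t - `|x|)^-1 * (`|c n.+1| * t ^+ n.+1))) => //.
- by move=> n; rewrite mulr_ge0 ?invr_ge0 ?(ltW d0)// mulr_ge0// exprn_ge0// ltW.
- move=> n; rewrite /pseries_diffs !normrM normrX normr_nat.
  rewrite -ler_pdivrMl ?invr_gt0// invrK.
  have -> : (t - `|x|) * (n.+1%:R * `|c n.+1| * `|x| ^+ n) =
      `|c n.+1| * (n.+1%:R * `|x| ^+ n * (t - `|x|)) by ring.
  by rewrite ler_wpM2l.
- apply: is_cvg_seriesZ.
  have := @is_cvg_pseries_inside_norm _ c K t cK.
  rewrite gtr0_norm// => /(_ tK).
  move=> /cvg_ex[l hl]; apply/cvg_ex; exists (l - `|c 0%N| * t ^+ 0).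
  rewrite (_ : series _ = (fun n => pseries (fun i => `|c i|) t n.+1 - `|c 0%N| * t ^+ 0)).
    by apply: cvgB; [rewrite cvg_shiftS|exact: cvg_cst].
  by apply/funext => n; rewrite /pseries /series/= big_nat_recl//= addrC addKr.
Qed.

Lemma pseries_derive (R : realType) (a rho : R) (c : R^nat) (f : R -> R) :
  (forall x, `|x - a| < rho -> pseries c (x - a) @ \oo --> f x) ->
  forall x, `|x - a| < rho ->
    derivable f x 1 /\ pseries (pseries_diffs c) (x - a) @ \oo --> f^`()%classic x.
Proof.
move=> fr x xr.
(* Each derived series costs some radius, and the differentiation theorem asks for convergence of
   the series and of its first two derived series at one point; hence three nested radii. *)
pose K1 := (`|x - a| + rho) / 2; pose K2 := (K1 + rho) / 2; pose K3 := (K2 + rho) / 2.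
have n0 : 0 <= `|x - a| by [].
have xK1 : `|x - a| < K1 by rewrite /K1; lra.
have K12 : K1 < K2 by rewrite /K2 /K1; lra.
have K23 : K2 < K3 by rewrite /K3 /K2 /K1; lra.
have K3r : K3 < rho by rewrite /K3 /K2 /K1; lra.
have K10 : 0 < K1 by lra.
have K20 : 0 < K2 by lra.
have K30 : 0 < K3 by lra.
have cK3 : cvgn (pseries c K3).
  apply/cvg_ex; exists (f (a + K3)).
  have := fr (a + K3); rewrite [a + K3]addrC addrK gtr0_norm//; exact.
have cK2 : cvgn (pseries (pseries_diffs c) K2).
  by apply: is_cvg_pseries_diffs cK3 _; rewrite !gtr0_norm.
have ddK1 : cvgn (pseries (pseries_diffs (pseries_diffs c)) K1).
  by apply: is_cvg_pseries_diffs cK2 _; rewrite !gtr0_norm.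
have dK1 : cvgn (pseries (pseries_diffs c) K1).
  by apply: is_cvg_pseries_inside cK2 _; rewrite !gtr0_norm.
have cK1 : cvgn (pseries c K1).
  by apply: is_cvg_pseries_inside cK3 _; rewrite !gtr0_norm// (lt_trans K12).
have D : is_derive (x - a) 1 (fun t => limn (pseries c t))
    (limn (pseries (pseries_diffs c) (x - a))).
  by apply: pseries_snd_diffs cK1 dK1 ddK1 _; rewrite [ltRHS]gtr0_norm.
have Ds : is_derive x 1 (fun t => t - a) (1 : R).
  by rewrite -[X in is_derive _ _ _ X]subr0; apply: is_deriveB.
have fD : is_derive x 1 f (limn (pseries (pseries_diffs c) (x - a))).
  have := @is_derive1_comp _ (fun t => limn (pseries c t)) (fun t => t - a) x _ _ D Ds.
  rewrite mulr1; apply: near_eq_is_derive; near=> t.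
  apply/cvg_lim => //; apply: fr.
  have h : `|x - t| < rho - `|x - a|.
    by near: t; exists (rho - `|x - a|) => //=; rewrite subr_gt0.
  have -> : t - a = (x - a) - (x - t) by ring.
  by rewrite (le_lt_trans (ler_normB _ _))//; lra.
split; first exact: ex_derive.
rewrite (is_derive_derive1 fD).
by apply: is_cvg_pseries_inside dK1 _; rewrite [ltRHS]gtr0_norm.
Unshelve. all: by end_near. Qed.

Definition pseries_at (R : realType) (a : R) (c : R^nat) (f : R -> R) :=
  \forall x \near a, pseries c (x - a) @ \oo --> f x.

Lemma pseries_at_derive (R : realType) (a : R) (c : R^nat) (f : R -> R) :
  pseries_at a c f ->
  (\forall x \near a, derivable f x 1) /\ pseries_at a (pseries_diffs c) f^`()%classic.
Proof.
move=> [r /= r0 fr].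
have H := @pseries_derive R a r c f.
have fr' x : `|x - a| < r -> pseries c (x - a) @ \oo --> f x.
  by rewrite distrC; exact: fr.
by split; exists r => //= x /=; rewrite distrC => /(H fr')[].
Qed.

(** By induction on [n]: the constant term is [f a], a limit from the right of zeros, and the
    derivative again vanishes on the right-hand interval and has the derived series. *)
Lemma pseries_at_eq0 (R : realType) (a : R) (c : R^nat) (f : R -> R) (e : R) :
  0 < e -> pseries_at a c f -> (forall x, a < x -> x < a + e -> f x = 0) ->
  forall n, c n = 0.
Proof.
move=> e0 fc f0 n; elim: n c f fc f0 => [|n IH] c f fc f0.
  have [/nbhs_singleton fd _] := pseries_at_derive fc.
  have fa : f a = 0.
    have fca : f x @[x --> a^'+] --> f a.
      apply: cvg_at_right_filter.
      by apply/differentiable_continuous/derivable1_diffP.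
    have f0a : f x @[x --> a^'+] --> (0 : R).
      apply: cvg_near_cst; near=> x; apply: f0 => //.
      by near: x; apply: nbhs_right_lt; rewrite ltrDl.
    exact: (cvg_unique _ fca f0a).
  have := nbhs_singleton fc; rewrite subrr fa => h.
  have h0 : pseries c 0 @ \oo --> c 0%N.
    apply: cvg_near_cst; exists 1%N => // -[|m]//= _.
    rewrite /pseries /series /= big_nat_recl//= expr0 mulr1 big1 ?addr0//.
    by move=> i _; rewrite expr0n mulr0.
  exact: (cvg_unique _ h0 h).
have [_ fc'] := pseries_at_derive fc.
have : pseries_diffs c n = 0.
  apply: IH fc' _ => x ax xe.
  apply: is_derive_derive1.
  apply: (near_eq_is_derive _ (is_derive_cst (0 : R) x 1)).
  near=> t; rewrite f0//; first by near: t; exact: lt_nbhsr.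
  by near: t; exact: lt_nbhsl.
by rewrite /pseries_diffs => /eqP; rewrite mulf_eq0 pnatr_eq0/= => /eqP.
Unshelve. all: by end_near. Qed.

(** Let [s] be the infimum of the points to the right of which [f] vanishes; a point where [f] is
    nonzero bounds it from below. All coefficients at [s] are 0, so [f] also vanishes a little to
    the left of [s], a contradiction. *)
Lemma real_analytic_identity (R : realType) (b : R) (f : R -> R) :
  real_analytic_on `]-oo, b[ f ->
  (exists2 a, a < b & forall x, a < x -> x < b -> f x = 0) ->
  forall x, x < b -> f x = 0.
Proof.
move=> fa [a ab f0] t tb; apply: contrapT => ft.
pose A := [set s | s < b /\ forall x, s < x -> x < b -> f x = 0].
have Aa : A a by [].
have lbA : lbound A t.
  by move=> s [sb sf]; rewrite leNgt; apply/negP => ts; apply: ft; exact: sf.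
have hiA : has_inf A by split; [exists a|exists t].
pose s := inf A.
have sa : s <= a by apply: ge_inf Aa; case: hiA.
have sb : s < b by exact: le_lt_trans ab.
have sf x : s < x -> x < b -> f x = 0.
  move=> sx xb; have [r [rb rf] rx] := inf_lt (proj1 hiA) sx.
  exact: rf.
have [c fc] := fa s sb.
have c0 : forall n, c n = 0.
  apply: (@pseries_at_eq0 _ s c f (b - s)) => //; first by rewrite subr_gt0.
  by move=> x sx; rewrite addrC subrK; exact: sf.
have [r /= r0 fr] := fc.
have fz x : `|s - x| < r -> f x = 0.
  move=> /fr; have -> : pseries c (x - s) = cst 0.
    apply/funext => n; rewrite /pseries /series/= big1// => i _.
    by rewrite c0 mul0r.
  by move=> h; apply/esym/(cvg_unique _ _ h) => //; exact: cvg_cst.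
have : A (s - r / 2).
  split; first by rewrite (lt_trans _ sb)// ltrBlDr ltrDl divr_gt0.
  move=> x sx xb; have [sx'|xs] := ltP s x; first exact: sf.
  by apply: fz; rewrite ger0_norm ?subr_ge0//; lra.
move=> /(ge_inf (proj2 hiA)); rewrite -/s; lra.
Qed.

Lemma real_analytic_derive (R : realType) (D : set R) (f : R -> R) :
  real_analytic_on D f ->
  (forall x, D x -> derivable f x 1) /\ real_analytic_on D f^`()%classic.
Proof.
move=> fa; split => [x /fa[c /pseries_at_derive[/nbhs_singleton//]]|].
by move=> x /fa[c /pseries_at_derive[_ ?]]; exists (pseries_diffs c).
Qed.

(** Serves for x f'(x) and for (1 - x) f'(x) - 1, the function to which the identity theorem is
    applied. *)
Lemma real_analytic_affineM (R : realType) (D : set R) (f : R -> R) (u v w : R) :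
  real_analytic_on D f -> real_analytic_on D (fun x => (u + v * x) * f x + w).
Proof.
move=> fa a /fa[c fc].
(* As u + v x = (u + v a) + v (x - a), the coefficients are scaled and shifted; [w] enters at index
   0, which the shift leaves free. *)
exists (fun n => (u + v * a) * c n + (if n is m.+1 then v * c m else w)).
apply: filterS fc => x fx.
rewrite -cvg_shiftS.
have -> : [sequence pseries (fun n => (u + v * a) * c n +
    (if n is m.+1 then v * c m else w)) (x - a) n.+1]_n =
  (fun n => (u + v * a) * pseries c (x - a) n.+1 +
            (v * (x - a) * pseries c (x - a) n + w)).
  apply/funext => n; rewrite /pseries /series /=.
  under eq_bigr do rewrite mulrDl.
  rewrite big_split/= mulr_sumr; congr (_ + _).
    by apply: eq_bigr => i _; rewrite mulrA.
  rewrite big_nat_recl//= expr0 mulr1 addrC mulr_sumr; congr (_ + _).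
  by apply: eq_bigr => i _; rewrite exprS; ring.
have -> : (u + v * x) * f x + w = (u + v * a) * f x + (v * (x - a) * f x + w) by ring.
apply: cvgD; first by apply: cvgM; [exact: cvg_cst|rewrite cvg_shiftS].
by apply: cvgD; [apply: cvgM => //; exact: cvg_cst|exact: cvg_cst].
Qed.

Lemma pseries_mulX (R : realType) (c : R^nat) (x l : R) :
  pseries c x @ \oo --> l ->
  pseries (fun n => if n is m.+1 then c m else 0) x @ \oo --> x * l.
Proof.
move=> cl; rewrite -cvg_shiftS.
have -> : [sequence pseries (fun n => if n is m.+1 then c m else 0) x n.+1]_n =
    (fun n => x * pseries c x n).
  apply/funext => n; rewrite /pseries /series /=.
  rewrite big_nat_recl//= mul0r add0r mulr_sumr.
  by apply: eq_bigr => i _; rewrite exprS mulrCA.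
by apply: cvgM => //; exact: cvg_cst.
Qed.

Lemma is_derive0_cst (R : realType) (h : R -> R) (b x y : R) :
  (forall t, t < b -> is_derive t 1 h 0) -> x < b -> y < b -> h x = h y.
Proof.
move=> hd; wlog xy : x y / x <= y => [H xb yb|xb yb].
  by have [xy|/ltW yx] := leP x y; [exact: H|apply/esym/H].
have [||c _] := @MVT_segment R h (cst 0) x y xy.
- move=> t; rewrite in_itv/= => /andP[_ ty]; apply: hd; exact: lt_trans yb.
- apply: within_itv_continuous => t /andP[_ ty].
  by apply: is_derive_continuous; apply: hd; exact: le_lt_trans yb.
by rewrite /cst mul0r => /eqP; rewrite subr_eq0 => /eqP.
Qed.

Section trilogarithm.
Variables (R : realType) (L : R -> R).
Hypothesis hL : is_trilogarithm L.

(** The operator x d/dx, that is, differentiation in log x; it takes each polylogarithm to the one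
    of the next lower order. *)
Definition mulX_derive (f : R -> R) (x : R) : R := x * f^`()%classic x.

Lemma real_analytic_mulX_derive (D : set R) (f : R -> R) :
  real_analytic_on D f -> real_analytic_on D (mulX_derive f).
Proof.
move=> /real_analytic_derive[_ /(@real_analytic_affineM _ _ _ 0 1 0)].
congr real_analytic_on; apply/funext => x.
by rewrite /mulX_derive add0r mul1r addr0.
Qed.

(** x d/dx multiplies the coefficient of index n by n. At index 0 both sides are 0 because
    [0^-1 = 0]. *)
Lemma pseries_mulX_derive (k : nat) (f : R -> R) :
  (forall x, `|x| < 1 -> pseries (fun n => n%:R ^- k.+2) x @ \oo --> f x) ->
  forall x, `|x| < 1 -> pseries (fun n => n%:R ^- k.+1) x @ \oo --> mulX_derive f x.
Proof.
move=> fk x x1.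
have H y : `|y - 0| < 1 -> pseries (fun n => n%:R ^- k.+2) (y - 0) @ \oo --> f y.
  by rewrite subr0; exact: fk.
have [|_ Hx] := pseries_derive H (x := x); first by rewrite subr0.
rewrite subr0 in Hx; have := pseries_mulX Hx.
have E : (fun n => if n is m.+1 then
    pseries_diffs (fun n => n%:R ^- k.+2) m else 0) = (fun n => n%:R ^- k.+1 : R).
  apply/funext => -[|n]; first by rewrite expr0n/= invr0.
  by rewrite /pseries_diffs [n.+1%:R ^+ k.+2]exprS invfM mulrA mulfV ?mul1r// pnatr_eq0.
by rewrite E.
Qed.

Lemma trilogarithm_derivable (x : R) : x < 1 ->
  derivable L x 1 /\ derivable (mulX_derive L) x 1.
Proof.
move=> x1; have [La _ _] := hL.
have [Ld _] := real_analytic_derive La.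
have [L1d _] := real_analytic_derive (real_analytic_mulX_derive La).
by split; [apply: Ld|apply: L1d]; rewrite /= in_itv.
Qed.

(** On the unit interval the left-hand side is the sum of x^n/n, with a geometric series as
    derivative. The relation (1 - x) L2' = 1 extends to ]-oo, 1[ by the identity theorem and is then
    integrated from 0. *)
Lemma trilogarithm_ode (x : R) : x < 1 ->
  mulX_derive (mulX_derive L) x = - ln (1 - x).
Proof.
have [La L3 _] := hL.
have L1a := real_analytic_mulX_derive La.
have L2a := real_analytic_mulX_derive L1a.
have [L2d L2'a] := real_analytic_derive L2a.
set L2 := mulX_derive (mulX_derive L) in L2a L2d L2'a *.
have L2s := pseries_mulX_derive (pseries_mulX_derive L3).
have L2'0 t : `|t| < 1 -> L2^`()%classic t = (1 - t)^-1.
  move=> t1.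
  have H y : `|y - 0| < 1 -> pseries (fun n => n%:R ^- 1) (y - 0) @ \oo --> L2 y.
    by rewrite subr0; exact: L2s.
  have [|_] := pseries_derive H (x := t); first by rewrite subr0.
  rewrite subr0 => Ht; apply: (cvg_unique _ Ht) => //.
  have := @cvg_geometric_series R 1 t t1; rewrite mul1r.
  rewrite (_ : series _ = pseries (pseries_diffs (fun n => n%:R ^- 1)) t); first exact.
  apply/funext => n; rewrite /pseries /series /=.
  by apply: eq_bigr => i _; rewrite /pseries_diffs /geometric/= expr1 mulfV ?pnatr_eq0.
have E0 t : t < 1 -> (1 + (-1) * t) * L2^`()%classic t + (-1) = 0.
  apply: real_analytic_identity (real_analytic_affineM 1 (-1) (-1) L2'a) _ t.
  exists 0 => // t t0 t1; rewrite L2'0 ?gtr0_norm// mulN1r mulfV ?subrr//.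
  by rewrite gt_eqF// subr_gt0.
move=> x1.
have : L2 x + ln (1 - x) = L2 0 + ln (1 - 0).
  apply: (@is_derive0_cst R (fun x => L2 x + ln (1 - x)) 1) => // t t1.
  have t1' : 0 < 1 - t by rewrite subr_gt0.
  have D1 : is_derive t 1 L2 (L2^`()%classic t).
    by apply: DeriveDef; [apply: L2d; rewrite /= in_itv|rewrite derive1E].
  have D2 : is_derive t 1 (fun x : R => ln (1 - x)) ((1 - t)^-1 * -1).
    apply: (@is_derive1_comp _ (@ln R) (fun x => 1 - x)); first exact: is_derive1_ln.
    by rewrite -[X in is_derive _ _ _ X]sub0r; apply: is_deriveB.
  have -> : 0 = L2^`()%classic t + (1 - t)^-1 * -1.
    have := E0 _ t1; rewrite mulN1r => /eqP; rewrite subr_eq0 => /eqP E1.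
    by rewrite -[X in X + _](mulKf (lt0r_neq0 t1')) E1 mulr1 mulrN1 subrr.
  exact: is_deriveD.
rewrite /L2 {3}/mulX_derive mul0r subr0 ln1 addr0 => /eqP.
by rewrite addr_eq0 => /eqP.
Qed.

Lemma trilogarithm0 : L 0 = 0.
Proof.
have [_ /(_ 0) L0 _] := hL.
have {}L0 := L0 _; rewrite normr0 in L0.
apply: (cvg_unique _ (L0 ltr01)) => //.
apply: cvg_near_cst; exists 1%N => // -[|m]//= _.
rewrite /pseries /series /= big_nat_recl//= expr0n/= invr0 mul0r add0r big1//.
by move=> i _; rewrite expr0n mulr0.
Qed.

(** All terms are nonnegative, so for 0 < y < 1 the value [L y] lies between any partial sum at [y]
    and [L 1]; a fixed partial sum is continuous in [y]. *)
Lemma trilogarithm_cvg1 : L y @[y --> 1^'-] --> L 1.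
Proof.
have [_ L3 L1] := hL.
have a0 n : 0 <= n%:R ^- 3 :> R by rewrite invr_ge0 exprn_ge0.
have nd : nondecreasing_seq (series (fun n => n%:R ^- 3 : R)).
  by apply: nondecreasing_series => n _ _; exact: a0.
apply/cvgrPdist_lt => e e0.
have [N _ NL] : \forall N \near \oo, `|L 1 - series (fun n => n%:R ^- 3 : R) N| < e / 2.
  by move/cvgrPdist_lt : L1; apply; rewrite divr_gt0.
have SN : pseries (fun n => n%:R ^- 3) y N @[y --> 1^'-] -->
    series (fun n => n%:R ^- 3 : R) N.
  rewrite (_ : series _ N = pseries (fun n => n%:R ^- 3 : R) 1 N); last first.
    by rewrite /pseries /series/=; apply: eq_bigr => i _; rewrite expr1n mulr1.
  apply: cvg_at_left_filter; rewrite /pseries /series/=.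
  rewrite big_mkord (_ : (fun y => _) = (fun y : R => \sum_(i < N) i%:R ^- 3 * y ^+ i)).
    apply: (@cvg_sum_ord _ _ _ _ N (fun i y => i%:R ^- 3 * y ^+ i)
      (fun i => i%:R ^- 3 * 1 ^+ i)) => i.
    by apply: cvgM; [exact: cvg_cst|exact: exprn_continuous].
  by apply/funext => y; rewrite big_mkord.
near=> y.
have y0 : 0 < y by near: y; exact: nbhs_left_gt.
have y1 : y < 1 by [].
have Ly := L3 y _; rewrite gtr0_norm// in Ly.
have yd : nondecreasing_seq (pseries (fun n => n%:R ^- 3) y).
  by apply: nondecreasing_series => n _ _; rewrite mulr_ge0// exprn_ge0// ltW.
have Lyge : pseries (fun n => n%:R ^- 3) y N <= L y.
  have := nondecreasing_cvgn_le yd (cvgP _ (Ly y1)) N.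
  by rewrite (cvg_lim _ (Ly y1)).
have Lyle : L y <= L 1.
  apply: (ler_cvg_to (Ly y1) L1); near=> n.
  rewrite /pseries /series/=; apply: ler_sum => i _.
  by rewrite ler_piMr// exprn_ile1// ltW.
have : `|series (fun n => n%:R ^- 3 : R) N - pseries (fun n => n%:R ^- 3) y N| < e / 2.
  by near: y; move/cvgrPdist_lt : SN; apply; rewrite divr_gt0.
have := NL N (leqnn N).
rewrite !ltr_norml => /andP[_ ?] /andP[_ ?].
by apply/andP; split; lra.
Unshelve. all: by end_near. Qed.

End trilogarithm.

(** * First-order behaviour at 0 *)

Lemma near_eq_continuous (R : realType) (f g : R -> R) (x : R) :
  (\forall t \near x, f t = g t) -> {for x, continuous g} -> {for x, continuous f}.
Proof.
move=> fg gc; change (f t @[t --> x] --> f x).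
rewrite (nbhs_singleton fg); apply: cvg_trans gc; apply: near_eq_cvg.
by apply: filterS fg => t ->.
Qed.

Section near_zero.
Variables (R : realType) (z : R) (F : R -> R).
Hypothesis FE : spence_kummer z F.
Hypothesis mF : lebesgue_measurable_fun `]-oo, 1[ F.
Hypothesis F0d : derivable F 0 1.

Let F' : R -> R := F^`()%classic.
Let alpha : R := F' 0.

Let is_derive_F0 : is_derive (0 : R) 1 F alpha.
Proof. by apply: DeriveDef => //; rewrite /alpha /F' derive1E. Qed.

Let cF0 : {for 0, continuous F} := is_derive_continuous is_derive_F0.

Let cF01 (x : R) : 0 < x -> x < 1 -> {for x, continuous F}.
Proof. exact: spence_kummer_continuous FE _ mF. Qed.

(** The solution y of 1 - 1/y = v. It maps ]-oo, 0[ into ]0, 1[, so the three-term relation at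
    [phi v] expresses [F v] by values of [F] on ]0, 1[. *)
Let phi (v : R) := (1 - v)^-1.

Let FNE (v : R) : v < 0 ->
  F v = 2^-1 * (sk_rhs z (phi v) - 3 * F 0) - F (phi v) - F (1 - phi v).
Proof.
move=> v0; have v1 : 0 < 1 - v by lra.
have p0 : 0 < phi v by rewrite invr_gt0.
have p1 : phi v < 1 by rewrite invf_lt1//; lra.
have := spence_kummer3 FE cF0 cF01 p0 p1.
by rewrite {4}/phi invrK subKr => E; lra.
Qed.

Let is_derive_phi (v : R) : v < 1 -> is_derive v 1 phi ((1 - v) ^- 2).
Proof. by move=> v1; exact: (@is_derive_sk_lam R 1 v v1). Qed.

Let phi01 (v : R) : v < 0 -> 0 < phi v /\ phi v < 1.
Proof.
move=> v0; have v1 : 0 < 1 - v by lra.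
by rewrite invr_gt0 v1 invf_lt1//; split => //; lra.
Qed.

Let is_derive_sk_rhs (y : R) : 0 < y -> y < 1 ->
  exists d : R, is_derive y 1 (sk_rhs z) d.
Proof.
move=> y0 y1; have D1 := is_derive1_ln y0.
have D2 : is_derive y 1 (fun x : R => ln (1 - x)) ((1 - y)^-1 * -1).
  apply: (@is_derive1_comp _ (@ln R) (fun x => 1 - x)).
    by apply: is_derive1_ln; rewrite subr_gt0.
  by rewrite -[X in is_derive _ _ _ X]sub0r; apply: is_deriveB.
by eexists; rewrite /sk_rhs; apply: is_derive_eq.
Qed.

Let cF (t : R) : t < 1 -> {for t, continuous F}.
Proof.
move=> t1; have [t0|t0|->//] := ltgtP t 0; last exact: cF01.
have [p0 p1] := phi01 t0.
have cphi := is_derive_continuous (is_derive_phi t1).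
have [d /is_derive_continuous cr] := is_derive_sk_rhs p0 p1.
have c2 : {for t, continuous (fun v => 2^-1 * (sk_rhs z (phi v) - 3 * F 0) -
    F (phi v) - F (1 - phi v))}.
  apply: cvgB; first apply: cvgB.
  - apply: cvgM; first exact: cvg_cst.
    apply: cvgB; last exact: cvg_cst.
    exact: (cvg_continuous_comp cr).
  - by apply: (cvg_continuous_comp (cF01 p0 p1)).
  - apply: (cvg_continuous_comp (f := F) (g := fun v => 1 - phi v)).
      by apply: cF01; lra.
    by apply: cvgB => //; exact: cvg_cst.
apply: near_eq_continuous c2; near=> v; rewrite FNE//.
by near: v; exact: lt_nbhsl.
Unshelve. all: by end_near. Qed.

(** The difference quotient of [F] at 0, completed by [alpha]; its continuity at 0 is the
    differentiability of [F] there. *)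
Let r (t : R) := if t == 0 then alpha else (F t - F 0) / t.

Let Fr (t : R) : F t = F 0 + t * r t.
Proof.
rewrite /r; case: eqVneq => [->|t0]; first by rewrite mul0r addr0.
by rewrite mulrC divfK// addrC subrK.
Qed.

Let rc (t : R) : t < 1 -> {for t, continuous r}.
Proof.
move=> t1; have [->|t0] := eqVneq t 0.
  change (r t @[t --> 0] --> r 0); rewrite {2}/r eqxx.
  apply/cvgrPdist_lt => e e0.
  have /cvg_ex[/= l] := F0d; rewrite /= => Fl.
  have la : l = alpha.
    rewrite /alpha /F' /derive1.
    by apply/esym/cvg_lim => //; move: Fl; under eq_fun do rewrite scaler1.
  move/cvgrPdist_lt : Fl => /(_ _ e0) [d /= d0 H].
  exists d => //= t' td; rewrite /r; case: eqVneq => [_|tN0].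
    by rewrite subrr normr0.
  have := H t'; rewrite /= => /(_ td tN0).
  by rewrite scaler1 addr0 la /GRing.scale/= mulrC.
have c2 : {for t, continuous (fun t => (F t - F 0) / t)}.
  apply: cvgM; last exact: cvgV.
  by apply: cvgB; [exact: cF|exact: cvg_cst].
apply: near_eq_continuous c2; near=> v; rewrite /r ifN//.
near: v; exists `|t| => /=; first by rewrite normr_gt0.
by move=> s /=; apply: contraTneq => ->; rewrite subr0 ltxx.
Unshelve. all: by end_near. Qed.

Let dF01 (x : R) : 0 < x -> x < 1 -> derivable F x 1.
Proof.
move=> x0 x1; pose p := (2 * x + 1) / 3; pose q := (x + 2) / 3.
have xp : x < p by rewrite /p; lra.
have pq : p < q by rewrite /p /q; lra.
have q1 : q < 1 by rewrite /q; lra.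
have [D [_ FD]] := spence_kummer_derivable FE cF rc Fr (lt_trans x0 xp) pq q1.
by have := FD _ x0 xp => h; exact: ex_derive.
Qed.

Lemma spence_kummer_derivable_lt1 (t : R) : t < 1 -> derivable F t 1.
Proof.
move=> t1; have [t0|t0|->//] := ltgtP t 0; last exact: dF01.
have [p0 p1] := phi01 t0.
have dphi := is_derive_phi t1.
have [d dr] := is_derive_sk_rhs p0 p1.
have D1 := is_derive1_comp dr dphi.
have dF1 : is_derive (phi t) 1 F (F' (phi t)).
  by apply: DeriveDef; [exact: dF01|rewrite /F' derive1E].
have D2 := is_derive1_comp dF1 dphi.
have dF2 : is_derive (1 - phi t) 1 F (F' (1 - phi t)).
  by apply: DeriveDef; [apply: dF01; lra|rewrite /F' derive1E].
have dphi1 : is_derive t 1 (fun t => 1 - phi t) (0 - (1 - t) ^- 2).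
  exact: is_deriveB.
have D3 := @is_derive1_comp R F (fun t => 1 - phi t) _ _ _ dF2 dphi1.
have D : derivable (fun v => 2^-1 * (sk_rhs z (phi v) - 3 * F 0) -
    F (phi v) - F (1 - phi v)) t 1.
  have Da := is_deriveB D1 (is_derive_cst (3 * F 0) t 1).
  have Db := is_deriveZ 2^-1 Da.
  have Dc := is_deriveB (is_deriveB Db D2) D3.
  by case: Dc => Dd _; exact: Dd.
apply: near_eq_derivable D; near=> v; rewrite -FNE//.
by near: v; exact: lt_nbhsl.
Unshelve. all: by end_near. Qed.

Let dF (t : R) : t < 1 -> is_derive t 1 F (F' t).
Proof.
move=> t1; apply: DeriveDef; last by rewrite /F' derive1E.
exact: spence_kummer_derivable_lt1.
Qed.

(* First-order term of the equation as [x] tends to [0], with [y = 1 - u]. *)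
Lemma spence_kummer_landen (u : R) : 0 < u -> u < 1 ->
  u * F' u + u / (u - 1) * F' (u / (u - 1)) = - 2^-1 * ln (1 - u) ^+ 2.
Proof.
move=> u0 u1; pose y := 1 - u.
have y0 : 0 < y by rewrite /y; lra.
have y1 : y < 1 by rewrite /y; lra.
have yN0 : y != 0 by rewrite gt_eqF.
have um : u - 1 != 0 by rewrite lt_eqF// subr_lt0.
have um' : 1 - u != 0 by rewrite gt_eqF// subr_gt0.
pose h (i : nat) x := sk_coef R i * F (sk_lam i x * sk_mu i y).
(* The difference of the two sides of the equation. It vanishes for 0 < x < y and is differentiable
   at 0, so its derivative there is the limit of zero quotients from the right. *)
pose Th x := 2 * F x + \sum_(i < 7) h i x + - (sk_rhs z y - 2 * F y + ln y ^+ 2 * ln (1 - x)).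
have arg i : sk_lam i 0 * sk_mu i y < 1.
  case: i => [|[|[|[|[|[|i]]]]]] /=; rewrite ?subr0 ?invr1
    ?oppr0 ?mul0r ?oppr0 ?mul0r ?mul1r ?ltr01//.
    lra.
  by rewrite mulN1r (@lt_trans _ _ 0)// oppr_lt0 divr_gt0// subr_gt0.
have dh i : is_derive (0 : R) 1 (h i)
    (sk_coef R i * (F' (sk_lam i 0 * sk_mu i y) * (sk_mu i y * sk_dlam i 0))).
  apply: is_deriveZ.
  apply: (@is_derive1_comp _ F (fun x => sk_lam i x * sk_mu i y)); first exact: dF.
  rewrite (_ : (fun x => _) = (fun x => sk_mu i y * sk_lam i x)); last first.
    by apply/funext => x; rewrite mulrC.
  by apply: is_deriveZ; exact: is_derive_sk_lam.
have dln : is_derive (0 : R) 1 (fun x : R => ln (1 - x)) (-1).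
  rewrite -[X in is_derive _ _ _ X]mul1r -[X in X * _]invr1.
  apply: (@is_derive1_comp _ (@ln R) (fun x => 1 - x)).
    by rewrite -[X in _ X^-1](subr0 1); apply: is_derive1_ln; rewrite subr0.
  by rewrite -[X in is_derive _ _ _ X]sub0r; apply: is_deriveB.
have dTh : is_derive (0 : R) 1 Th (2 * alpha +
    \sum_(i < 7) sk_coef R i * (F' (sk_lam i 0 * sk_mu i y) * (sk_mu i y * sk_dlam i 0)) +
    - (0 + ln y ^+ 2 * -1)).
  have dA : is_derive (0 : R) 1 (fun x => 2 * F x) (2 * alpha) by exact: is_deriveZ.
  have dS := @is_derive_sum_ord R 7 h _ 0 dh.
  have dC : is_derive (0 : R) 1 (fun x => ln y ^+ 2 * ln (1 - x)) (ln y ^+ 2 * -1).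
    exact: is_deriveZ.
  have dD := is_deriveD (is_derive_cst (sk_rhs z y - 2 * F y) (0 : R) 1) dC.
  exact: (is_deriveB (is_deriveD dA dS) dD).
have Th0 x : 0 < x -> x < y -> Th x = 0.
  by move=> x0 xy; rewrite /Th (spence_kummerE FE x0 xy y1) /h; ring.
have Th00 : Th 0 = 0.
  have cT : Th x @[x --> 0^'+] --> Th 0.
    by apply: cvg_at_right_filter; exact: is_derive_continuous dTh.
  apply: (cvg_unique _ cT) => //; apply: cvg_near_cst; near=> x.
  have xy : x < y by near: x; exact: nbhs_right_lt.
  exact: Th0.
have : Th^`()%classic 0 = 0.
  have := @ex_derive _ _ _ _ _ _ _ dTh.
  move=> /cvg_ex[/= l Tl].
  have -> : Th^`()%classic 0 = l.
    by rewrite /derive1; apply: cvg_lim => //; move: Tl; under eq_fun do rewrite scaler1.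
  have Tr : h0^-1 *: (Th (h0 *: 1 + 0) - Th 0) @[h0 --> 0^'+] --> l.
    exact: cvg_dnbhs_at_right.
  apply: (cvg_unique _ Tr) => //; apply: cvg_near_cst; near=> x.
  have xy : x < y by near: x; exact: nbhs_right_lt.
  by rewrite scaler1 addr0 Th00 Th0 ?subrr ?scaler0.
rewrite (is_derive_derive1 dTh) !big_ord_recl big_ord0 /=.
rewrite !mul0r subr0 invr1 oppr0 !mul0r mul1r expr1n invr1 -/alpha.
have -> : - (1) * ((1 - y) / y) = u / (u - 1).
  by rewrite /y; field; rewrite ?um ?um'.
have -> : 1 - y = u by rewrite /y subKr.
have -> : u / y = - (u / (u - 1)).
  by rewrite /y; field; rewrite ?um ?um'.
have -> : u / (u - 1) = 1 - y^-1.
  by rewrite /y; field; rewrite ?um ?um'.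
have -> : u = 1 - y by rewrite /y subKr.
move=> E.
have -> : 1 - (1 - y) = y by ring.
(* The contributions of all arguments tending to 0 are multiples of [alpha], and they cancel; only
   the indices 1 and 5 survive. *)
have E2 : 2 * alpha - (alpha * y^-1) + 2 * (alpha * (y^-1 - 1)) - alpha * y
   - 2 * (alpha * (1 - y)) - alpha * ((1 - y) ^+ 2 / y) = 0 by field.
have e3 : (1 - y) ^+ 2 / y = y^-1 - 2 + y by field.
rewrite e3 in E E2.
rewrite !mulr1 !mulrN1 !addr0 add0r !mul1r in E.
lra.
Unshelve. all: by end_near. Qed.

(** To the right of 0 the derivative is a function continuous at 0, hence has a limit; l'Hopital's
    rule for (F x - F 0)/x identifies that limit with F'(0). The values 1/3 and 2/3 are an arbitrary
    choice of interval. *)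
Lemma spence_kummer_derive_cvg_right : F' x @[x --> 0^'+] --> F' 0.
Proof.
have [D [cD FD]] := spence_kummer_derivable FE cF rc Fr
  (p := 3^-1) (q := 2 / 3) ltac:(lra) ltac:(lra) ltac:(lra).
have FD0 : F' x @[x --> 0^'+] --> D 0.
  have : D x @[x --> 0^'+] --> D 0 by exact: cvg_at_right_filter.
  apply: cvg_trans; apply: near_eq_cvg; near=> x.
  have x3 : x < 3^-1 by near: x; apply: nbhs_right_lt; lra.
  by rewrite /F' (is_derive_derive1 (FD x _ x3)).
suff -> : F' 0 = D 0 by [].
have r0 : r x @[x --> 0^'+] --> r 0 by apply: cvg_at_right_filter; exact: rc.
have {r0} r0 : (F x - F 0) / x @[x --> 0^'+] --> F' 0.
  move: r0; rewrite {2}/r eqxx; apply: cvg_trans; apply: near_eq_cvg; near=> x.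
  by rewrite /r gt_eqF.
apply: (cvg_unique _ r0) => //.
apply: (@lhopital_at_right R (fun x => F x - F 0) F' id (cst 1) 0 1) => //.
- move=> x; rewrite in_itv/= => /andP[x0 x1].
  by rewrite -[X in is_derive _ _ _ X]subr0; apply: is_deriveB; exact: dF.
- rewrite -[X in _ --> X](subrr (F 0)); apply: cvgB; last exact: cvg_cst.
  by apply: cvg_at_right_filter.
- by apply: cvg_at_right_filter; exact: cvg_id.
- by move=> x _; rewrite /cst oner_eq0.
- by under eq_fun do rewrite divr1.
Unshelve. all: by end_near. Qed.

End near_zero.

(** * Second differences *)

(* If [chi] exceeded its logarithmic interpolation somewhere, adding a small
   multiple of [(ln x - ln a) (ln x - ln b)] would give an interior maximum with
   a positive second derivative. *)
Lemma schwarz_log_concave (R : realType) (chi : R -> R) (a b m : R) :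
  0 < a -> a < m -> m < b ->
  (forall x, a <= x <= b -> {for x, continuous chi}) ->
  (forall x, a < x -> x < b ->
     (chi (x / (1 - e)) + chi (x * (1 - e)) - 2 * chi x) / e ^+ 2 @[e --> 0^'+] --> (0 : R)) ->
  chi m * (ln b - ln a) <= chi a * (ln b - ln m) + chi b * (ln m - ln a).
Proof.
move=> a0 am mb chic chi2.
have m0 := lt_trans a0 am; have b0 := lt_trans m0 mb.
have lam : ln a < ln m by rewrite ltr_ln.
have lmb : ln m < ln b by rewrite ltr_ln.
have lab : 0 < ln b - ln a by lra.
rewrite leNgt; apply/negP => H.
pose l x := (chi a * (ln b - ln x) + chi b * (ln x - ln a)) / (ln b - ln a).
pose gap := chi m - l m.
have gap0 : 0 < gap by rewrite /gap /l subr_gt0 ltr_pdivrMr.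
pose w := (ln m - ln a) * (ln b - ln m).
have w0 : 0 < w by rewrite mulr_gt0// subr_gt0.
(* At [m] the quadratic term equals [- d * w = - gap / 2], so half of the gap remains. *)
pose d := gap / (2 * w).
have d0 : 0 < d by rewrite divr_gt0// mulr_gt0.
pose k x := chi x - l x + d * ((ln x - ln a) * (ln x - ln b)).
have km : 0 < k m.
  have -> : k m = gap / 2.
    by rewrite /k /gap /d /gap /w; field; rewrite !subr_eq0 !gt_eqF.
  by rewrite divr_gt0.
have ka : k a = 0 by rewrite /k /l; field; rewrite gt_eqF.
have kb : k b = 0 by rewrite /k /l; field; rewrite gt_eqF.
have ab : a <= b by rewrite ltW// (lt_trans am).
have [c cab cmax] : exists2 c, c \in `[a, b] & forall t, t \in `[a, b] -> k t <= k c.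
  apply: EVT_max => //; apply: within_itv_continuous => t /[dup] tab /andP[ta tb].
  have lnc : {for t, continuous (@ln R)} by apply: continuous_ln; exact: lt_le_trans ta.
  have lB s : {for t, continuous (fun t => ln t - s)} by apply: cvgB => //; exact: cvg_cst.
  have lB' s : {for t, continuous (fun t => s - ln t)} by apply: cvgB => //; exact: cvg_cst.
  apply: cvgD; first apply: cvgB.
  - exact: chic.
  - apply: cvgM; last exact: cvg_cst.
    by apply: cvgD; apply: cvgM; [exact: cvg_cst|exact: lB'|exact: cvg_cst|exact: lB].
  - apply: cvgM; first exact: cvg_cst.
    by apply: cvgM; exact: lB.
have kc : 0 < k c by rewrite (lt_le_trans km)// cmax// in_itv/= !ltW.
have [ac cb] : a < c /\ c < b.
  move: cab; rewrite in_itv/= => /andP[ac cb]; rewrite !lt_neqAle ac cb !andbT.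
  by split; apply/eqP => E; move: kc; rewrite ?E ?kb -?E ?ka ltxx.
have c0 := lt_trans a0 ac.
pose q e := (chi (c / (1 - e)) + chi (c * (1 - e)) - 2 * chi c) / e ^+ 2.
have := chi2 c ac cb; rewrite -/q => qc.
(* At the interior maximum [c] the second difference of [k] is nonpositive, that of [l], affine in
   log x, is 0, and that of the quadratic term is 2 d log(1-e)^2 >= 2 d e^2. The quotient for [chi]
   is thus at most -2d and cannot tend to 0. *)
have nq : \forall e \near 0^'+, q e <= - (2 * d).
  near=> e.
  have e0 : 0 < e by [].
  have ec : e < 1 - c / b.
    by near: e; apply: nbhs_right_lt; rewrite subr_gt0 ltr_pdivrMr// mul1r.
  have ea : e < 1 - a / c.
    by near: e; apply: nbhs_right_lt; rewrite subr_gt0 ltr_pdivrMr// mul1r.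
  have cb0 : 0 < c / b by rewrite divr_gt0.
  have y0 : 0 < 1 - e by lra.
  have y1 : 1 - e < 1 by lra.
  have lny : e <= - ln (1 - e).
    have := @le_ln1Dx R (- e); rewrite lerNr => /(_ _); apply; lra.
  have x1 : a <= c / (1 - e) <= b.
    apply/andP; split.
      rewrite ler_pdivlMr//; apply: (@le_trans _ _ a); last exact: ltW.
      by rewrite ler_piMr// ltW.
    by rewrite ler_pdivrMr// mulrC -ler_pdivrMr//; lra.
  have x2 : a <= c * (1 - e) <= b.
    apply/andP; split.
      by rewrite mulrC -ler_pdivrMr//; lra.
    by rewrite (le_trans _ (ltW cb))// ler_piMr// ltW.
  have k1 : k (c / (1 - e)) <= k c by apply: cmax; rewrite in_itv.
  have k2 : k (c * (1 - e)) <= k c by apply: cmax; rewrite in_itv.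
  have l1 : ln (c / (1 - e)) = ln c - ln (1 - e) by rewrite ln_div.
  have l2 : ln (c * (1 - e)) = ln c + ln (1 - e) by rewrite lnM.
  rewrite /q ler_pdivrMr ?exprn_gt0//.
  have key : chi (c / (1 - e)) + chi (c * (1 - e)) - 2 * chi c =
      k (c / (1 - e)) + k (c * (1 - e)) - 2 * k c - 2 * d * ln (1 - e) ^+ 2.
    rewrite /k /l l1 l2; field; rewrite gt_eqF//.
  have e2 : e ^+ 2 <= ln (1 - e) ^+ 2.
    by rewrite -[leRHS]sqrrN lerXn2r ?nnegrE// ltW// (lt_le_trans e0).
  rewrite key mulNr; have := ler_wpM2l (ltW (mulr_gt0 (ltr0Sn _ 1) d0)) e2; lra.
have h : (0 : R) <= - (2 * d) by exact: cvgr_to_le qc nq.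
by move: h; rewrite oppr_ge0 leNgt mulr_gt0.
Unshelve. all: by end_near. Qed.

Lemma schwarz_log_affine (R : realType) (chi : R -> R) (a b m : R) :
  0 < a -> a < m -> m < b ->
  (forall x, a <= x <= b -> {for x, continuous chi}) ->
  (forall x, a < x -> x < b ->
     (chi (x / (1 - e)) + chi (x * (1 - e)) - 2 * chi x) / e ^+ 2 @[e --> 0^'+] --> (0 : R)) ->
  chi m * (ln b - ln a) = chi a * (ln b - ln m) + chi b * (ln m - ln a).
Proof.
move=> a0 am mb chic chi2; apply/eqP; rewrite eq_le schwarz_log_concave//=.
have := @schwarz_log_concave R (fun x => - chi x) a b m a0 am mb.
rewrite !mulNr -opprD lerN2; apply.
  by move=> x /chic; exact: cvgN.
move=> x ax xb; rewrite -[X in _ --> X]oppr0.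
have -> : (fun e => (- chi (x / (1 - e)) + - chi (x * (1 - e)) - 2 * - chi x) / e ^+ 2) =
   (fun e => - ((chi (x / (1 - e)) + chi (x * (1 - e)) - 2 * chi x) / e ^+ 2)).
  by apply/funext => e; ring.
by apply: cvgN; exact: chi2.
Qed.

(** [chi] is affine in log x and has a finite limit at 0, where log x is unbounded; so its slope is
    0. In the proof, [f a] equals [chi x1 - chi x2] by affinity on [[a, x2]], while its denominator
    tends to infinity as [a] tends to 0. *)
Lemma schwarz_log_eq0 (R : realType) (chi : R -> R) :
  (forall x, 0 < x -> x < 1 -> {for x, continuous chi}) ->
  chi x @[x --> 0^'+] --> (0 : R) ->
  (forall x, 0 < x -> x < 1 ->
     (chi (x / (1 - e)) + chi (x * (1 - e)) - 2 * chi x) / e ^+ 2 @[e --> 0^'+] --> (0 : R)) ->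
  forall x, 0 < x -> x < 1 -> chi x = 0.
Proof.
move=> chic chi0 chi2.
have lnoo : ln x @[x --> (0 : R)^'+] --> -oo%R by exact: lnNy.
have chi_cst x1 x2 : 0 < x1 -> x1 < x2 -> x2 < 1 -> chi x1 = chi x2.
  move=> x10 x12 x21; have x20 := lt_trans x10 x12.
  pose f a := ((chi a - chi x2) * (ln x2 - ln x1)) / (ln x2 - ln a).
  have c1 : f a @[a --> 0^'+] --> (0 : R).
    rewrite -[X in _ --> X](mulr0 ((0 - chi x2) * (ln x2 - ln x1))).
    apply: cvgM.
      apply: cvgM; last exact: cvg_cst.
      by apply: cvgB => //; exact: cvg_cst.
    apply/(gtr0_cvgV0 (f := fun a => ln x2 - ln a)).
      by near=> a; rewrite subr_gt0 ltr_ln ?posrE.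
    apply/cvgryPge => M; near=> a.
    rewrite lerBrDl -lerBrDr.
    by near: a; move/cvgrNyPle : lnoo; apply.
  have c2 : f a @[a --> 0^'+] --> chi x1 - chi x2; last first.
    by apply/eqP; rewrite -subr_eq0; apply/eqP; apply: (cvg_unique _ c2 c1).
  apply: cvg_near_cst; near=> a.
  have a0 : 0 < a by [].
  have a1 : a < x1 by near: a; exact: nbhs_right_lt.
  have E : chi x1 * (ln x2 - ln a) =
      chi a * (ln x2 - ln x1) + chi x2 * (ln x1 - ln a).
    apply: schwarz_log_affine => // [x /andP[ax xx2]|x ax xx2].
    - by apply: chic; [exact: lt_le_trans ax|exact: le_lt_trans x21].
    - by apply: chi2; [exact: lt_trans ax|exact: lt_trans x21].
  have l0 : 0 < ln x2 - ln a by rewrite subr_gt0 ltr_ln// (lt_trans a1).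
  apply: (mulIf (lt0r_neq0 l0)); rewrite /f divfK ?gt_eqF//; lra.
move=> x x0 x1.
apply/esym; apply: (cvg_unique _ chi0) => //.
apply: cvg_near_cst; near=> t.
have tx : t < x by near: t; exact: nbhs_right_lt.
exact: chi_cst.
Unshelve. all: by end_near. Qed.

(** * Limits at 0 and second differences in log x *)

Lemma is_derive_cvg0 (R : realType) (f : R -> R) (l : R) :
  is_derive (0 : R) 1 f l -> (f t - f 0) / t @[t --> 0^'] --> l.
Proof.
move=> fl; have /cvg_ex[/= l' fl'] := @ex_derive _ _ _ _ _ _ _ fl.
have E : l' = l.
  rewrite -(is_derive_derive1 fl) /derive1.
  by apply/esym/cvg_lim => //; move: fl'; under eq_fun do rewrite scaler1.
move: fl'; rewrite E.
rewrite (_ : (fun h => _) = (fun t => (f t - f 0) / t))//.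
by apply/funext => t; rewrite scaler1 addr0 /GRing.scale/= mulrC.
Qed.

Lemma is_derive_ln1B (R : realType) (x : R) : x < 1 ->
  is_derive x 1 (fun x : R => ln (1 - x)) (- (1 - x)^-1).
Proof.
move=> x1; rewrite -mulrN1; apply: (@is_derive1_comp _ (@ln R) (fun x => 1 - x)).
  by apply: is_derive1_ln; rewrite subr_gt0.
by rewrite -[X in is_derive _ _ _ X]sub0r; apply: is_deriveB.
Qed.

Lemma cvg_ln1B_div (R : realType) : ln (1 - t) / t @[t --> (0 : R)^'] --> (-1 : R).
Proof.
have := is_derive_cvg0 (is_derive_ln1B (@ltr01 R)).
by rewrite subr0 ln1 invr1; under eq_fun do rewrite subr0.
Qed.

Lemma cvg_to_right0 (R : realType) (T : Type) (G : set_system T) {FG : Filter G}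
    (f : T -> R) :
  f @ G --> (0 : R) -> (\forall t \near G, 0 < f t) -> f @ G --> 0^'+.
Proof.
move=> /cvgrPdist_lt f0 fp P [d /= d0 dP].
have := f0 _ d0; apply: filterS2 fp => t tp ft /=.
by apply: dP => //=.
Qed.

Lemma cvg_to_left0 (R : realType) (T : Type) (G : set_system T) {FG : Filter G}
    (f : T -> R) :
  f @ G --> (0 : R) -> (\forall t \near G, f t < 0) -> f @ G --> 0^'-.
Proof.
move=> /cvgrPdist_lt f0 fp P [d /= d0 dP].
have := f0 _ d0; apply: filterS2 fp => t tp ft /=.
by apply: dP => //=.
Qed.

Lemma right0_dnbhs (R : realType) : (0 : R)^'+ `=>` 0^'.
Proof. by move=> P [d /= d0 dP]; exists d => //= t td t0; apply: dP => //; rewrite gt_eqF. Qed.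

Lemma left0_dnbhs (R : realType) : (0 : R)^'- `=>` 0^'.
Proof. by move=> P [d /= d0 dP]; exists d => //= t td t0; apply: dP => //; rewrite lt_eqF. Qed.

(** With q1 = x q', the numerator has derivative (q1(x/(1-e)) - q1(x(1-e)))/(1-e) in e. After one
    use of l'Hopital's rule there remains a symmetric difference quotient of q1, so
    differentiability of q1 at [x] alone suffices. *)
Lemma cvg_log_second_difference (R : realType) (q : R -> R) (x : R) :
  0 < x -> x < 1 -> (forall t, 0 < t -> t < 1 -> derivable q t 1) ->
  derivable (mulX_derive q) x 1 ->
  (q (x / (1 - e)) + q (x * (1 - e)) - 2 * q x) / e ^+ 2 @[e --> 0^'+] -->
    mulX_derive (mulX_derive q) x.
Proof.
move=> x0 x1 qd q1d.
set q1 := mulX_derive q in q1d *.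
have dq (t : R) : 0 < t -> t < 1 -> is_derive t 1 q (q^`()%classic t).
  by move=> t0 t1; apply: DeriveDef; [exact: qd|rewrite derive1E].
have dq1 : is_derive x 1 q1 (q1^`()%classic x).
  by apply: DeriveDef; [exact: q1d|rewrite derive1E].
have dV (e : R) : e < 1 -> is_derive e 1 (fun e : R => x / (1 - e)) (x * (1 - e) ^- 2).
  by move=> e1; apply: is_deriveZ; exact: (@is_derive_sk_lam R 1 e e1).
have dM (e : R) : is_derive e 1 (fun e : R => x * (1 - e)) (x * -1).
  by apply: is_deriveZ; rewrite -[X in is_derive _ _ _ X]sub0r; apply: is_deriveB.
pose th e := q (x / (1 - e)) + q (x * (1 - e)) - 2 * q x.
pose m e := q1 (x / (1 - e)) - q1 (x * (1 - e)).
pose dth e := m e / (1 - e).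
have dm : is_derive (0 : R) 1 m (2 * mulX_derive q1 x).
  have dq1a : is_derive (x / (1 - 0)) 1 q1 (q1^`()%classic x) by rewrite subr0 divr1.
  have dq1b : is_derive (x * (1 - 0)) 1 q1 (q1^`()%classic x) by rewrite subr0 mulr1.
  have A := @is_derive1_comp R q1 (fun e => x / (1 - e)) _ _ _ dq1a (dV 0 ltr01).
  have B := @is_derive1_comp R q1 (fun e => x * (1 - e)) _ _ _ dq1b (dM 0).
  apply: is_derive_eq (is_deriveB A B) _.
  by rewrite subr0 expr1n invr1 /mulX_derive; ring.
have m0 : m 0 = 0 by rewrite /m subr0 divr1 mulr1 subrr.
have mc : m e / e @[e --> 0^'+] --> 2 * mulX_derive q1 x.
  have := is_derive_cvg0 dm; rewrite m0.
  under eq_fun do rewrite subr0.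
  by move=> h; apply: cvg_trans h; apply: cvg_app; exact: right0_dnbhs.
have e0 : e @[e --> (0 : R)^'+] --> (0 : R).
  by apply: cvg_at_right_filter; exact: cvg_id.
have eVc : (1 - e)^-1 @[e --> (0 : R)^'+] --> (1 : R).
  rewrite -[X in _ --> X]invr1; apply: cvgV; rewrite ?oner_neq0//.
  by rewrite -[X in _ --> X]subr0; apply: cvgB => //; exact: cvg_cst.
have qx := is_derive_continuous (dq x x0 x1).
(* For e < 1 - x the point x/(1-e) is still below 1. *)
apply: (@lhopital_at_right R th dth (fun u => u ^+ 2) (fun u => 2 * u) 0 (1 - x)).
- by rewrite subr_gt0.
- move=> e; rewrite in_itv/= => /andP[e0' ex].
  have e1 : 0 < 1 - e by lra.
  have a0 : 0 < x / (1 - e) by rewrite divr_gt0.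
  have a1 : x / (1 - e) < 1 by rewrite ltr_pdivrMr// mul1r; lra.
  have b0 : 0 < x * (1 - e) by rewrite mulr_gt0.
  have b1 : x * (1 - e) < 1 by rewrite mulr_ilt1 ?ltW//; lra.
  have A := @is_derive1_comp R q (fun e => x / (1 - e)) _ _ _ (dq _ a0 a1) (dV e ltac:(lra)).
  have B := @is_derive1_comp R q (fun e => x * (1 - e)) _ _ _ (dq _ b0 b1) (dM e).
  apply: is_derive_eq (is_deriveB (is_deriveD A B) (is_derive_cst (2 * q x) e 1)) _.
  by rewrite /dth /m /q1 /mulX_derive; field; rewrite gt_eqF.
- by move=> u _; apply: is_derive_eq; rewrite /GRing.scale/=; ring.
- rewrite -[X in _ --> X](subrr (2 * q x)); apply: cvgB; last exact: cvg_cst.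
  rewrite [X in _ --> X](_ : 2 * q x = q x + q x); last by ring.
  apply: cvgD.
    apply: (cvg_continuous_comp qx).
    rewrite -[X in _ --> X]mulr1; apply: cvgM; [exact: cvg_cst|exact: eVc].
  apply: (cvg_continuous_comp qx).
  rewrite -[X in _ --> X]mulr1 -[X in _ * X]subr0; apply: cvgM; first exact: cvg_cst.
  by apply: cvgB; [exact: cvg_cst|exact: e0].
- by rewrite -[X in _ --> X](mulr0 0); under eq_fun do rewrite expr2; exact: (cvgM e0 e0).
- by move=> u; rewrite in_itv/= => /andP[u0' _]; rewrite mulf_neq0 ?gt_eqF.
have : 2^-1 * (m e / e) * (1 - e)^-1 @[e --> 0^'+] --> 2^-1 * (2 * mulX_derive q1 x) * 1.
  by apply: cvgM; [apply: cvgM; [exact: cvg_cst|exact: mc]|exact: eVc].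
rewrite mulr1 mulKf//; apply: cvg_trans; apply: near_eq_cvg; near=> e.
have h1 : e != 0 by rewrite gt_eqF.
have h2 : 1 - e != 0.
  rewrite subr_eq0 gt_eqF//; near: e; apply: nbhs_right_lt; exact: ltr01.
by rewrite /dth; field; rewrite ?h1 ?h2.
Unshelve. all: by end_near. Qed.

(** * Identification of the solution *)

Section second_order.
Variables (R : realType) (z : R) (F : R -> R).
Hypothesis FE : spence_kummer z F.
Hypothesis mF : lebesgue_measurable_fun `]-oo, 1[ F.
Hypothesis F0d : derivable F 0 1.

Let F' : R -> R := F^`()%classic.
Let alpha : R := F' 0.
Let beta : R := (alpha - 2^-1) / 2.

Let dF (t : R) : t < 1 -> is_derive t 1 F (F' t).
Proof.
move=> t1; apply: DeriveDef; last by rewrite /F' derive1E.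
have h := spence_kummer_derivable_lt1 FE mF F0d t1.
exact: h.
Qed.

Let H (t : R) : R := F t - F 0 - alpha * t.

Let dH (t : R) : t < 1 -> is_derive t 1 H (F' t - alpha).
Proof.
move=> t1; have dFt := dF t1.
have dz : is_derive t 1 (fun t => alpha * t) (alpha * 1) by exact: is_deriveZ.
have := is_deriveB (is_deriveB dFt (is_derive_cst (F 0) t 1)) dz.
by rewrite subr0 mulr1.
Qed.

Let H0 : H 0 = 0. Proof. by rewrite /H mulr0 subr0 subrr. Qed.

Let H_div : H t / t @[t --> 0^'] --> (0 : R).
Proof.
have := is_derive_cvg0 (dH ltr01).
by rewrite H0 -/alpha subrr; under eq_fun do rewrite subr0.
Qed.

Let vee (u : R) := u / (u - 1).

(** [vee] is an involution exchanging the two sides of 0, so the first-order relation at [vee v]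
    expresses F'(v) by F'(vee v) and transports the limit from the right. *)
Lemma spence_kummer_derive_cvg_left : F' v @[v --> 0^'-] --> alpha.
Proof.
have v0 : v @[v --> (0 : R)^'-] --> (0 : R).
  by apply: cvg_at_left_filter; exact: cvg_id.
have veec : vee v @[v --> 0^'-] --> (0 : R).
  rewrite -[X in _ --> X](mul0r (0 - 1)^-1); apply: cvgM => //; apply: cvgV.
    by rewrite sub0r oppr_eq0 oner_eq0.
  by apply: cvgB => //; exact: cvg_cst.
have uc : vee v @[v --> 0^'-] --> 0^'+.
  apply: cvg_to_right0 => //; near=> v.
  have v0' : v < 0 by [].
  by rewrite /vee -mulrNN -invrN divr_gt0//; lra.
have F'u : F' (vee v) @[v --> 0^'-] --> alpha.
  exact: cvg_comp uc (spence_kummer_derive_cvg_right FE mF F0d).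
have lnc : ln (1 - v) @[v --> (0 : R)^'-] --> (0 : R).
  apply: cvg_at_left_filter.
  have := is_derive_continuous (is_derive_ln1B (@ltr01 R)).
  by rewrite /prop_for /continuous_at subr0 ln1.
have lnd : ln (1 - v) / v @[v --> (0 : R)^'-] --> (-1 : R).
  by apply: cvg_trans (@cvg_ln1B_div R); apply: cvg_app; exact: left0_dnbhs.
have : F' (vee v) / (1 - v) - 2^-1 * (ln (1 - v) / v) * ln (1 - v) @[v --> 0^'-] -->
    alpha / (1 - 0) - 2^-1 * (-1) * 0.
  apply: cvgB.
    apply: cvgM => //; apply: cvgV; first by rewrite subr0 oner_eq0.
    by apply: cvgB => //; exact: cvg_cst.
  by apply: cvgM => //; apply: cvgM => //; exact: cvg_cst.
rewrite subr0 divr1 mulr0 subr0; apply: cvg_trans; apply: near_eq_cvg; near=> v.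
have v0' : v < 0 by [].
have vN0 : v != 0 by rewrite lt_eqF.
have v1N0 : v - 1 != 0 by rewrite lt_eqF//; lra.
have v1N0' : 1 - v != 0 by rewrite gt_eqF//; lra.
have u0 : 0 < vee v by rewrite /vee -mulrNN -invrN divr_gt0//; lra.
have uE : 1 - vee v = (1 - v)^-1 by rewrite /vee; field; rewrite ?v1N0 ?v1N0'.
have u1 : vee v < 1 by rewrite -subr_gt0 uE invr_gt0; lra.
have := spence_kummer_landen FE mF F0d u0 u1.
have -> : vee v / (vee v - 1) = v.
  by rewrite -[vee v - 1]opprB uE invrN invrK /vee; field.
rewrite uE lnV ?posrE; last by lra.
rewrite sqrrN => E.
have -> : F' v = v^-1 * (v * F' v) by rewrite mulKf.
have -> : v * F' v = - 2^-1 * ln (1 - v) ^+ 2 - vee v * F' (vee v).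
  by rewrite -E /F'; ring.
by rewrite /vee; field; rewrite ?vN0 ?v1N0 ?v1N0'.
Unshelve. all: by end_near. Qed.

(** The derivative of [H] tends to 0 on the left of 0. Hence an error O(e^2) in a negative argument
    changes [H] only by o(e^2). *)
Let H_lip (eta : R) : 0 < eta -> exists2 d : R, 0 < d &
  forall s t, - d < s < 0 -> - d < t < 0 -> `|H s - H t| <= eta * `|s - t|.
Proof.
move=> eta0.
have /cvgrPdist_le/(_ _ eta0)[d /= d0 Hd] := spence_kummer_derive_cvg_left.
exists d => // s t; wlog st : s t / s <= t => [W|] sJ tJ.
  have [st|/ltW ts] := leP s t; first exact: W.
  by rewrite distrC [X in eta * X]distrC; exact: W.
have [||c cst E] := @MVT_segment R H (fun t => F' t - alpha) s t st.
- move=> x; rewrite in_itv/= => /andP[_ xt]; apply: dH.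
  by case/andP: tJ => _ t0; rewrite (lt_trans xt)// (lt_trans t0).
- apply: within_itv_continuous => x /andP[_ xt].
  apply: is_derive_continuous; apply: dH.
  by case/andP: tJ => _ t0; rewrite (le_lt_trans xt)// (lt_trans t0).
rewrite distrC E normrM [X in _ <= _ * X]distrC ler_wpM2r// distrC.
move: cst; rewrite in_itv/= => /andP[sc ct].
case/andP: sJ => ds _; case/andP: tJ => _ t0.
apply: Hd; last by rewrite (le_lt_trans ct).
have c0 : c < 0 by exact: le_lt_trans t0.
by rewrite /= sub0r normrN ltr0_norm//; lra.
Qed.

(** The factor 1 - u makes the first-order relation applicable: as (1-u) vee'(u) = vee(u)/u, the
    terms of N' containing H' add up to (u H'(u) + vee(u) H'(vee u))/u. *)
Let N (u : R) : R := H u + (1 - u) * H (vee u).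

(** l'Hopital's rule: N'(u)/(2u) tends to (alpha - 1/2)/2, the 1/2 coming from log(1-u)^2/(2 u^2),
    while H(vee u)/u tends to 0. For the trilogarithm, with alpha = 1, the value of [beta] is
    1/4. *)
Let N_div : N u / u ^+ 2 @[u --> 0^'+] --> beta.
Proof.
pose dN u := alpha * u / (1 - u) - 2^-1 * ln (1 - u) ^+ 2 / u - H (vee u).
have u0 : u @[u --> (0 : R)^'+] --> (0 : R).
  by apply: cvg_at_right_filter; exact: cvg_id.
have u1c : (1 - u)^-1 @[u --> (0 : R)^'+] --> (1 : R).
  rewrite -[X in _ --> X]invr1; apply: cvgV; first exact: oner_neq0.
  by rewrite -[X in _ --> X]subr0; apply: cvgB => //; exact: cvg_cst.
have veec : vee v @[v --> 0^'+] --> (0 : R).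
  rewrite -[X in _ --> X](mul0r (0 - 1)^-1); apply: cvgM => //; apply: cvgV.
    by rewrite sub0r oppr_eq0 oner_eq0.
  by apply: cvgB => //; exact: cvg_cst.
have nu : \forall u \near (0 : R)^'+, [/\ 0 < u, u < 1 & vee u < 0].
  near=> u; have u0' : 0 < u by [].
  have u1 : u < 1 by near: u; exact: nbhs_right_lt.
  by split => //; rewrite /vee pmulr_rlt0// invr_lt0; lra.
have veel : vee v @[v --> 0^'+] --> 0^'-.
  by apply: cvg_to_left0 => //; apply: filterS nu => u [].
have lnd : ln (1 - v) / v @[v --> (0 : R)^'+] --> (-1 : R).
  by apply: cvg_trans (@cvg_ln1B_div R); apply: cvg_app; exact: right0_dnbhs.
have Hv : H (vee u) / vee u @[u --> 0^'+] --> (0 : R).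
  apply: (cvg_comp _ (fun v => H v / v) veel).
  by apply: cvg_trans H_div; apply: cvg_app; exact: left0_dnbhs.
apply: (@lhopital_at_right R N dN (fun u => u ^+ 2) (fun u => 2 * u) 0 1).
- exact: ltr01.
- move=> u; rewrite in_itv/= => /andP[u0' u1].
  have uN0 : u != 0 by rewrite gt_eqF.
  have u1N0 : 1 - u != 0 by rewrite gt_eqF// subr_gt0.
  have u1N0' : u - 1 != 0 by rewrite lt_eqF// subr_lt0.
  have v1 : vee u < 1 by rewrite (@lt_trans _ _ 0)// /vee pmulr_rlt0// invr_lt0; lra.
  have dv : is_derive u 1 vee (- (1 - u) ^- 2).
    rewrite (_ : vee = (fun x => - (x / (1 - x)))).
      exact: (@is_derive_sk_lam R 4 u u1).
    by apply/funext => x; rewrite /vee -opprB invrN mulrN.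
  have d1 := @is_derive1_comp R H vee _ _ _ (dH v1) dv.
  have d2 : is_derive u 1 (fun x : R => 1 - x) (0 - 1) by apply: is_deriveB.
  have d3 := is_deriveD (dH u1) (is_deriveM d2 d1).
  apply: is_derive_eq d3 _.
  rewrite /dN /GRing.scale/=.
  have := spence_kummer_landen FE mF F0d u0' u1; rewrite -/F' -/(vee u) => E.
  have -> : 2^-1 * ln (1 - u) ^+ 2 = - (u * F' u + vee u * F' (vee u)).
    by rewrite E mulNr opprK.
  set w := F' (vee u); set hv := H (vee u); rewrite (_ : vee u = u / (u - 1))//.
  by field; rewrite ?uN0 ?u1N0 ?u1N0'.
- by move=> u _; apply: is_derive_eq; rewrite /GRing.scale/=; ring.
- rewrite -[X in _ --> X](addr0 0) /N; apply: cvgD.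
    rewrite -[X in _ --> X]H0; apply: cvg_at_right_filter.
    exact: is_derive_continuous (dH ltr01).
  rewrite -[X in _ --> X](mulr0 (1 - 0)); apply: cvgM.
    by apply: cvgB => //; exact: cvg_cst.
  rewrite -[X in _ --> X]H0; apply: cvg_continuous_comp veec.
  exact: is_derive_continuous (dH ltr01).
- rewrite -[X in _ --> X](mulr0 0); under eq_fun do rewrite expr2.
  exact: cvgM.
- by move=> u; rewrite in_itv/= => /andP[u0' _]; rewrite mulf_neq0 ?gt_eqF.
have : 2^-1 * (alpha * (1 - u)^-1 - 2^-1 * (ln (1 - u) / u) ^+ 2 -
     H (vee u) / vee u * - (1 - u)^-1) @[u --> 0^'+] -->
     2^-1 * (alpha * 1 - 2^-1 * (-1) ^+ 2 - 0 * - 1).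
  have c1 : alpha * (1 - u)^-1 @[u --> 0^'+] --> alpha * 1.
    by apply: cvgM; [exact: cvg_cst|exact: u1c].
  have c2 : (ln (1 - u) / u) ^+ 2 @[u --> 0^'+] --> (-1 : R) ^+ 2.
    by under eq_fun do rewrite expr2; exact: (cvgM lnd lnd).
  have c3 : 2^-1 * (ln (1 - u) / u) ^+ 2 @[u --> 0^'+] --> 2^-1 * (-1 : R) ^+ 2.
    by apply: cvgM; [exact: cvg_cst|exact: c2].
  have c4 : H (vee u) / vee u * - (1 - u)^-1 @[u --> 0^'+] --> (0 : R) * - 1.
    by apply: cvgM; [exact: Hv|exact: cvgN u1c].
  apply: cvgM; first exact: cvg_cst.
  by apply: cvgB; [apply: cvgB; [exact: c1|exact: c3]|exact: c4].
have -> : 2^-1 * (alpha * 1 - 2^-1 * (-1) ^+ 2 - 0 * - 1) = beta.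
  by rewrite /beta; field.
apply: cvg_trans; apply: near_eq_cvg; apply: filterS nu => u [u0' u1 v0].
have uN0 : u != 0 by rewrite gt_eqF.
have u1N0 : 1 - u != 0 by rewrite gt_eqF// subr_gt0.
have vN0 : vee u != 0 by rewrite lt_eqF.
have -> : - (1 - u)^-1 = vee u / u.
  by rewrite /vee; field; rewrite ?uN0 ?u1N0//= -oppr_eq0 opprB u1N0.
by rewrite /dN; field; rewrite ?uN0 ?u1N0 ?vN0.
Unshelve. all: by end_near. Qed.

(** H(s1) + H(vee s1) = N(s1) + s1 H(vee s1), where [N_div] gives the first term to second order and
    the second is o(e^2). Replacing [vee (s1 e)] by [s2 e] costs o(e^2) by [H_lip]. *)
Let H_pair (s1 s2 : R -> R) (kappa nu : R) : 0 < kappa ->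
  s1 e / e @[e --> 0^'+] --> kappa ->
  (s2 e - vee (s1 e)) / e ^+ 2 @[e --> 0^'+] --> nu ->
  (H (s1 e) + H (s2 e)) / e ^+ 2 @[e --> 0^'+] --> beta * kappa ^+ 2.
Proof.
move=> k0 s1k s2n.
have e0 : e @[e --> (0 : R)^'+] --> (0 : R).
  by apply: cvg_at_right_filter; exact: cvg_id.
have s1c : s1 e @[e --> 0^'+] --> (0 : R).
  rewrite -[X in _ --> X](mulr0 kappa).
  have : s1 e / e * e @[e --> 0^'+] --> kappa * 0 by exact: cvgM.
  apply: cvg_trans; apply: near_eq_cvg; near=> e.
  by rewrite divfK// gt_eqF.
have s1p : \forall e \near 0^'+, 0 < s1 e.
  near=> e; have h : 0 < s1 e / e by near: e; apply: cvgr_gt s1k _ k0.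
  have e0' : 0 < e by [].
  by move: h; rewrite pmulr_lgt0// invr_gt0.
have s1r : s1 e @[e --> 0^'+] --> 0^'+ by exact: cvg_to_right0.
have v1c : (s1 e - 1)^-1 @[e --> 0^'+] --> (-1 : R).
  rewrite [X in _ --> X](_ : -1 = (0 - 1)^-1); last by rewrite sub0r invrN invr1.
  apply: cvgV; first by rewrite sub0r oppr_eq0 oner_eq0.
  by apply: cvgB => //; exact: cvg_cst.
have vk : vee (s1 e) / e @[e --> 0^'+] --> - kappa.
  have : s1 e / e * (s1 e - 1)^-1 @[e --> 0^'+] --> kappa * -1 by exact: cvgM.
  by rewrite mulrN1; under eq_fun do rewrite mulrAC.
have s2k : s2 e / e @[e --> 0^'+] --> - kappa.
  have : (s2 e - vee (s1 e)) / e ^+ 2 * e + vee (s1 e) / e @[e --> 0^'+] -->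
      nu * 0 + - kappa.
    by apply: cvgD => //; exact: cvgM.
  rewrite mulr0 add0r; apply: cvg_trans; apply: near_eq_cvg; near=> e.
  by field; rewrite gt_eqF.
have left_of (s : R -> R) : s e / e @[e --> 0^'+] --> - kappa -> s e @[e --> 0^'+] --> 0^'-.
  move=> sk; apply: cvg_to_left0.
    rewrite -[X in _ --> X](mulr0 (- kappa)).
    have : s e / e * e @[e --> 0^'+] --> - kappa * 0 by exact: cvgM.
    apply: cvg_trans; apply: near_eq_cvg; near=> e.
    by rewrite divfK// gt_eqF.
  near=> e; have h : s e / e < 0.
    by near: e; apply: cvgr_lt sk _ _; rewrite oppr_lt0.
  have e0' : 0 < e by [].
  by move: h; rewrite pmulr_llt0// invr_gt0.
have vl := left_of _ vk; have s2l := left_of _ s2k.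
have T1 : N (s1 e) / s1 e ^+ 2 * (s1 e / e) ^+ 2 @[e --> 0^'+] --> beta * kappa ^+ 2.
  apply: cvgM; first exact: (cvg_comp _ (fun u => N u / u ^+ 2) s1r N_div).
  by under eq_fun do rewrite expr2; exact: cvgM.
have T2 : (s1 e / e) * (vee (s1 e) / e) * (H (vee (s1 e)) / vee (s1 e)) @[e --> 0^'+] -->
    kappa * (- kappa) * 0.
  apply: cvgM; first exact: cvgM.
  apply: (cvg_comp _ (fun v => H v / v) vl).
  by apply: cvg_trans H_div; apply: cvg_app; exact: left0_dnbhs.
have T3 : (H (s2 e) - H (vee (s1 e))) / e ^+ 2 @[e --> 0^'+] --> (0 : R).
  apply/cvgrPdist_le => eta eta0.
  pose eta' := eta / (`|nu| + 1).
  have nu0 : 0 < `|nu| + 1 by rewrite ltr_wpDl.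
  have eta'0 : 0 < eta' by rewrite divr_gt0.
  have [d d0 Hl] := H_lip eta'0.
  have inJ (s : R -> R) : s e @[e --> 0^'+] --> 0^'- ->
      \forall e \near 0^'+, - d < s e < 0.
    move=> sl.
    have J : nbhs (0 : R)^'- [set t | - d < t < 0].
      near=> t => /=; have t0 : t < 0 by [].
      by rewrite t0 andbT; near: t; apply: nbhs_left_gt; rewrite oppr_lt0.
    exact: (sl _ J).
  near=> e.
  have e0' : 0 < e by [].
  have J1 : - d < vee (s1 e) < 0 by near: e; exact: inJ.
  have J2 : - d < s2 e < 0 by near: e; exact: inJ.
  have nue : `|(s2 e - vee (s1 e)) / e ^+ 2| <= `|nu| + 1.
    near: e; apply: cvgr_le (cvg_norm s2n) _ _; first by rewrite ltrDl.
  rewrite sub0r normrN normrM normfV.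
  apply: (@le_trans _ _ (eta' * `|s2 e - vee (s1 e)| / `|e ^+ 2|)).
    by rewrite ler_wpM2r ?invr_ge0// Hl.
  rewrite -mulrA -normfV -normrM (le_trans (ler_wpM2l (ltW eta'0) nue))//.
  by rewrite /eta' divfK// gt_eqF.
have : N (s1 e) / s1 e ^+ 2 * (s1 e / e) ^+ 2 +
    s1 e / e * (vee (s1 e) / e) * (H (vee (s1 e)) / vee (s1 e)) +
    (H (s2 e) - H (vee (s1 e))) / e ^+ 2 @[e --> 0^'+] -->
    beta * kappa ^+ 2 + kappa * (- kappa) * 0 + 0.
  by apply: cvgD => //; exact: cvgD.
rewrite mulr0 !addr0.
apply: cvg_trans; apply: near_eq_cvg; near=> e.
have eN0 : e != 0 by rewrite gt_eqF.
have sN0 : s1 e != 0 by rewrite gt_eqF//; near: e.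
have vN0 : vee (s1 e) != 0.
  rewrite lt_eqF//; near: e.
  have J : nbhs (0 : R)^'- [set t | t < 0] by exists 1 => //=.
  exact: (vl _ J).
have s1N : s1 e != 1.
  rewrite lt_eqF//; near: e; apply: cvgr_lt s1c _ _; exact: ltr01.
by rewrite /N; field; rewrite eN0 sN0 vN0.
Unshelve. all: by end_near. Qed.

(** The equation at y = 1 - e: besides the second difference of [F] at [x], these are the terms that
    involve [x]; the others depend on [e] only. *)
Let V (x e : R) : R :=
  2 * (F (sk_lam 1 x * e) + F (sk_lam 2 x * (e / (1 - e))) +
       F (sk_lam 4 x * e) + F (sk_lam 5 x * (e / (1 - e))))
  - F (sk_lam 6 x * (e ^+ 2 / (1 - e))) - ln (1 - x) * ln (1 - e) ^+ 2.

Let VE (x e : R) : 0 < x -> 0 < e -> e < 1 - x ->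
  F (x / (1 - e)) + F (x * (1 - e)) - 2 * F x =
  2 * F (1 - e) - sk_rhs z (1 - e) + V x e.
Proof.
move=> x0 e0 ex; have xe : x < 1 - e by lra.
have e1 : 1 - e < 1 by lra.
have := spence_kummerE FE x0 xe e1.
rewrite !big_ord_recl big_ord0 /= subKr /V /= => E; lra.
Qed.

(** The four arguments of order e add up to -e^2/(1-e), so order e cancels and their linear parts
    leave [- alpha]. The [beta] terms come from the two pairs, and the next term from index 6, whose
    argument is of order e^2. The 7 in the limit below is 2 * 4 - 1, the number of values F(0) in
    [V]. *)
Let W (x : R) : R :=
  2 * (- alpha + beta * (1 - x)^-1 ^+ 2 + beta * (x / (1 - x)) ^+ 2)
  - alpha * (x / (1 - x) ^+ 2) - ln (1 - x).

Let V_cvg (x : R) : 0 < x -> x < 1 ->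
  (V x e - 7 * F 0) / e ^+ 2 @[e --> 0^'+] --> W x.
Proof.
move=> x0 x1.
have xN1 : 1 - x != 0 by rewrite gt_eqF// subr_gt0.
have k1 : 0 < (1 - x)^-1 by rewrite invr_gt0 subr_gt0.
have k2 : 0 < x / (1 - x) by rewrite mulr_gt0.
have e0 : e @[e --> (0 : R)^'+] --> (0 : R).
  by apply: cvg_at_right_filter; exact: cvg_id.
have e1c (k : R) : k - e @[e --> (0 : R)^'+] --> k.
  by rewrite -[X in _ --> X]subr0; apply: cvgB => //; exact: cvg_cst.
have eVc : (1 - e)^-1 @[e --> (0 : R)^'+] --> (1 : R).
  by rewrite -[X in _ --> X]invr1; apply: cvgV; rewrite ?oner_neq0.
have ne : \forall e \near (0 : R)^'+, [/\ 0 < e, e < 1 & e < 1 - x].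
  near=> e.
  have ex : e < 1 - x by near: e; apply: nbhs_right_lt; rewrite subr_gt0.
  by split => //; lra.
have eXVc : (1 - x - e)^-1 @[e --> (0 : R)^'+] --> (1 - x)^-1 by exact: cvgV.
(* The indices 1 and 5 form a pair, and so do 2 and 4; the positive argument plays the role of [s1],
   and [nu] is the limit of (s2 - vee(s1))/e^2. *)
have P1 : (H (sk_lam 1 x * e) + H (sk_lam 5 x * (e / (1 - e)))) / e ^+ 2
    @[e --> 0^'+] --> beta * (1 - x)^-1 ^+ 2.
  apply: (H_pair (s1 := fun e => sk_lam 1 x * e)
    (s2 := fun e => sk_lam 5 x * (e / (1 - e)))
    (nu := x * (1 - x)^-1 * (1 - x)^-1 * 1)) => //.
    apply: cvg_near_cst; apply: filterS ne => e [e0' _ _] /=.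
    by rewrite mulfK// gt_eqF.
  have : x * (1 - x)^-1 * (1 - x - e)^-1 * (1 - e)^-1 @[e --> 0^'+] -->
      x * (1 - x)^-1 * (1 - x)^-1 * 1.
    by apply: cvgM => //; apply: cvgM => //; exact: cvg_cst.
  apply: cvg_trans; apply: near_eq_cvg; apply: filterS ne => e [e0' e1 ex].
  have h1 : e != 0 by rewrite gt_eqF.
  have h2 : 1 - e != 0 by rewrite gt_eqF// subr_gt0.
  have h3 : 1 - x - e != 0 by rewrite gt_eqF//; lra.
  have E1 : (1 - x)^-1 * e - 1 = - ((1 - x - e) / (1 - x)) by field.
  by rewrite /vee /= E1; field; rewrite ?h1 ?h2 ?h3 ?xN1.
have P2 : (H (sk_lam 2 x * (e / (1 - e))) + H (sk_lam 4 x * e)) / e ^+ 2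
    @[e --> 0^'+] --> beta * (x / (1 - x)) ^+ 2.
  apply: (H_pair (s1 := fun e => sk_lam 2 x * (e / (1 - e)))
    (s2 := fun e => sk_lam 4 x * e)
    (nu := x * (1 - x)^-1 * (1 - x)^-1)) => //.
    have : x / (1 - x) * (1 - e)^-1 @[e --> 0^'+] --> x / (1 - x) * 1.
      by apply: cvgM => //; exact: cvg_cst.
    rewrite mulr1; apply: cvg_trans; apply: near_eq_cvg.
    apply: filterS ne => e [e0' e1 ex] /=.
    have h1 : e != 0 by rewrite gt_eqF.
    have h2 : 1 - e != 0 by rewrite gt_eqF// subr_gt0.
    by field; rewrite ?h1 ?h2 ?xN1.
  have : x * (1 - x)^-1 * (1 - x - e)^-1 @[e --> 0^'+] -->
      x * (1 - x)^-1 * (1 - x)^-1.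
    by apply: cvgM => //; exact: cvg_cst.
  apply: cvg_trans; apply: near_eq_cvg; apply: filterS ne => e [e0' e1 ex].
  have h1 : e != 0 by rewrite gt_eqF.
  have h2 : 1 - e != 0 by rewrite gt_eqF// subr_gt0.
  have h3 : 1 - x - e != 0 by rewrite gt_eqF//; lra.
  have E1 : x / (1 - x) * (e / (1 - e)) - 1 =
      - ((1 - x - e) / ((1 - x) * (1 - e))) by field; rewrite ?h2 ?xN1.
  by rewrite /vee /= E1; field; rewrite ?h1 ?h2 ?h3 ?xN1.
have ec : sk_lam 6 x * (e ^+ 2 / (1 - e)) / e ^+ 2 @[e --> 0^'+] --> x / (1 - x) ^+ 2.
  have : x / (1 - x) ^+ 2 * (1 - e)^-1 @[e --> 0^'+] --> x / (1 - x) ^+ 2 * 1.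
    by apply: cvgM => //; exact: cvg_cst.
  rewrite mulr1; apply: cvg_trans; apply: near_eq_cvg.
  apply: filterS ne => e [e0' e1 ex] /=.
  have h1 : e != 0 by rewrite gt_eqF.
  have h2 : 1 - e != 0 by rewrite gt_eqF// subr_gt0.
  by field; rewrite ?h1 ?h2 ?xN1.
have He : H (sk_lam 6 x * (e ^+ 2 / (1 - e))) / e ^+ 2 @[e --> 0^'+] --> (0 : R).
  have sr : sk_lam 6 x * (e ^+ 2 / (1 - e)) @[e --> 0^'+] --> 0^'+.
    apply: cvg_to_right0.
      have : sk_lam 6 x * (e * e * (1 - e)^-1) @[e --> 0^'+] --> sk_lam 6 x * (0 * 0 * 1).
        by apply: cvgM; [exact: cvg_cst|apply: cvgM => //; exact: cvgM].
      by rewrite !mul0r mulr0; under eq_fun do rewrite -expr2.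
    apply: filterS ne => e [e0' e1 ex].
    by rewrite !mulr_gt0 ?invr_gt0 ?exprn_gt0 ?subr_gt0.
  have Hr : H (sk_lam 6 x * (e ^+ 2 / (1 - e))) / (sk_lam 6 x * (e ^+ 2 / (1 - e)))
      @[e --> 0^'+] --> (0 : R).
    apply: (cvg_comp _ (fun v => H v / v) sr).
    by apply: cvg_trans H_div; apply: cvg_app; exact: right0_dnbhs.
  have : H (sk_lam 6 x * (e ^+ 2 / (1 - e))) / (sk_lam 6 x * (e ^+ 2 / (1 - e))) *
      (sk_lam 6 x * (e ^+ 2 / (1 - e)) / e ^+ 2) @[e --> 0^'+] -->
      0 * (x / (1 - x) ^+ 2) by exact: (cvgM Hr ec).
  rewrite mul0r; apply: cvg_trans; apply: near_eq_cvg.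
  apply: filterS ne => e [e0' e1 ex].
  have h1 : sk_lam 6 x * (e ^+ 2 / (1 - e)) != 0.
    by rewrite gt_eqF// !mulr_gt0 ?invr_gt0 ?exprn_gt0 ?subr_gt0.
  by rewrite mulrA divfK.
have lnd : (ln (1 - v) / v) ^+ 2 @[v --> (0 : R)^'+] --> (1 : R).
  rewrite -[X in _ --> X](mulr1 1) -[X in _ --> X](mulrNN 1 1).
  have l1 : ln (1 - v) / v @[v --> (0 : R)^'+] --> (-1 : R).
    by apply: cvg_trans (@cvg_ln1B_div R); apply: cvg_app; exact: right0_dnbhs.
  by under eq_fun do rewrite expr2; exact: cvgM.
have : 2 * (- alpha * (1 - e)^-1 +
      (H (sk_lam 1 x * e) + H (sk_lam 5 x * (e / (1 - e)))) / e ^+ 2 +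
      (H (sk_lam 2 x * (e / (1 - e))) + H (sk_lam 4 x * e)) / e ^+ 2) -
   alpha * (sk_lam 6 x * (e ^+ 2 / (1 - e)) / e ^+ 2) -
   H (sk_lam 6 x * (e ^+ 2 / (1 - e))) / e ^+ 2 - ln (1 - x) * (ln (1 - e) / e) ^+ 2
   @[e --> 0^'+] -->
   2 * (- alpha * 1 + beta * (1 - x)^-1 ^+ 2 + beta * (x / (1 - x)) ^+ 2)
     - alpha * (x / (1 - x) ^+ 2) - 0 - ln (1 - x) * 1.
  apply: cvgB; first apply: cvgB; first apply: cvgB.
  - apply: cvgM; first exact: cvg_cst.
    apply: cvgD; last exact: P2.
    apply: cvgD; last exact: P1.
    by apply: cvgM; [exact: cvg_cst|exact: eVc].
  - by apply: cvgM; [exact: cvg_cst|exact: ec].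
  - exact: He.
  - by apply: cvgM; [exact: cvg_cst|exact: lnd].
rewrite subr0 !mulr1; apply: cvg_trans; apply: near_eq_cvg.
apply: filterS ne => e [e0' e1 ex].
have h1 : e != 0 by rewrite gt_eqF.
have h2 : 1 - e != 0 by rewrite gt_eqF// subr_gt0.
by rewrite /V /H /=; field; rewrite ?h1 ?h2 ?xN1.
Unshelve. all: by end_near. Qed.

(** * Comparison with the trilogarithm *)

Variable L : R -> R.
Hypothesis hL : is_trilogarithm L.
Hypothesis zL : z = L 1.

(** Under (x d/dx)^2 the function -log(1-x) becomes x/(1-x)^2, the shape in which [alpha] enters
    [W]; the correction thus absorbs the deviation of [alpha] from 1. *)
Let Q (x : R) : R := L x - (alpha - 1) * ln (1 - x).

Let dL (x : R) : x < 1 -> is_derive x 1 L (L^`()%classic x).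
Proof.
move=> x1; have [h _] := trilogarithm_derivable hL x1.
by apply: DeriveDef; [exact: h|rewrite derive1E].
Qed.

Let Q_cvg (x : R) : 0 < x -> x < 1 ->
  (Q (x / (1 - e)) + Q (x * (1 - e)) - 2 * Q x) / e ^+ 2 @[e --> 0^'+] -->
    - ln (1 - x) + (alpha - 1) * (x / (1 - x) ^+ 2).
Proof.
move=> x0 x1.
have cL : (L (x / (1 - e)) + L (x * (1 - e)) - 2 * L x) / e ^+ 2 @[e --> 0^'+] -->
    - ln (1 - x).
  rewrite -(trilogarithm_ode hL x1); apply: (cvg_log_second_difference x0 x1).
    by move=> t _ t1; case: (trilogarithm_derivable hL t1).
  by case: (trilogarithm_derivable hL x1) => _ h; exact: h.
pose l (t : R) := ln (1 - t).
have l1 (t : R) : t < 1 -> mulX_derive l t = - (t / (1 - t)).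
  by move=> t1; rewrite /mulX_derive (is_derive_derive1 (is_derive_ln1B t1)) mulrN.
have dl1 : is_derive x 1 (mulX_derive l) (- (1 - x) ^- 2).
  have := @is_derive_sk_lam R 4 x x1; apply: near_eq_is_derive.
  near=> t; rewrite l1//.
  by near: t; exact: lt_nbhsl.
have cl : (l (x / (1 - e)) + l (x * (1 - e)) - 2 * l x) / e ^+ 2 @[e --> 0^'+] -->
    - (x / (1 - x) ^+ 2).
  have -> : - (x / (1 - x) ^+ 2) = mulX_derive (mulX_derive l) x.
    by rewrite [RHS]/mulX_derive (is_derive_derive1 dl1) mulrN.
  apply: (cvg_log_second_difference x0 x1).
    by move=> t _ t1; case: (is_derive_ln1B t1) => d _; exact: d.
  by case: dl1 => d _; exact: d.
have : (L (x / (1 - e)) + L (x * (1 - e)) - 2 * L x) / e ^+ 2 -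
   (alpha - 1) * ((l (x / (1 - e)) + l (x * (1 - e)) - 2 * l x) / e ^+ 2) @[e --> 0^'+] -->
   - ln (1 - x) - (alpha - 1) * - (x / (1 - x) ^+ 2).
  by apply: cvgB; [exact: cL|apply: cvgM; [exact: cvg_cst|exact: cl]].
rewrite mulrN opprK; apply: cvg_trans; apply: near_eq_cvg; near=> e.
by rewrite /Q /l; ring.
Unshelve. all: by end_near. Qed.

(** Because (1+x^2)/(1-x)^2 = 1 + 2x/(1-x)^2 and 4 beta - alpha = alpha - 1. The value of [beta] is
    what makes the difference independent of [x]. *)
Let WQ (x : R) : x < 1 ->
  W x - (- ln (1 - x) + (alpha - 1) * (x / (1 - x) ^+ 2)) = 2 * (beta - alpha).
Proof.
move=> x1; have xN1 : 1 - x != 0 by rewrite gt_eqF// subr_gt0.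
by rewrite /W /beta; field.
Qed.

Let psi (x : R) : R := F x - Q x.

Let cpsi (x : R) : x < 1 -> {for x, continuous psi}.
Proof.
move=> x1; apply: cvgB; first exact: is_derive_continuous (dF x1).
apply: cvgB; first exact: is_derive_continuous (dL x1).
by apply: cvgM; [exact: cvg_cst|exact: is_derive_continuous (is_derive_ln1B x1)].
Qed.

Let psi0 : psi 0 = F 0.
Proof. by rewrite /psi /Q (trilogarithm0 hL) subr0 ln1 mulr0 !subr0. Qed.

Let psi_cst (h x : R) : 0 < h -> h < 1 -> 0 < x -> x < 1 -> psi (h * x) = psi x.
Proof.
move=> h0 h1 x0 x1; apply/eqP; rewrite -subr_eq0; apply/eqP; move: x x0 x1.
apply: schwarz_log_eq0.
- move=> x x0 x1; apply: cvgB; last exact: cpsi.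
  apply: (cvg_continuous_comp (f := psi) (g := fun x => h * x)).
    by apply: cpsi; rewrite mulr_ilt1// ltW.
  by apply: cvgM; [exact: cvg_cst|exact: cvg_id].
- have x0 : x @[x --> (0 : R)^'+] --> (0 : R).
    by apply: cvg_at_right_filter; exact: cvg_id.
  rewrite -[X in _ --> X](subrr (psi 0)); apply: cvgB.
    rewrite -[X in _ --> psi X](mulr0 h).
    apply: (cvg_continuous_comp (f := psi) (g := fun x => h * x)).
      by rewrite mulr0; apply: cpsi.
    by apply: cvgM; [exact: cvg_cst|exact: x0].
  by apply: cvg_continuous_comp x0; exact: cpsi.
move=> x x0 x1.
have hx0 : 0 < h * x by rewrite mulr_gt0.
have hx1 : h * x < 1 by rewrite mulr_ilt1// ltW.
(* Between [h * x] and [x] the function of [e] alone cancels exactly, and so do the two limits, both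
   equal to 2 (beta - alpha). *)
have : ((V (h * x) e - 7 * F 0) / e ^+ 2 -
     (Q (h * x / (1 - e)) + Q (h * x * (1 - e)) - 2 * Q (h * x)) / e ^+ 2) -
   ((V x e - 7 * F 0) / e ^+ 2 -
     (Q (x / (1 - e)) + Q (x * (1 - e)) - 2 * Q x) / e ^+ 2) @[e --> 0^'+] -->
   (W (h * x) - (- ln (1 - h * x) + (alpha - 1) * (h * x / (1 - h * x) ^+ 2))) -
   (W x - (- ln (1 - x) + (alpha - 1) * (x / (1 - x) ^+ 2))).
  apply: cvgB; apply: cvgB.
  - exact: V_cvg.
  - exact: Q_cvg.
  - exact: V_cvg.
  - exact: Q_cvg.
rewrite !WQ// subrr; apply: cvg_trans; apply: near_eq_cvg; near=> e.
have e0' : 0 < e by [].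
have e1 : e < 1 - h * x by near: e; apply: nbhs_right_lt; rewrite subr_gt0.
have e2 : e < 1 - x by near: e; apply: nbhs_right_lt; rewrite subr_gt0.
have := VE hx0 e0' e1; have := VE x0 e0' e2.
rewrite /psi !mulrA => E1 E2.
have -> : V (h * x) e = F (h * x / (1 - e)) + F (h * x * (1 - e)) - 2 * F (h * x) -
    (2 * F (1 - e) - sk_rhs z (1 - e)) by rewrite E2; ring.
have -> : V x e = F (x / (1 - e)) + F (x * (1 - e)) - 2 * F x -
    (2 * F (1 - e) - sk_rhs z (1 - e)) by rewrite E1; ring.
by ring.
Unshelve. all: by end_near. Qed.

Let FQ (x : R) : 0 < x -> x < 1 -> F x = F 0 + Q x.
Proof.
move=> x0 x1; suff : psi x = psi 0 by rewrite psi0 {1}/psi => <-; rewrite subrK.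
have hc : psi (h * x) @[h --> 0^'+] --> psi 0.
  rewrite -[X in _ --> psi X](mul0r x).
  apply: (cvg_continuous_comp (f := psi) (g := fun h => h * x)).
    by rewrite mul0r; exact: cpsi.
  by apply: cvgM; [apply: cvg_at_right_filter; exact: cvg_id|exact: cvg_cst].
apply/esym; apply: (cvg_unique _ hc) => //.
apply: cvg_near_cst; near=> h.
have h1 : h < 1 by near: h; apply: nbhs_right_lt; exact: ltr01.
exact: psi_cst.
Unshelve. all: by end_near. Qed.

(** The equation at the fixed point x = 1/2: its second difference tends to 0 by continuity and [V]
    tends to 7 F(0), so 2 F(1-e) tends to 2 z - 7 F(0). *)
Let F_cvg1 : F (1 - e) @[e --> 0^'+] --> z - 7 / 2 * F 0.
Proof.
have x0 : (0 : R) < 2^-1 by rewrite invr_gt0.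
have x1 : (2^-1 : R) < 1 by lra.
have e0 : e @[e --> (0 : R)^'+] --> (0 : R).
  by apply: cvg_at_right_filter; exact: cvg_id.
have e1c : 1 - e @[e --> (0 : R)^'+] --> (1 : R).
  by rewrite -[X in _ --> X]subr0; apply: cvgB => //; exact: cvg_cst.
have Vc : V 2^-1 e @[e --> 0^'+] --> 7 * F 0.
  have : (V 2^-1 e - 7 * F 0) / e ^+ 2 * (e * e) + 7 * F 0 @[e --> 0^'+] -->
      W 2^-1 * (0 * 0) + 7 * F 0.
    apply: cvgD; last exact: cvg_cst.
    by apply: cvgM; [exact: V_cvg|exact: (cvgM e0 e0)].
  rewrite mulr0 mulr0 add0r; apply: cvg_trans; apply: near_eq_cvg; near=> e.
  by rewrite -expr2 divfK ?subrK// expf_neq0// gt_eqF.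
have Fx := is_derive_continuous (dF x1).
have Zc : F (2^-1 / (1 - e)) + F (2^-1 * (1 - e)) - 2 * F 2^-1 @[e --> 0^'+] --> (0 : R).
  rewrite -[X in _ --> X](subrr (2 * F 2^-1)); apply: cvgB; last exact: cvg_cst.
  rewrite [X in _ --> X](_ : 2 * F 2^-1 = F 2^-1 + F 2^-1); last by ring.
  apply: cvgD; apply: (cvg_continuous_comp Fx); rewrite -[X in _ --> X]mulr1.
    apply: cvgM; first exact: cvg_cst.
    by rewrite -[X in _ --> X]invr1; apply: cvgV; [exact: oner_neq0|exact: e1c].
  by apply: cvgM; [exact: cvg_cst|exact: e1c].
have lnc : ln (1 - e) @[e --> (0 : R)^'+] --> (0 : R).
  by rewrite -[X in _ --> X](ln1 R); apply: cvg_continuous_comp e1c; exact: continuous_ln.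
have lnd : ln (1 - v) / v @[v --> (0 : R)^'+] --> (-1 : R).
  by apply: cvg_trans (@cvg_ln1B_div R); apply: cvg_app; exact: right0_dnbhs.
(* The unbounded factor [ln e] of the right-hand side is multiplied by [ln (1 - e) ^+ 2], of order
   e^2; the bound -e log e <= 1 suffices. *)
have e2ln : e * (e * ln e) @[e --> (0 : R)^'+] --> (0 : R).
  apply/cvgrPdist_le => d d0; near=> e.
  have e0' : 0 < e by [].
  have e1 : e < 1 by near: e; apply: nbhs_right_lt; exact: ltr01.
  have ed : e < d by near: e; apply: nbhs_right_lt.
  have ln0 : ln e <= 0 by rewrite ln_le0// ltW.
  have lnV' : ln e^-1 <= e^-1.
    have -> : e^-1 = 1 + (e^-1 - 1) by ring.
    apply: (le_trans (le_ln1Dx _)); last by lra.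
    have eV : 0 < e^-1 by rewrite invr_gt0.
    by lra.
  rewrite lnV ?posrE// in lnV'.
  have h : e * - ln e <= 1.
    by rewrite -(mulfV (lt0r_neq0 e0')) ler_wpM2l// ltW.
  rewrite sub0r normrN ler0_norm.
    rewrite -!mulrN; apply: (le_trans _ (ltW ed)).
    by rewrite -[leRHS]mulr1 ler_wpM2l// ltW.
  by rewrite pmulr_rle0// pmulr_rle0.
have rhsc : sk_rhs z (1 - e) @[e --> 0^'+] --> 2 * z.
  have : 2 * z - (ln (1 - e) / e) * (ln (1 - e) / e) * (e * (e * ln e)) +
     pi ^+ 2 / 3 * ln (1 - e) + ln (1 - e) * (ln (1 - e) * ln (1 - e)) / 3 @[e --> 0^'+] -->
     2 * z - (-1) * (-1) * 0 + pi ^+ 2 / 3 * 0 + 0 * (0 * 0) / 3.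
    apply: cvgD; first apply: cvgD; first apply: cvgB.
    - exact: cvg_cst.
    - by apply: cvgM; [exact: (cvgM lnd lnd)|exact: e2ln].
    - by apply: cvgM; [exact: cvg_cst|exact: lnc].
    - apply: cvgM; last exact: cvg_cst.
      by apply: cvgM; [exact: lnc|exact: (cvgM lnc lnc)].
  rewrite mulr0 subr0 mulr0 addr0 !mul0r addr0.
  apply: cvg_trans; apply: near_eq_cvg; near=> e.
  have eN0 : e != 0 by rewrite gt_eqF.
  by rewrite /sk_rhs subKr; field.
have : 2^-1 * (F (2^-1 / (1 - e)) + F (2^-1 * (1 - e)) - 2 * F 2^-1 +
    sk_rhs z (1 - e) - V 2^-1 e) @[e --> 0^'+] --> 2^-1 * (0 + 2 * z - 7 * F 0).
  apply: cvgM; first exact: cvg_cst.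
  by apply: cvgB; [apply: cvgD; [exact: Zc|exact: rhsc]|exact: Vc].
rewrite (_ : 2^-1 * (0 + 2 * z - 7 * F 0) = z - 7 / 2 * F 0); last by field.
apply: cvg_trans; apply: near_eq_cvg; near=> e.
have e0' : 0 < e by [].
have e2 : e < 1 - 2^-1 by near: e; apply: nbhs_right_lt; rewrite subr_gt0.
by rewrite (VE x0 e0' e2); field.
Unshelve. all: by end_near. Qed.

(** On ]0, 1[ one has F(1-e) = F(0) + L(1-e) - (alpha-1) log e. As F(1-e) and L(1-e) converge while
    log e does not, alpha = 1; comparing limits then leaves (1 + 7/2) F(0) = 0. *)
Let alpha1_F0 : alpha = 1 /\ F 0 = 0.
Proof.
have Lc : L (1 - e) @[e --> 0^'+] --> z.
  rewrite zL; apply: (cvg_comp (fun e => 1 - e) L _ (trilogarithm_cvg1 hL)).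
  move=> P [d /= d0 dP]; exists d => //= e ed e0.
  by apply: dP => /=; [rewrite opprB addrC subrK -normrN -sub0r|rewrite gtrBl].
have key : (alpha - 1) * ln e @[e --> 0^'+] --> 9 / 2 * F 0.
  have : F 0 + L (1 - e) - F (1 - e) @[e --> 0^'+] --> F 0 + z - (z - 7 / 2 * F 0).
    by apply: cvgB; [apply: cvgD; [exact: cvg_cst|exact: Lc]|exact: F_cvg1].
  rewrite (_ : F 0 + z - _ = 9 / 2 * F 0); last by field.
  apply: cvg_trans; apply: near_eq_cvg; near=> e.
  have e0' : 0 < e by [].
  have e1 : e < 1 by near: e; apply: nbhs_right_lt; exact: ltr01.
  by rewrite (@FQ (1 - e)) ?subr_gt0 ?gtrBl// /Q subKr; ring.
have lnV0 : (ln e)^-1 @[e --> (0 : R)^'+] --> (0 : R).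
  apply/(ltr0_cvgV0 (f := @ln R)); last exact: lnNy.
  near=> e; apply: ln_lt0.
  by apply/andP; split => //; near: e; apply: nbhs_right_lt; exact: ltr01.
have a1 : alpha = 1.
  have c0 : (alpha - 1) * ln e * (ln e)^-1 @[e --> 0^'+] --> 9 / 2 * F 0 * 0.
    exact: (cvgM key lnV0).
  apply/eqP; rewrite -subr_eq0; apply/eqP.
  rewrite -[RHS](mulr0 (9 / 2 * F 0)).
  apply/esym; apply: (cvg_unique _ c0) => //; apply: cvg_near_cst; near=> e.
  rewrite mulfK// lt_eqF// ln_lt0//.
  by apply/andP; split => //; near: e; apply: nbhs_right_lt; exact: ltr01.
split => //.
have : (0 : R) = 9 / 2 * F 0.
  apply/esym; apply: (cvg_unique _ key) => //; apply: cvg_near_cst; near=> e.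
  by rewrite a1 subrr mul0r.
lra.
Unshelve. all: by end_near. Qed.

Let FL_pos (x : R) : 0 < x -> x < 1 -> F x = L x.
Proof.
move=> x0 x1; have [a1 F00] := alpha1_F0.
by rewrite FQ// F00 add0r /Q a1 subrr mul0r subr0.
Qed.

(** Landen's identity for the dilogarithm, which is [mulX_derive L]. Both sides vanish at 0, and
    their difference has derivative 0 by the differential equation and 1 - vee(t) = 1/(1-t). *)
Let landenL (u : R) : 0 < u -> u < 1 ->
  mulX_derive L u + mulX_derive L (vee u) = - 2^-1 * ln (1 - u) ^+ 2.
Proof.
move=> u0 u1; set g := mulX_derive L.
have vee1 (t : R) : 0 <= t -> t < 1 -> vee t < 1.
  by move=> t0 t1; rewrite /vee (@le_lt_trans _ _ 0)// mulr_ge0_le0// invr_le0; lra.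
have dg (t : R) : t < 1 -> is_derive t 1 g (g^`()%classic t).
  by move=> t1; apply: DeriveDef; [case: (trilogarithm_derivable hL t1)|rewrite derive1E].
have gode (t : R) : t < 1 -> t * g^`()%classic t = - ln (1 - t).
  by move=> t1; rewrite -(trilogarithm_ode hL t1).
have dv (t : R) : t < 1 -> is_derive t 1 vee (- (1 - t) ^- 2).
  move=> t1; rewrite (_ : vee = (fun x => - (x / (1 - x)))).
    exact: (@is_derive_sk_lam R 4 t t1).
  by apply/funext => x; rewrite /vee -opprB invrN mulrN.
pose T (t : R) := g t + g (vee t) + 2^-1 * (ln (1 - t) * ln (1 - t)).
pose dT (t : R) := g^`()%classic t + g^`()%classic (vee t) * (- (1 - t) ^- 2) +
   2^-1 * (ln (1 - t) * - (1 - t)^-1 + ln (1 - t) * - (1 - t)^-1).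
have TdT (t : R) : 0 <= t -> t < 1 -> is_derive t 1 T (dT t).
  move=> t0 t1; have dl := is_derive_ln1B t1.
  have A := is_derive1_comp (dg _ (vee1 t t0 t1)) (dv t t1).
  exact: (is_deriveD (is_deriveD (dg t t1) A) (is_deriveZ 2^-1 (is_deriveM dl dl))).
have [||c] := @MVT R T dT 0 u u0.
- by move=> t; rewrite in_itv/= => /andP[t0 tu]; apply: TdT; [exact: ltW|exact: lt_trans u1].
- apply: within_itv_continuous => t /andP[t0 tu].
  by apply: is_derive_continuous (TdT t _ _) => //; exact: le_lt_trans u1.
rewrite in_itv/= => /andP[c0 cu]; have c1 := lt_trans cu u1.
have cN0 : c != 0 by rewrite gt_eqF.
have c1N0 : 1 - c != 0 by rewrite gt_eqF// subr_gt0.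
have -> : dT c = 0.
  have v1 := vee1 c (ltW c0) c1.
  have E1 : 1 - vee c = (1 - c)^-1.
    by rewrite /vee; field; rewrite c1N0 -oppr_eq0 opprB c1N0.
  have vE : vee c = - (c / (1 - c)) by rewrite /vee -opprB invrN mulrN.
  have vN0 : vee c != 0 by rewrite vE oppr_eq0 mulf_neq0// invr_neq0.
  have g1 : g^`()%classic c = - ln (1 - c) / c by rewrite -gode// mulrC mulKf.
  have g2 : g^`()%classic (vee c) = ln (1 - c) / vee c.
    have := gode _ v1; rewrite E1 lnV ?posrE ?subr_gt0// opprK => <-.
    by rewrite mulrC mulKf.
  by rewrite /dT g1 g2 vE; field; rewrite cN0 c1N0.
rewrite mul0r /T /vee mul0r subr0 ln1 mul0r mulr0 addr0 -/(vee u).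
have -> : g 0 = 0 by rewrite /g /mulX_derive mul0r.
by rewrite expr2 => E; lra.
Qed.

Lemma spence_kummer_unique (x : R) : x < 1 -> F x = L x.
Proof.
have [a1 F00] := alpha1_F0.
move=> x1; have [x0|x0|->] := ltgtP x 0; last by rewrite F00 (trilogarithm0 hL).
  (* [F] and [L] obey the same first-order relation and coincide near [vee v], in ]0, 1[; hence
     their derivatives agree at v = vee(vee v). *)
  have dFL (v : R) : v < 0 -> F' v = L^`()%classic v.
    move=> v0; have v1N : v - 1 != 0 by rewrite lt_eqF//; lra.
    have u0 : 0 < vee v by rewrite /vee -mulrNN -invrN divr_gt0//; lra.
    have u1 : vee v < 1.
      by rewrite /vee -mulrNN -invrN ltr_pdivrMr; lra.
    have vv : vee (vee v) = v.
      have E : v / (v - 1) - 1 = (v - 1)^-1 by field.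
      by rewrite {1}/vee {2}/vee E invrK /vee divfK.
    have FLu : F' (vee v) = L^`()%classic (vee v).
      apply: is_derive_derive1; apply: near_eq_is_derive (dL u1).
      near=> t; rewrite FL_pos//.
        by near: t; exact: lt_nbhsr.
      by near: t; exact: lt_nbhsl.
    have E : vee v * F' (vee v) + vee (vee v) * F' (vee (vee v)) =
      - 2^-1 * ln (1 - vee v) ^+ 2 := spence_kummer_landen FE mF F0d u0 u1.
    move: E; rewrite -(landenL u0 u1) FLu /mulX_derive vv.
    by move=> /addrI/mulfI; apply; rewrite lt_eqF.
  have [||c] := @MVT R (fun t => F t - L t) (fun t => F' t - L^`()%classic t) x 0 x0.
  - move=> t; rewrite in_itv/= => /andP[_ t0]; apply: is_deriveB.
      by apply: dF; exact: lt_trans ltr01.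
    by apply: dL; exact: lt_trans ltr01.
  - apply: within_itv_continuous => t /andP[_ t0]; have t1 := le_lt_trans t0 ltr01.
    by apply: cvgB; [exact: is_derive_continuous (dF t1)|exact: is_derive_continuous (dL t1)].
  rewrite in_itv/= => /andP[_ c0]; rewrite (dFL c c0) F00 (trilogarithm0 hL).
  by rewrite !subrr mul0r sub0r => /eqP; rewrite oppr_eq0 subr_eq0 => /eqP.
exact: FL_pos.
Unshelve. all: by end_near. Qed.

End second_order.

Theorem theoremD (R : realType) (Li3 : R -> R) (hLi3 : is_trilogarithm Li3)
  (F : R -> R) (hFm : lebesgue_measurable_fun `]-oo, 1[ F)
  (hFeq : forall x y : R, 0 < x -> x < y -> y < 1 ->
     2 * F x + 2 * F y - F (x / y)
     + 2 * F ((1 - y) / (1 - x))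
     + 2 * F ((x * (1 - y)) / (y * (1 - x)))
     - F (x * y)
     + 2 * F ((x * (1 - y)) / (x - 1))
     + 2 * F ((1 - y) / (y * (x - 1)))
     - F ((x * (1 - y) ^+ 2) / (y * (1 - x) ^+ 2))
     = R3 Li3 x y)
  (hF0 : derivable F 0 1) :
  forall x : R, x < 1 -> F x = Li3 x.
Proof.
move=> x; apply: (@spence_kummer_unique R (Li3 1) F _ hFm hF0 Li3 hLi3 erefl).
by move=> s t s0 st t1; rewrite hFeq.
Qed.
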